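(* Let $\mathbf E$ be a solid, translation invariant BF space on $\mathcal G$, let $w$ be an admissible weight for $\mathbf E$, and let $\mathbf S$ be a closed complemented subspace of $\mathbf E$. Let $P: W(L^1,L^\infty_{1/w})\to L^\infty_{1/w}$ be a bounded linear operator with $P(\mathbf E)=\mathbf S$ and $P(f)=f$ for all $f\in\mathbf S$, and let $H\in W(L^\infty,L^1_w)\cap W_R(L^\infty,L^1_w)$ be a function such that for all $f\in W(L^1,L^\infty_{1/w})$ $$|P(f)(x)|\le \int_{\mathcal G}|f(y)|\,H(y^{-1}x)\,dy\qquad(x\in\mathcal G).$$ Let $\Gamma\subseteq\mathcal G$ be relatively separated and let $\{\eta_\gamma\}_{\gamma\in\Gamma}$ be functions on $\mathcal G$ for which there is $g\in W_R^{\rm weak}(L^\infty,L^1_w)$ with $|\eta_\gamma(x)|\le g(\gamma^{-1}x)$ for all $x\in\mathcal G$, $\gamma\in\Gamma$, and such that $\sum_\gamma\eta_\gamma\equiv1$ and $\sum_\gamma|\eta_\gamma|\in L^\infty(\mathcal G)$. Let $\mathbf B$ be a solid, isometrically left-translation invariant BF space with $W(L^\infty,L^1_w)\hookrightarrow\mathbf B$. Then the map $$C^{\mathbf B}:\mathbf S\to\mathbf E_{d,\mathbf B}(\Gamma),\qquad f\mapsto (P(f\eta_\gamma))_{\gamma\in\Gamma}$$ is (well-defined, bounded and) left-invertible. Consequently, there are constants $0<c\le C<\infty$ such that for all $f\in\mathbf S$, $$c\,\|f\|_{\mathbf E}\le \big\|(\|P(f\eta_\gamma)\|_{\mathbf B})_{\gamma}\big\|_{\mathbf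 E_d(\Gamma)}\le C\,\|f\|_{\mathbf E}.$$
   Context: Group. $\mathcal G$ is a locally compact, $\sigma$-compact topological group with identity $e$, left Haar measure (used for all integrals) and modular function $\Delta$. $V$ is a fixed symmetric ($V=V^{-1}$) relatively compact neighborhood of $e$. $L_xf(y)=f(x^{-1}y)$, $R_xf(y)=f(yx)$, $f*g(x)=\int f(y)g(y^{-1}x)\,dy$. A set $\Gamma\subseteq\mathcal G$ is relatively separated if $\sup_{x}\#(\Gamma\cap xV)<\infty$. BF spaces and weights. A BF space is a Banach space of functions on $\mathcal G$ continuously embedded in $L^1_{\rm loc}(\mathcal G)$. It is solid if $f\in\mathbf E$, $g$ measurable and $|g|\le|f|$ a.e. imply $g\in\mathbf E$ and $\|g\|_{\mathbf E}\le\|f\|_{\mathbf E}$. For a weight $\nu>0$, $\|f\|_{L^p_\nu}=\|f\nu\|_{L^p}$. A solid BF space $\mathbf E$ is translation invariant if $L_x\mathbf E\subseteq\mathbf E$ and $R_x\mathbf E\subseteq\mathbf E$ for all $x$, and $L^1_u*\mathbf E\subseteq\mathbf E$, $\mathbf E*L^1_v\subseteq\mathbf E$ with the corresponding norm estimates, where $u(x)=\|L_x\|_{\mathbf E\to\mathbf E}$, $v(x)=\Delta(x^{-1})\|R_{x^{-1}}\|_{\mathbf E\to\mathbf E}$. It is isometrically left-translation invariant if in addition all $L_x$ are isometries of it. An admissible weight is a locally bounded $w:\mathcal G\to(0,\infty)$ with $w(x)=\Delta(x^{-1})w(x^{-1})$ and $w(xy)\le w(x)w(y)$; it is admissible for $\mathbf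 E$ if moreover $w(x)\ge C_{\mathbf E,w}\max\{u(x),u(x^{-1}),v(x),\Delta(x^{-1})v(x^{-1})\}$ for some constant $C_{\mathbf E,w}>0$. Amalgam spaces. For solid translation invariant $\mathbf A$ (local component) and $\mathbf E$ (global component), $W(\mathbf A,\mathbf E)$ is the space of $f\in\mathbf A_{\rm loc}$ such that $x\mapsto\|f\chi_{xV}\|_{\mathbf A}$ belongs to $\mathbf E$, normed by the $\mathbf E$-norm of this function; $W_R(\mathbf A,\mathbf E)$ is defined in the same way using $x\mapsto\|f\chi_{Vx^{-1}}\|_{\mathbf A}$. $W_R^{\rm weak}(L^\infty,L^1_w)=\{f\in L^1_{\rm loc}: |f|*\chi_V\in W_R(L^\infty,L^1_w)\}$ with norm $\||f|*\chi_V\|_{W_R(L^\infty,L^1_w)}$. One has $\mathbf E\hookrightarrow W(L^1,L^\infty_{1/w})$, so $P$ is defined on $\mathbf E$. Discrete spaces. For $\Gamma$ relatively separated, $\mathbf E_d(\Gamma)=\{c\in\mathbb C^\Gamma:\sum_\gamma|c_\gamma|\chi_{\gamma V}\in\mathbf E\}$ with norm $\|\sum_\gamma|c_\gamma|\chi_{\gamma V}\|_{\mathbf E}$, and $\mathbf E_{d,\mathbf B}(\Gamma)=\{c\in\mathbf B^\Gamma:(\|c_\gamma\|_{\mathbf B})_\gamma\in\mathbf E_d(\Gamma)\}$ with norm $\|(\|c_\gamma\|_{\mathbf B})_\gamma\|_{\mathbf E_d}$. Left-invertible means: has a bounded linear left inverse $\mathbf E_{d,\mathbf B}(\Gamma)\to\mathbf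 S$. *)

(* Defs.v *)
From HB Require Import structures.
From mathcomp Require Import all_boot all_order all_algebra finmap.
From mathcomp Require Import complex.
From mathcomp Require Import all_classical all_reals all_analysis.

Set Implicit Arguments.
Unset Strict Implicit.
Unset Printing Implicit Defensive.

Import Order.TTheory GRing.Theory Num.Theory.
Import numFieldNormedType.Exports.

Local Open Scope classical_set_scope.
Local Open Scope complex_scope.
Local Open Scope ring_scope.

(* The distinguished point of [G] plays no role; the library asks for one to
   put a sigma-algebra on a type. *)
HB.mixin Record isTopologicalGroup G of PointedTopological G & Group G := {
  mulg_continuous : continuous (fun p : G * G => (p.1 * p.2)%g) ;
  invg_continuous : continuous (fun x : G => (x^-1)%g)
}.

#[short(type="topologicalGroupType")]
HB.structure Definition TopologicalGroup :=
  {G of PointedTopological G & Group G & isTopologicalGroup G}.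

Definition borel (G : ptopologicalType) := g_sigma_algebraType (@open G).

(* The modulus of a complex number, as an element of [R]. *)
Definition cmod (R : realType) (z : R[i]) : R := Normc.normc z.

Definition toC (R : realType) (T : Type) (f : T -> R) : T -> R[i] :=
  fun x => (f x)%:C.

Section TopologicalGroups.
Variable G : topologicalGroupType.
Implicit Types (x : G) (A V : set G).

Definition ltranslate A x : set G := [set (x * y)%g | y in A].
Definition rtranslate A x : set G := [set (y * x)%g | y in A].

Definition sigma_compact : Prop :=
  exists K : nat -> set G,
    (forall n, compact (K n)) /\ \bigcup_n K n = [set: G].

(* Measurability of [V] is what makes the functions [f * chi_(xV)]
   measurable. *)
Definition window V : Prop :=
  [/\ nbhs (1%g : G) V, [set (y^-1)%g | y in V] = V,
      compact (closure V) & measurable (V : set (borel G))].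

Definition relatively_separated V (Gam : set G) : Prop :=
  exists N : nat, forall x, (Gam `&` ltranslate V x #<= `I_N)%card.

End TopologicalGroups.

Section Haar.
Variables (R : realType) (G : topologicalGroupType).
Variable mu : {measure set (borel G) -> \bar R}.

Definition left_haar : Prop :=
  [/\ (0 < mu [set: G])%E,
      forall K : set G, compact K -> (mu K < +oo)%E,
      forall (x : G) (A : set (borel G)), measurable A ->
        mu (ltranslate A x) = mu A,
      forall A : set (borel G), measurable A ->
        mu A = ereal_inf [set mu U | U in [set U : set G | open U /\ A `<=` U]]
    & forall U : set G, open U ->
        mu U = ereal_sup
          [set mu K | K in [set K : set G | compact K /\ K `<=` U]]].

(* This determines [Delta], since some Borel set has finite positive
   measure. *)
Definition modular_function (Delta : G -> R) : Prop :=
  forall (x : G) (A : set (borel G)), measurable A ->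
    mu (rtranslate A x) = ((Delta x)%:E * mu A)%E.

End Haar.

(* A subspace of [V] together with a seminorm on it.  Spaces of functions modulo
   null sets are handled by keeping genuine functions as elements: functions
   that agree almost everywhere are at distance 0, and equality of classes is
   [nrm X (f - g) = 0]. *)
Record nspace (R : realType) (V : lmodType R[i]) := NSpace {
  carrier :> V -> Prop ;
  nrm : V -> R
}.

Section NormedSpaces.
Variable R : realType.
Local Notation C := R[i].
Implicit Types V W : lmodType C.

Definition seminormed V (X : nspace V) : Prop :=
  [/\ X 0, forall a f g, X f -> X g -> X (a *: f + g),
      forall f, X f -> 0 <= nrm X f,
      forall a f, X f -> nrm X (a *: f) = cmod a * nrm X f
    & forall f g, X f -> X g -> nrm X (f + g) <= nrm X f + nrm X g].

Definition norm_complete V (X : nspace V) : Prop :=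
  forall u : nat -> V, (forall n, X (u n)) ->
    (forall e : R, 0 < e -> exists N : nat, forall m n : nat,
      (N <= m)%N -> (N <= n)%N -> nrm X (u m - u n) < e) ->
    exists2 f, X f & (fun n => nrm X (u n - f)) @ \oo --> (0 : R).

Definition embedded V (X Y : nspace V) : Prop :=
  (forall f, X f -> Y f) /\
  exists C0 : R, forall f, X f -> nrm Y f <= C0 * nrm X f.

(* Linearity and boundedness imply that [T] descends to classes. *)
Definition bounded_linear V W (X : nspace V) (Y : nspace W) (T : V -> W) :
    Prop :=
  [/\ forall f, X f -> Y (T f),
      forall a f g, X f -> X g ->
        nrm Y (T (a *: f + g) - (a *: T f + T g)) = 0
    & exists C0 : R, forall f, X f -> nrm Y (T f) <= C0 * nrm X f].

Definition left_invertible V W (X : nspace V) (Y : nspace W) (T : V -> W) :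
    Prop :=
  exists2 D : W -> V, bounded_linear Y X D &
    forall f, X f -> nrm X (D (T f) - f) = 0.

Definition closed_subspace V (S : V -> Prop) (X : nspace V) : Prop :=
  [/\ forall f, S f -> X f, S 0,
      forall a f g, S f -> S g -> S (a *: f + g)
    & forall f, X f ->
        (forall e : R, 0 < e -> exists2 s, S s & nrm X (f - s) < e) -> S f].

Definition closed_complemented V (S : V -> Prop) (X : nspace V) : Prop :=
  closed_subspace S X /\
  exists T : V -> Prop,
    [/\ closed_subspace T X,
        forall f, X f -> exists s t, [/\ S s, T t & f = s + t]
      & forall f, S f -> T f -> nrm X f = 0].

Definition subnspace V (S : V -> Prop) (X : nspace V) : nspace V :=
  NSpace S (nrm X).

(* For a bounded operator; the set below is then bounded above, as [sup]
   requires. *)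
Definition opnorm V (X : nspace V) (T : V -> V) : R :=
  sup [set nrm X (T f) | f in [set f | X f /\ nrm X f <= 1]].

End NormedSpaces.

Section FunctionSpaces.
Variables (R : realType) (G : topologicalGroupType).
Variables (mu : {measure set (borel G) -> \bar R}) (Delta : G -> R) (V : set G).
Local Notation C := R[i].
Local Notation fspace := (nspace (G -> C)).
Implicit Types (E A B : fspace) (f g : G -> C) (x : G) (w : G -> R).

Definition Ltrans x f : G -> C := fun y => f (x^-1 * y)%g.
Definition Rtrans x f : G -> C := fun y => f (y * x)%g.

Definition measurable_cfun f : Prop :=
  measurable_fun [set: borel G] (fun x => complex.Re (f x)) /\
  measurable_fun [set: borel G] (fun x => complex.Im (f x)).

Definition cintegral f : C :=
  (\int[mu]_x (complex.Re (f x))) +i* (\int[mu]_x (complex.Im (f x))).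

Definition cintegrable f : Prop :=
  measurable_cfun f /\ (\int[mu]_x (cmod (f x))%:E < +oo)%E.

Definition convol f g : G -> C :=
  fun x => cintegral (fun y => f y * g (y^-1 * x)%g).

Definition convol_defined f g : Prop :=
  \forall x \ae mu, cintegrable (fun y => f y * g (y^-1 * x)%g).

Definition L1loc f : Prop :=
  measurable_cfun f /\ forall K : set G, compact K ->
    (\int[mu]_(x in (K : set (borel G))) (cmod (f x))%:E < +oo)%E.

Definition BF_space E : Prop :=
  [/\ seminormed E /\ norm_complete E,
      forall f g, E f -> measurable_cfun g -> (\forall x \ae mu, f x = g x) -> E g,
      forall f, E f -> (nrm E f = 0 <-> \forall x \ae mu, f x = 0),
      forall f, E f -> L1loc f
    & forall K : set G, compact K -> exists C0 : R, forall f, E f ->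
        (\int[mu]_(x in (K : set (borel G))) (cmod (f x))%:E
           <= (C0 * nrm E f)%:E)%E].

Definition solid E : Prop :=
  forall f g, E f -> measurable_cfun g ->
    (\forall x \ae mu, cmod (g x) <= cmod (f x)) ->
    E g /\ nrm E g <= nrm E f.

Definition Lp (p : \bar R) w : fspace :=
  NSpace
    (fun f => [/\ measurable_cfun f,
       measurable_fun [set: borel G] (fun x => cmod (f x) * w x)
     & (Lnorm mu p (fun x : borel G => (cmod (f x) * w x)%:E) < +oo)%E])
    (fun f => fine (Lnorm mu p (fun x : borel G => (cmod (f x) * w x)%:E))).

Definition uweight E x : R := opnorm E (Ltrans x).
Definition vweight E x : R := Delta (x^-1)%g * opnorm E (Rtrans (x^-1)%g).

(* Measurability of the two weights is implicit in the use of the spaces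
   [L^1_u] and [L^1_v]. *)
Definition translation_invariant E : Prop :=
  [/\ forall x f, E f -> E (Ltrans x f) /\ E (Rtrans x f),
      measurable_fun [set: borel G] (uweight E),
      measurable_fun [set: borel G] (vweight E),
      forall f g, Lp 1%:E (uweight E) f -> E g ->
        [/\ convol_defined f g, E (convol f g)
          & nrm E (convol f g) <= nrm (Lp 1%:E (uweight E)) f * nrm E g]
    & forall f g, E f -> Lp 1%:E (vweight E) g ->
        [/\ convol_defined f g, E (convol f g)
          & nrm E (convol f g) <= nrm E f * nrm (Lp 1%:E (vweight E)) g]].

Definition solid_TI_BF E : Prop :=
  [/\ BF_space E, solid E & translation_invariant E].

Definition solid_isometric_TI_BF E : Prop :=
  solid_TI_BF E /\ forall x f, E f -> nrm E (Ltrans x f) = nrm E f.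

(* Measurability of [w] is implicit in the use of the spaces [L^p_w]. *)
Definition admissible_weight w : Prop :=
  [/\ measurable_fun [set: borel G] w, forall x, 0 < w x,
      forall x, exists M : R, \forall y \near x, w y <= M,
      forall x, w x = Delta (x^-1)%g * w (x^-1)%g
    & forall x y, w (x * y)%g <= w x * w y].

Definition admissible_for E w : Prop :=
  admissible_weight w /\
  exists2 C0 : R, 0 < C0 & forall x,
    w x >= C0 * Num.max (Num.max (uweight E x) (uweight E (x^-1)%g))
                        (Num.max (vweight E x)
                                 (Delta (x^-1)%g * vweight E (x^-1)%g)).

Definition cutoff (K : set G) f : G -> C := fun x => (\1_K x : R)%:C * f x.

Definition locally_in A f : Prop :=
  measurable_cfun f /\ forall K : set G, compact K -> A (cutoff K f).

Definition control A f : G -> R := fun x => nrm A (cutoff (ltranslate V x) f).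
Definition controlR A f : G -> R :=
  fun x => nrm A (cutoff (rtranslate V (x^-1)%g) f).

Definition amalgam A E : fspace :=
  NSpace (fun f => locally_in A f /\ E (toC (control A f)))
         (fun f => nrm E (toC (control A f))).

Definition amalgamR A E : fspace :=
  NSpace (fun f => locally_in A f /\ E (toC (controlR A f)))
         (fun f => nrm E (toC (controlR A f))).

Definition Linf : fspace := Lp +oo%E (fun=> 1).
Definition L1 : fspace := Lp 1%:E (fun=> 1).
Definition L1w w : fspace := Lp 1%:E w.
Definition Linf_inv w : fspace := Lp +oo%E (fun x => (w x)^-1).

Definition smear f : G -> C :=
  convol (toC (fun x => cmod (f x))) (toC (fun x => \1_V x : R)).

Definition weak_amalgamR w : fspace :=
  NSpace (fun f => L1loc f /\ amalgamR Linf (L1w w) (smear f))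
         (fun f => nrm (amalgamR Linf (L1w w)) (smear f)).

Section Sequences.
Variables (E B : fspace) (Gam : set G).

(* When [Gam] is relatively separated the sum has, at each point, finitely many
   nonzero terms. *)
Definition steps (c : Gam -> C) : G -> R :=
  fun x => \sum_(gam \in [set: Gam])
             (cmod (c gam) * \1_(ltranslate V (\val gam)) x).

Definition Ed : nspace (Gam -> C) :=
  NSpace (fun c => E (toC (steps c))) (fun c => nrm E (toC (steps c))).

Definition norms (c : Gam -> G -> C) : Gam -> C :=
  toC (fun gam => nrm B (c gam)).

Definition EdB : nspace (Gam -> G -> C) :=
  NSpace (fun c => (forall gam, B (c gam)) /\ Ed (norms c))
         (fun c => nrm Ed (norms c)).

End Sequences.

(* Unconditional convergence: [l] is the limit of the finite partial sums along
   the finite subsets of [I]. *)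
Definition unconditional_sum (I : choiceType) (a : I -> C) (l : C) : Prop :=
  forall e : R, 0 < e -> exists F0 : {fset I}, forall F : {fset I},
    (F0 `<=` F)%fset -> cmod (\sum_(i <- F) a i - l) < e.

End FunctionSpaces.

(* Main.v *)
Require Import Defs.
From HB Require Import structures.
From mathcomp Require Import all_boot all_order all_algebra finmap complex.
From mathcomp Require Import all_classical all_reals all_analysis.
From mathcomp Require Import measurable_realfun ess_sup_inf lra ring.
Set Implicit Arguments.
Unset Strict Implicit.
Unset Printing Implicit Defensive.
Import Order.TTheory GRing.Theory Num.Theory.
Import numFieldNormedType.Exports.
Local Open Scope classical_set_scope.
Local Open Scope ring_scope.

(* The idea: sample [f] in [S] by [c_gam = P(f eta_gam)] and resynthesise it as
   [Phi_U(c) = sum_gam c_gam chi_(gam U)] with [U] compact and large.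

   For [f] in [S] one has [|f| = |P f| <= |f| * |H|], so [f] lies below a function
   whose local maxima are again controlled by an element of [E].  This turns the
   coefficients [int |f| |eta_gam|] into values, near [gam], of one element of
   [E], although [g] is only controlled after smearing with [chi_V]; hence the
   sampling map is bounded.

   Since [f = P f = sum_gam P(f eta_gam)], the error [f - Phi_U(c)] only involves
   points [x] outside [gam U], where either [y^-1 x] is large, so that a tail of
   [H] appears, or [gam^-1 y] is large, so that a tail of [g] appears.  By Young's
   inequality the error tends to [0] in the operator norm as [U] grows, and so
   [f |-> P (P (Phi_U (c)))] is invertible on [S] by a Neumann series.

   Two points need care.  The Borel sigma-algebra of [G * G] need not be the
   product one when [G] is not second countable, so Tonelli's theorem is needed
   for Borel functions on [G * G]; it follows from inner regularity on open sets.
   And the translations are only assumed to preserve [E]: their boundedness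
   follows from positivity and completeness. *)

(** [P] is applied twice in the reconstruction because membership of the [c_gam] in [B] only
    controls their integrals over compact sets: [Phi_U(c)] is not known to lie in [E], whereas its
    convolution with [|H|] lies below an element of [E]. The inner [P] brings the synthesis into
    [E], the outer one into [S].

    The two amalgam norms of [H] have different uses. The left one yields a majorant of [|f| * |H|]
    that tolerates a shift of the variable [x -> x v]. The right one tolerates a shift of the base
    point [y -> y v] in [H (y^-1 x)], which is what pairing against local integrals requires.

    The tail of the majorant of [g] enters without a weight, so [w] has to be bounded below. This
    holds as soon as [E] has an element of nonzero norm, and the degenerate case is separated at the
    end.

    Elements are functions and not classes, so identities hold off null sets that depend on the
    functions involved. Countability of [Gam] keeps the union of these sets null, and the left
    inverse is linear modulo norm [0]. *)

Section step_functions.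
Context {R : realType}.
Local Open Scope ring_scope.

(** A number exceeds the layers of height [d] lying strictly below it by at most [d]. Strict
    inequalities are used because the Tonelli argument needs open superlevel sets. *)
Lemma le_staircase (d : R) (N : nat) (r : R) : 0 < d -> r <= N.+1%:R * d ->
  r <= d + \sum_(k < N) d * (k.+1%:R * d < r)%R%:R.
Proof.
move=> d0; elim: N r => [|N IH] r; first by rewrite big_ord0 addr0 mul1r.
move=> rN; have [/IH {}IH|rN1] := leP r (N.+1%:R * d).
  rewrite big_ord_recr/= addrA; apply: (le_trans IH).
  by rewrite lerDl mulr_ge0// ltW.
apply: (le_trans rN); rewrite (eq_bigr (fun=> d)).
  by rewrite sumr_const card_ord -[X in X + _]mulr1n -mulrnDr add1n mulr_natl.
move=> k _; rewrite (_ : _ < r) ?mulr1//; apply: le_lt_trans rN1.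
by rewrite ler_pM2r// ler_nat.
Qed.

(** The largest selected index [k] alone gives [k.+1 * d <= r], and at most [k.+1] indices are
    selected, whichever they are. *)
Lemma staircase_le (d : R) (N : nat) (b : nat -> bool) (r : R) : 0 < d ->
  0 <= r -> (forall k, (k < N)%N -> b k -> k.+1%:R * d <= r) ->
  \sum_(k < N) d * (b k)%:R <= r.
Proof.
move=> d0 r0; elim: N => [|N IH] br; first by rewrite big_ord0.
have [bN|/negbTE bN] := boolP (b N); last first.
  rewrite big_ord_recr/= bN mulr0 addr0; apply: IH => k kN; apply: br.
  exact: ltnW.
apply: le_trans (br N (ltnSn N) bN).
rewrite (le_trans (ler_sum _ (G := fun=> d) _))//.
  by move=> k _; rewrite -[leRHS]mulr1 ler_pM2l// lern1; case: (b k).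
by rewrite sumr_const card_ord mulr_natl.
Qed.

End step_functions.

(** * Induction over nonnegative measurable functions *)

Section mfun_ind.
Local Open Scope ereal_scope.
Import HBNNSimple.
Context d (T : measurableType d) (R : realType).

Lemma ge0_mfun_ind (P : (T -> \bar R) -> Prop) :
  (forall A, measurable A -> P (EFin \o \1_A)) ->
  (forall (c : R) (f : T -> \bar R), (0 <= c)%R -> measurable_fun setT f ->
    (forall x, 0 <= f x) -> P f -> P (fun x => c%:E * f x)) ->
  (forall f g : T -> \bar R, measurable_fun setT f -> measurable_fun setT g ->
    (forall x, 0 <= f x) -> (forall x, 0 <= g x) ->
    P f -> P g -> P (f \+ g)) ->
  (forall (f : (T -> \bar R)^nat) (g : T -> \bar R),
    (forall n, measurable_fun setT (f n)) -> (forall n x, 0 <= f n x) ->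
    (forall x, {homo f ^~ x : m n / (m <= n)%N >-> m <= n}) ->
    (forall x, f n x @[n --> \oo] --> g x) ->
    (forall n, P (f n)) -> P g) ->
  forall f : T -> \bar R, measurable_fun setT f -> (forall x, 0 <= f x) -> P f.
Proof.
move=> PI PZ PD PL f mf f0.
have Psum (s : seq R) (h : R -> T -> \bar R) :
    (forall k, measurable_fun setT (h k)) ->
    (forall k x, 0 <= h k x) -> (forall k, P (h k)) ->
    P (fun x => \sum_(k <- s) h k x).
  move=> mh h0 Ph; elim: s => [|k s IH].
    under eq_fun do rewrite big_nil.
    suff -> : (fun=> 0) = EFin \o \1_(@set0 T) :> (T -> \bar R) by exact: PI.
    by apply/funext => x /=; rewrite indic0.
  under eq_fun do rewrite big_cons.
  apply: (PD (h k) (fun x => \sum_(k <- s) h k x)) => //.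
    exact: emeasurable_sum.
  by move=> x; apply: sume_ge0.
have Pnn (g : {nnsfun T >-> R}) : P (EFin \o g).
  have mI y : measurable_fun setT (EFin \o \1_(g @^-1` [set y]) : T -> \bar R).
    exact/measurable_EFinP/measurable_indic.
  (* The summands must be nonnegative for every real [y], not only for values of [g], so the
     coefficient is [|y|]; on the range of [g] it equals [y]. *)
  rewrite (_ : EFin \o g = fun x => \sum_(y <- fset_set (range g))
      `|y|%:E * (\1_(g @^-1` [set y]) x)%:E).
    apply: (Psum _ (fun y x => `|y|%:E * (\1_(g @^-1` [set y]) x)%:E)).
    - by move=> y; apply: measurable_funeM; apply: mI.
    - by move=> y x; rewrite mule_ge0// lee_fin.
    - move=> y; apply: (PZ `|y|%R (EFin \o \1_(g @^-1` [set y]))) => //.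
        by move=> x; rewrite /= lee_fin.
      exact: PI.
  apply/funext => x /=; rewrite [in LHS](fimfunE g) fsbig_finite//= -sumEFin.
  apply: eq_big_seq => y; rewrite in_fset_set// inE => -[t _ <-].
  by rewrite ger0_norm// EFinM.
have [g [ndg cvg_g]] := approximation measurableT mf (fun x _ => f0 x).
apply: (PL (fun n => EFin \o g n)) => //.
- by move=> n; exact/measurable_EFinP.
- by move=> n x; rewrite /= lee_fin.
- by move=> x m n mn; rewrite /= lee_fin; have /lefP := ndg _ _ mn; exact.
- by move=> x; exact: cvg_g.
Qed.

End mfun_ind.

HB.saturate prod.

Lemma near_open (T : topologicalType) (A : set T) :
  (forall x, A x -> nbhs x A) -> open A.
Proof. by rewrite openE. Qed.

Lemma le_mu d (T : measurableType d) (R : realType)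
  (mu : {measure set T -> \bar R}) (A B : set T) :
  measurable A -> measurable B -> A `<=` B -> (mu A <= mu B)%E.
Proof. by move=> mA mB; apply: le_measure; rewrite inE. Qed.

Lemma measurable_sum_indic d (T : measurableType d) (R : realType) (c : R)
    (N : nat) (A : nat -> set T) : (forall k, measurable (A k)) ->
  measurable_fun setT (fun x => (\sum_(k < N) c * \1_(A k) x)%:E).
Proof.
move=> mA; apply/measurable_EFinP; apply: measurable_sum => k.
by apply: measurable_funM.
Qed.

Lemma integral_sum_indic d (T : measurableType d) (R : realType)
    (mu : {measure set T -> \bar R}) (c : R) (N : nat) (A : nat -> set T) :
  0 <= c -> (forall k, measurable (A k)) ->
  (\int[mu]_x (\sum_(k < N) c * \1_(A k) x)%:E = \sum_(k < N) c%:E * mu (A k))%E.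
Proof.
move=> c0 mA; under eq_integral do rewrite -sumEFin.
rewrite ge0_integral_sum//.
- apply: eq_bigr => k _; under eq_integral do rewrite EFinM.
  rewrite ge0_integralZl//; first by rewrite integral_indic// setIT.
  exact/measurable_EFinP/measurable_indic.
- move=> k; apply/measurable_EFinP; exact: measurable_funM.
- by move=> k x _; rewrite lee_fin mulr_ge0.
Qed.

(** * Tonelli's theorem for Borel functions on a square *)

Section borel_tonelli.
Local Open Scope ereal_scope.
Context {R : realType} {X : ptopologicalType}.
Variable mu : {measure set (borel X) -> \bar R}.
Hypothesis hausX : hausdorff_space X.
Hypothesis inner_open : forall U : set X, open U ->
  mu U = ereal_sup [set mu K | K in [set K : set X | compact K /\ K `<=` U]].
Variable W : nat -> set X.
Hypothesis openW : forall n, open (W n).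
Hypothesis ndW : forall n m, (n <= m)%N -> W n `<=` W m.
Hypothesis finW : forall n, mu (W n) < +oo.
Hypothesis bigW : \bigcup_n W n = setT.

Lemma borel_open (A : set X) : open A -> measurable (A : set (borel X)).
Proof. by move=> oA; exact: sub_sigma_algebra. Qed.

Lemma borel_closed (A : set X) : closed A -> measurable (A : set (borel X)).
Proof.
move=> cA; rewrite -[A]setCK; apply: measurableC; apply: borel_open.
exact: closed_openC.
Qed.

Lemma borel_compact (A : set X) : compact A -> measurable (A : set (borel X)).
Proof. by move=> /(compact_closed hausX); exact: borel_closed. Qed.

Lemma le_borel (A B : set X) : measurable (A : set (borel X)) ->
  measurable (B : set (borel X)) -> A `<=` B -> mu A <= mu B.
Proof. exact: le_mu. Qed.

Lemma mu_sigma_finite : sigma_finite setT (mu : set (borel X) -> \bar R).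
Proof.
exists W; first by rewrite bigW.
by move=> n; split; [exact: borel_open|exact: finW].
Qed.

(** A copy of [mu] that carries the sigma-finite structure required by the product measure
    theorem. *)
Let nu : set (borel X) -> \bar R := mu.

HB.instance Definition _ := Measure.on nu.
HB.instance Definition _ := @Measure_isSigmaFinite.Build _ _ _ nu mu_sigma_finite.

Lemma rectangles_tonelli (D : set (borel X * borel X)) : measurable D ->
  \int[mu]_x mu (xsection D x) = \int[mu]_y mu (ysection D y).
Proof.
move=> mD; have := @indic_fubini_tonelli _ _ _ _ R nu nu _ mD.
by rewrite indic_fubini_tonelli_FE// indic_fubini_tonelli_GE.
Qed.

Lemma xsection_open (O : set (X * X)) x : open O -> open (xsection O x).
Proof.
move=> oO; rewrite /xsection (_ : [set y | _] = (fun y => (x, y)) @^-1` O); last first.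
  by apply/seteqP; split => y /=; rewrite inE.
apply: open_comp => // y _; apply: cvg_pair; [exact: cvg_cst|exact: cvg_id].
Qed.

(** Inner regularity puts a compact [K] of measure above [a] in the section at [x], and by the tube
    lemma [K] stays inside the sections at all nearby points. *)
Lemma lsc_section (O : set (X * X)) (a : \bar R) : open O ->
  open [set x | a < mu (xsection O x)].
Proof.
move=> oO; apply: near_open => x /=.
rewrite [X in a < X](inner_open (xsection_open x oO)) => /ereal_sup_gt[_ [K [cK KO] <-]] aK.
have : \forall x' \near x, K `<=` O \o pair x'.
  apply: ((compact_near_coveringP K).1 cK _ (nbhs x) (fun x y => O (x, y))).
  move=> y /KO; rewrite /xsection/= inE => Oxy.
  have : nbhs (x, y) O by exact: open_nbhs_nbhs.
  case=> -[U1 U2] /= [nU1 nU2] UO.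
  by exists (U2, U1) => //= -[y' x'] /= [U2y U1x]; exact: (UO (x', y')).
apply: filterS => x' KO'; apply: (lt_le_trans aK); apply: le_borel.
- exact: borel_compact.
- by apply: borel_open; exact: xsection_open.
- by move=> y Ky; rewrite /xsection /= inE; exact: KO'.
Qed.

Lemma measurable_lsc_section (O : set (X * X)) : open O ->
  measurable_fun [set: borel X] (fun x => mu (xsection O x)).
Proof.
move=> oO; apply: measurability (ErealGenOInfty.measurableE R) _.
move=> _ [_ [r ->] <-]; rewrite setTI; apply: borel_open.
rewrite preimage_itvoy; exact: lsc_section.
Qed.

Lemma open_swap (O : set (X * X)) : open O ->
  open ([set z | O (z.2, z.1)] : set (X * X)).
Proof.
move=> oO; apply: (@open_comp _ _ (fun z : X * X => (z.2, z.1))) => // z _.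
by apply: cvg_pair => /=; [exact: cvg_snd|exact: cvg_fst].
Qed.

Lemma ysection_open (O : set (X * X)) y : open O -> open (ysection O y).
Proof.
move=> /open_swap/(xsection_open y).
by rewrite xsectionE ysectionE.
Qed.

Lemma measurable_lsc_ysection (O : set (X * X)) : open O ->
  measurable_fun [set: borel X] (fun x => mu (ysection O x)).
Proof.
move=> /open_swap/measurable_lsc_section.
by apply: eq_measurable_fun => x _; rewrite xsectionE ysectionE.
Qed.

(** Near each point one rectangle [U x K] with [K] compact suffices, and compactness of [C] leaves
    finitely many of them. This is the passage from Borel sets of the square to the product
    sigma-algebra. *)
Lemma rectangles_in_open (O : set (X * X)) (a : \bar R) (C : set X) :
  open O -> compact C -> C `<=` [set x | a < mu (xsection O x)] ->
  exists2 D : set (borel X * borel X), measurable D /\ D `<=` O &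
    forall x, C x -> a < mu (xsection D x).
Proof.
move=> oO cC CO.
pose inO (D : set (borel X * borel X)) := measurable D /\ D `<=` O.
(* [F] consists of the properties that hold for all sufficiently large admissible [D]. Unions of
   admissible sets make it a filter, so the covering form of compactness merges the local
   rectangles. *)
pose F : set_system (set (borel X * borel X)) :=
  [set Q | exists2 D0, inO D0 & forall D, inO D -> D0 `<=` D -> Q D].
have FF : Filter F.
  split.
  - by exists set0; [split|].
  - move=> P Q [D0 [mD0 D0O] PD] [D1 [mD1 D1O] QD]; exists (D0 `|` D1).
      by split; [exact: measurableU|rewrite subUset].
    by move=> D DO DD; split; [apply: PD|apply: QD] => //;
      apply: subset_trans DD; [exact: subsetUl|exact: subsetUr].
  - by move=> P Q PQ [D0 D0O PD]; exists D0 => // D DO D0D; exact/PQ/PD.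
have : \near F, C `<=` (fun D x => a < mu (xsection D x)) F.
  apply: ((compact_near_coveringP C).1 cC _ F) => x /CO /=.
  rewrite [X in a < X](inner_open (xsection_open x oO)).
  move=> /ereal_sup_gt[_ [K [cK KO] <-]] aK.
  have KU : \forall x' \near x, K `<=` O \o pair x'.
    apply: ((compact_near_coveringP K).1 cK _ (nbhs x) (fun x y => O (x, y))).
    move=> y /KO; rewrite /xsection/= inE => Oxy.
    have : nbhs (x, y) O by exact: open_nbhs_nbhs.
    case=> -[U1 U2] /= [nU1 nU2] UO.
    by exists (U2, U1) => //= -[y' x'] /= [U2y U1x]; exact: (UO (x', y')).
  have : nbhs x [set x' | K `<=` O \o pair x'] by exact: KU.
  rewrite nbhsE => -[U [oU Ux] UK].
  have inD0 : inO (U `*` K).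
    split; last by move=> [x' y] [/= /UK]; exact.
    by apply: measurableX; [exact: borel_open|exact: borel_compact].
  exists (U, [set D | inO D /\ U `*` K `<=` D]) => /=.
    by split; [exact: open_nbhs_nbhs|exists (U `*` K)].
  move=> [x' D] /= [Ux' [[mD DO] KD]]; apply: (lt_le_trans aK).
  apply: le_borel; [exact: borel_compact|exact: (@measurable_xsection _ _ (borel X) (borel X))|].
  by move=> y Ky; rewrite /xsection /= inE; apply: KD.
move=> [D inD /(_ D inD (@subset_refl _ D)) CD]; by exists D.
Qed.
(** Layer by layer, the integral of the x-sections of [O] is almost reached by a subset [E] in the
    product sigma-algebra. Tonelli applies to [E], and inclusion in [O] bounds its y-sections. The
    converse inequality is the same statement with the coordinates swapped. *)
Lemma open_iterated_le n (O : set (X * X)) : open O -> O `<=` W n `*` W n ->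
  \int[mu]_x mu (xsection O x) <= \int[mu]_y mu (ysection O y).
Proof.
(* The added [1] keeps [c] positive when [W n] is null. *)
move=> oO OW; set c := (fine (mu (W n)) + 1)%R.
have mWn : measurable (W n : set (borel X)) by exact: borel_open.
have muWE : mu (W n) = (c - 1)%:E.
  by rewrite /c addrK fineK// ge0_fin_numE.
have c1 : (1 <= c)%R by rewrite /c lerDr fine_ge0.
have c0 : (0 < c)%R by exact: lt_le_trans c1.
have sec_le x : mu (xsection O x) <= (c - 1)%:E.
  rewrite -muWE; apply: le_borel => //.
    by apply: borel_open; exact: xsection_open.
  by move=> y; rewrite /xsection /= inE => /OW[].
have sec_fin x : mu (xsection O x) \is a fin_num.
  by rewrite ge0_fin_numE// (le_lt_trans (sec_le x))// ltry.
pose phi x := fine (mu (xsection O x)).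
have phiE x : mu (xsection O x) = (phi x)%:E by rewrite /phi fineK.
have phi_le x : (phi x <= c - 1)%R by rewrite -lee_fin -phiE.
have phi0 x : ~ W n x -> phi x = 0%R.
  move=> nWx; rewrite /phi (_ : xsection O x = set0) ?measure0//.
  by rewrite -subset0 => y; rewrite /xsection /= inE => /OW[].
apply/lee_addgt0Pr => e e0.
(* The mesh [d] is chosen so that [2 c d <= e]; the total error below is [d (c - 1) + c d]. *)
pose N := Num.trunc (2 * c ^+ 2 / e); pose d := (c / N.+1%:R)%R.
have d0 : (0 < d)%R by rewrite divr_gt0.
have Nd : (N.+1%:R * d = c)%R by rewrite mulrC divfK.
have cde : (2 * (c * d) <= e)%R.
  rewrite /d !mulrA -(mulrA 2%R c) -expr2 ler_pdivrMr// (mulrC e) -ler_pdivrMr// ltW//.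
  exact: truncnS_gt.
clearbody d.
pose U k := [set x | (k.+1%:R * d)%:E < mu (xsection O x)].
have oU k : open (U k) by exact: lsc_section.
have mU k : measurable (U k : set (borel X)) by exact: borel_open.
have UW k : U k `<=` W n.
  move=> x; rewrite /U /= phiE lte_fin; apply: contraPP => /phi0 ->.
  by rewrite ltNge mulr_ge0// ltW.
have finU k : mu (U k) \is a fin_num.
  by rewrite ge0_fin_numE// (le_lt_trans (le_borel (mU k) mWn (UW k)))// finW.
(* Each superlevel set is exhausted by a compact set up to measure [d]; over [N] layers of height
   [d] this costs [N d d <= c d]. *)
have /choice[C CP] : forall k, exists C,
    [/\ compact C, C `<=` U k & mu (U k) <= mu C + d%:E].
  move=> k; have := finU k; rewrite (inner_open (oU k)) => fU.
  have [_ [K [cK KU] <-] h] := ub_ereal_sup_adherent d0 fU.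
  by exists K; split => //; rewrite -leeBlDr// ltW.
have mC k : measurable (C k : set (borel X)) by apply: borel_compact; case: (CP k).
have /choice[D DP] : forall k, exists D : set (borel X * borel X),
    [/\ measurable D, D `<=` O &
        forall x, C k x -> (k.+1%:R * d)%:E < mu (xsection D x)].
  move=> k; have [cC CU _] := CP k.
  by have [D [mD DO] CD] := rectangles_in_open oO cC CU; exists D.
pose E := \bigcup_k D k.
have mE : measurable (E : set (borel X * borel X)).
  by apply: bigcup_measurable => k _; case: (DP k).
have EO : E `<=` O by move=> z [k _]; have [_ + _] := DP k; exact.
have mEx x : measurable (xsection E x : set (borel X)).
  exact: (@measurable_xsection _ _ (borel X) (borel X)).
have mEy x : measurable (ysection E x : set (borel X)).
  exact: (@measurable_ysection _ _ (borel X) (borel X)).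
have EOx x : xsection E x `<=` xsection O x.
  by move=> y; rewrite /xsection/= !inE; exact: EO.
have step1 : \int[mu]_x mu (xsection O x) <=
    d%:E * mu (W n) + \sum_(k < N) d%:E * mu (U k).
  have -> : d%:E * mu (W n) = \int[mu]_x (\sum_(k < 1) d * \1_(W n) x)%:E.
    by rewrite (@integral_sum_indic _ _ _ mu d 1 (fun=> W n) (ltW d0)) ?big_ord1.
  rewrite -integral_sum_indic ?(ltW d0)// -ge0_integralD//.
  - apply: ge0_le_integral => //.
    + exact: measurable_lsc_section.
    + apply: emeasurable_funD; last exact: measurable_sum_indic.
      exact: (@measurable_sum_indic _ (borel X) R d 1 (fun=> W n)).
    move=> x _; rewrite big_ord1 phiE -EFinD lee_fin.
    have [Wx|nWx] := pselect (W n x); last first.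
      rewrite phi0//; apply: addr_ge0; first by rewrite mulr_ge0// ltW.
      by apply: sumr_ge0 => k _; rewrite mulr_ge0// ltW.
    rewrite indicE mem_set// mulr1; apply: le_trans (@le_staircase _ d N _ d0 _) _.
      by rewrite Nd (le_trans (phi_le x))// gerBl.
    rewrite lerD2l ler_sum// => k _; rewrite ler_pM2l// indicE ler_nat.
    case: ltP => // kx; rewrite mem_set//.
    by rewrite /U /= phiE lte_fin.
  - by move=> x _; rewrite lee_fin; apply: sumr_ge0 => k _; rewrite mulr_ge0// ltW.
  - exact: (@measurable_sum_indic _ (borel X) R d 1 (fun=> W n)).
  - by move=> x _; rewrite lee_fin; apply: sumr_ge0 => k _; rewrite mulr_ge0// ltW.
  - exact: measurable_sum_indic.
have step2 : \sum_(k < N) d%:E * mu (C k) <= \int[mu]_x mu (xsection E x).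
  rewrite -integral_sum_indic ?(ltW d0)//; apply: ge0_le_integral => //.
  - by move=> x _; rewrite lee_fin; apply: sumr_ge0 => k _; rewrite mulr_ge0// ltW.
  - exact: measurable_sum_indic.
  - exact: (@measurable_fun_xsection _ _ (borel X) (borel X) _ nu).
  move=> x _.
  have sE : mu (xsection E x) \is a fin_num.
    rewrite ge0_fin_numE// (le_lt_trans _ (ltry (c - 1)))//.
    apply: le_trans (sec_le x); apply: le_borel => //.
    by apply: borel_open; exact: xsection_open.
  rewrite -(fineK sE) lee_fin.
  rewrite (eq_bigr (fun k : 'I_N => d * (x \in C k)%:R)%R); last first.
    by move=> k _; rewrite indicE.
  apply: (@staircase_le _ d N (fun k => x \in C k)) => //.
  move=> k _; rewrite inE => Cx; rewrite -lee_fin fineK// ltW//.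
  have [mD DO /(_ _ Cx) /lt_le_trans] := DP k; apply; apply: le_borel => //.
    exact: (@measurable_xsection _ _ (borel X) (borel X)).
  by move=> y; rewrite /xsection /= !inE => Dxy; exists k.
have step3 : \int[mu]_y mu (ysection E y) <= \int[mu]_y mu (ysection O y).
  apply: ge0_le_integral => //.
  - exact: (@measurable_fun_ysection _ _ (borel X) (borel X) _ nu).
  - exact: measurable_lsc_ysection.
  - move=> y _; apply: le_borel => //.
      by apply: borel_open; exact: ysection_open.
    by move=> x; rewrite /ysection /= !inE; exact: EO.
rewrite (le_trans step1)//.
have -> : d%:E * mu (W n) = (d * (c - 1))%:E by rewrite muWE.
have sumCU : \sum_(k < N) d%:E * mu (U k) <=
    \sum_(k < N) d%:E * mu (C k) + (c * d)%:E.
  apply: (@le_trans _ _ (\sum_(k < N) (d%:E * mu (C k) + (d * d)%:E))).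
    apply: lee_sum => k _; rewrite (EFinM d d) -ge0_muleDr//; last by rewrite lee_fin ltW.
    by apply: lee_wpmul2l; [rewrite lee_fin ltW|case: (CP k)].
  rewrite big_split/= leeD2l// sumEFin lee_fin sumr_const card_ord -mulr_natl.
  rewrite mulrA ler_pM2r// -Nd ler_pM2r// ler_nat//.
apply: (@le_trans _ _ ((d * (c - 1))%:E +
    (\int[mu]_y mu (ysection O y) + (c * d)%:E))).
  rewrite leeD2l// (le_trans sumCU)// leeD2r//.
  by rewrite (le_trans step2)// rectangles_tonelli.
rewrite addeCA leeD2l// -EFinD lee_fin (le_trans _ cde)//.
by nra.
Qed.
End borel_tonelli.

Lemma continuous_borel (T U : ptopologicalType) (f : T -> U) :
  continuous f -> measurable_fun [set: borel T] (f : borel T -> borel U).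
Proof.
move=> /continuousP cf.
apply: (@measurability _ _ (borel T) (borel U) setT f open erefl).
by move=> _ [B oB <-]; rewrite setTI; apply: sub_sigma_algebra; exact: cf.
Qed.

Section borel_tonelli_sets.
Local Open Scope ereal_scope.
Context {R : realType} {X : ptopologicalType}.
Variable mu : {measure set (borel X) -> \bar R}.
Hypothesis hausX : hausdorff_space X.
Hypothesis inner_open : forall U : set X, open U ->
  mu U = ereal_sup [set mu K | K in [set K : set X | compact K /\ K `<=` U]].
Variable W : nat -> set X.
Hypothesis openW : forall n, open (W n).
Hypothesis ndW : forall n m, (n <= m)%N -> W n `<=` W m.
Hypothesis finW : forall n, mu (W n) < +oo.
Hypothesis bigW : \bigcup_n W n = setT.

Local Notation XX := (borel (X * X)%type).
Implicit Type A : set XX.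

Lemma borel_xsection A x : measurable A -> measurable (xsection A x : set (borel X)).
Proof.
move=> mA; rewrite xsectionE -[X in measurable X]setTI.
apply: (@continuous_borel X (X * X)%type (pair x)) => // y.
by apply: cvg_pair; [exact: cvg_cst|exact: cvg_id].
Qed.

Lemma borel_ysection A y : measurable A -> measurable (ysection A y : set (borel X)).
Proof.
move=> mA; rewrite ysectionE -[X in measurable X]setTI.
apply: (@continuous_borel X (X * X)%type (pair^~ y)) => // x.
by apply: cvg_pair; [exact: cvg_id|exact: cvg_cst].
Qed.

Let tonelli_set A :=
  [/\ measurable_fun [set: borel X] (fun x => mu (xsection A x)),
      measurable_fun [set: borel X] (fun y => mu (ysection A y)) &
      \int[mu]_x mu (xsection A x) = \int[mu]_y mu (ysection A y)].

Let open_WW n : open (W n `*` W n).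
Proof.
apply: near_open => -[x y] /= [Wx Wy].
by exists (W n, W n) => //=; split; apply: open_nbhs_nbhs; split.
Qed.

Let tonelli_open n (O : set (X * X)) : open O -> O `<=` W n `*` W n ->
  tonelli_set O.
Proof.
move=> oO OW; split.
- exact: measurable_lsc_section.
- exact: measurable_lsc_ysection.
apply/eqP; rewrite eq_le; apply/andP; split.
  exact: (open_iterated_le hausX inner_open openW finW bigW oO OW).
pose O' := [set z | O (z.2, z.1)].
have -> : (fun x => mu (xsection O x)) = fun x => mu (ysection O' x).
  by apply/funext => x; rewrite xsectionE ysectionE.
have -> : (fun x => mu (ysection O x)) = fun x => mu (xsection O' x).
  by apply/funext => x; rewrite xsectionE ysectionE.
apply: (@open_iterated_le _ _ mu hausX inner_open W openW finW bigW n).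
  exact: open_swap.
by move=> [x y] /OW[].
Qed.

(** Dynkin induction from open sets. Intersecting with [W n x W n] keeps all measures finite, which
    the complement case needs in order to subtract. *)
Let tonelli_block n A : measurable A -> tonelli_set (A `&` (W n `*` W n)).
Proof.
pose Q := W n `*` W n.
have mQ : measurable (Q : set XX) by apply: borel_open; exact: open_WW.
have mW : measurable (W n : set (borel X)) by apply: borel_open.
have finx x (B : set XX) : measurable B -> mu (xsection (B `&` Q) x) < +oo.
  move=> mB; apply: le_lt_trans (finW n); apply: le_mu => //.
    by apply: borel_xsection; exact: measurableI.
  by move=> y; rewrite /xsection/= inE => -[_ []].
have finy y (B : set XX) : measurable B -> mu (ysection (B `&` Q) y) < +oo.
  move=> mB; apply: le_lt_trans (finW n); apply: le_mu => //.
    by apply: borel_ysection; exact: measurableI.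
  by move=> x; rewrite /ysection/= inE => -[_ []].
move: A; apply: (@dynkin_induction _ XX open (fun A => tonelli_set (A `&` Q))) => //.
- exact: openI.
- by rewrite setTI; apply: (@tonelli_open n) => //; exact: open_WW.
- move=> O oO; apply: (@tonelli_open n); first by apply: openI => //; exact: open_WW.
  by move=> z [].
- move=> S mS [mSx mSy ES].
  have [mQx mQy EQ] : tonelli_set Q.
    by apply: (@tonelli_open n) => //; exact: open_WW.
  have mSQ : measurable (S `&` Q : set XX) by exact: measurableI.
  have mCQ : measurable (~` S `&` Q : set XX).
    by apply: measurableI => //; exact: measurableC.
  have UQ : Q = (~` S `&` Q) `|` (S `&` Q) by rewrite -setIUl setUC setUv setTI.
  have IQ : (~` S `&` Q) `&` (S `&` Q) = set0.
    by rewrite setIACA setIC setICl setI0.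
  have xE x : mu (xsection Q x) =
      mu (xsection (~` S `&` Q) x) + mu (xsection (S `&` Q) x).
    rewrite [in LHS]UQ xsectionE preimage_setU -!xsectionE measureU//; try exact: borel_xsection.
    by rewrite -xsectionI IQ xsection0.
  have yE y : mu (ysection Q y) =
      mu (ysection (~` S `&` Q) y) + mu (ysection (S `&` Q) y).
    rewrite [in LHS]UQ ysectionE preimage_setU -!ysectionE measureU//; try exact: borel_ysection.
    by rewrite -ysectionI IQ ysection0.
  have finSx x : mu (xsection (S `&` Q) x) \is a fin_num.
    by rewrite ge0_fin_numE//; exact: finx.
  have finSy y : mu (ysection (S `&` Q) y) \is a fin_num.
    by rewrite ge0_fin_numE//; exact: finy.
  have mCx : measurable_fun [set: borel X] (fun x => mu (xsection (~` S `&` Q) x)).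
    apply: eq_measurable_fun (emeasurable_funB mQx mSx) => x _ /=.
    by rewrite xE addeK.
  have mCy : measurable_fun [set: borel X] (fun y => mu (ysection (~` S `&` Q) y)).
    apply: eq_measurable_fun (emeasurable_funB mQy mSy) => y _ /=.
    by rewrite yE addeK.
  split => //.
  have finI : \int[mu]_x mu (xsection (S `&` Q) x) \is a fin_num.
    rewrite ge0_fin_numE; last by apply: integral_ge0 => x _.
    apply: (@le_lt_trans _ _ (\int[mu]_x (\sum_(k < 1) fine (mu (W n)) * \1_(W n) x)%:E)).
      apply: ge0_le_integral => //.
        exact: (@measurable_sum_indic _ (borel X) R _ 1 (fun=> W n)).
      move=> x _; rewrite big_ord1 indicE; have [Wx|Wx] := boolP (x \in W n).
        rewrite mulr1 fineK ?ge0_fin_numE//; apply: le_mu => //.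
          exact: borel_xsection.
        by move=> y; rewrite /xsection/= inE => -[_ []].
      rewrite mulr0 (_ : xsection _ _ = set0) ?measure0//.
      rewrite -subset0 => y; rewrite /xsection/= inE => -[_ []].
      by move: Wx; rewrite notin_setE.
    rewrite (@integral_sum_indic _ (borel X) R mu _ 1 (fun=> W n))// big_ord1.
    by rewrite lte_mul_pinfty// ?lee_fin.
  have : \int[mu]_x mu (xsection (~` S `&` Q) x) + \int[mu]_x mu (xsection (S `&` Q) x) =
      \int[mu]_y mu (ysection (~` S `&` Q) y) + \int[mu]_x mu (xsection (S `&` Q) x).
    rewrite -ge0_integralD// ES -ge0_integralD//.
    under eq_integral do rewrite -xE.
    by under [RHS]eq_integral do rewrite -yE.
  by move=> /(congr1 (fun z => z - \int[mu]_x mu (xsection (S `&` Q) x))); rewrite !addeK.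
- move=> F mF tF PF.
  have mFQ k : measurable (F k `&` Q : set XX) by exact: measurableI.
  have tFQ : trivIset setT (fun k => F k `&` Q) by exact: trivIset_setIr.
  have xE x : mu (xsection (\bigcup_k F k `&` Q) x) =
      \sum_(k <oo) mu (xsection (F k `&` Q) x).
    rewrite setI_bigcupl xsection_bigcup measure_semi_bigcup//.
    - by move=> k; exact: borel_xsection.
    - exact: trivIset_xsection.
    - by apply: bigcup_measurable => k _; exact: borel_xsection.
  have yE y : mu (ysection (\bigcup_k F k `&` Q) y) =
      \sum_(k <oo) mu (ysection (F k `&` Q) y).
    rewrite setI_bigcupl ysection_bigcup measure_semi_bigcup//.
    - by move=> k; exact: borel_ysection.
    - exact: trivIset_ysection.
    - by apply: bigcup_measurable => k _; exact: borel_ysection.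
  split.
  - under eq_fun do rewrite xE.
    by apply: ge0_emeasurable_sum => // k _; case: (PF k).
  - under eq_fun do rewrite yE.
    by apply: ge0_emeasurable_sum => // k _; case: (PF k).
  under eq_integral do rewrite xE.
  under [RHS]eq_integral do rewrite yE.
  rewrite !integral_nneseries//.
  - by apply: eq_eseriesr => k _; case: (PF k).
  - by move=> k; case: (PF k).
  - by move=> k; case: (PF k).
Qed.

Lemma tonelli_borel_set A : measurable A ->
  [/\ measurable_fun [set: borel X] (fun x => mu (xsection A x)),
      measurable_fun [set: borel X] (fun y => mu (ysection A y)) &
      \int[mu]_x mu (xsection A x) = \int[mu]_y mu (ysection A y)].
Proof.
move=> mA; pose B n : set XX := A `&` (W n `*` W n).
have mB n : measurable (B n).
  by apply: measurableI => //; apply: borel_open; exact: open_WW.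
have ndB : nondecreasing_seq B.
  move=> m n mn; apply/subsetPset => -[x y] [Axy [Wx Wy]]; split => //.
  by split; exact: ndW Wx || exact: ndW Wy.
have UB : A = \bigcup_n B n.
  apply/seteqP; split => [[x y] Axy|z [n _ []]//].
  have [n _ Wx] : (\bigcup_n W n) x by rewrite bigW.
  have [m _ Wy] : (\bigcup_n W n) y by rewrite bigW.
  exists (maxn n m) => //; split => //; split => /=.
    exact: ndW (leq_maxl _ _) _ Wx.
  exact: ndW (leq_maxr _ _) _ Wy.
have cx x : mu (xsection (B n) x) @[n --> \oo] --> mu (xsection A x).
  rewrite UB xsection_bigcup; apply: nondecreasing_cvg_mu.
  - by move=> n; exact: borel_xsection.
  - by apply: bigcup_measurable => k _; exact: borel_xsection.
  - move=> m n mn; apply/subsetPset => y; rewrite /xsection/= !inE.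
    by have /subsetPset := ndB _ _ mn; exact.
have cy y : mu (ysection (B n) y) @[n --> \oo] --> mu (ysection A y).
  rewrite UB ysection_bigcup; apply: nondecreasing_cvg_mu.
  - by move=> n; exact: borel_ysection.
  - by apply: bigcup_measurable => k _; exact: borel_ysection.
  - move=> m n mn; apply/subsetPset => x; rewrite /ysection/= !inE.
    by have /subsetPset := ndB _ _ mn; exact.
have mBx n : measurable_fun [set: borel X] (fun x => mu (xsection (B n) x)).
  by have [] := tonelli_block n mA.
have mBy n : measurable_fun [set: borel X] (fun x => mu (ysection (B n) x)).
  by have [] := tonelli_block n mA.
split.
- by apply: (@emeasurable_fun_cvg _ (borel X) R setT (fun n x => mu (xsection (B n) x))).
- by apply: (@emeasurable_fun_cvg _ (borel X) R setT (fun n x => mu (ysection (B n) x))).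
have ndx x : {homo (fun n => mu (xsection (B n) x)) : m n / (m <= n)%N >-> m <= n}.
  move=> m n mn; apply: le_mu; [exact: borel_xsection..|].
  move=> y; rewrite /xsection/= !inE.
  by have /subsetPset := ndB _ _ mn; exact.
have ndy y : {homo (fun n => mu (ysection (B n) y)) : m n / (m <= n)%N >-> m <= n}.
  move=> m n mn; apply: le_mu; [exact: borel_ysection..|].
  move=> x; rewrite /ysection/= !inE.
  by have /subsetPset := ndB _ _ mn; exact.
transitivity (limn (fun n => \int[mu]_x mu (xsection (B n) x))).
  rewrite -monotone_convergence//.
  by apply: eq_integral => x _; rewrite (cvg_lim _ (cx x)).
transitivity (limn (fun n => \int[mu]_y mu (ysection (B n) y))).
  by congr (limn _); apply/funext => n; have [] := tonelli_block n mA.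
rewrite -monotone_convergence//.
by apply: eq_integral => x _; rewrite (cvg_lim _ (cy x)).
Qed.

End borel_tonelli_sets.

Section tonelli_functions.
Local Open Scope ereal_scope.
Context {R : realType} {X : ptopologicalType}.
Variable mu : {measure set (borel X) -> \bar R}.
Hypothesis hausX : hausdorff_space X.
Hypothesis inner_open : forall U : set X, open U ->
  mu U = ereal_sup [set mu K | K in [set K : set X | compact K /\ K `<=` U]].
Variable W : nat -> set X.
Hypothesis openW : forall n, open (W n).
Hypothesis ndW : forall n m, (n <= m)%N -> W n `<=` W m.
Hypothesis finW : forall n, mu (W n) < +oo.
Hypothesis bigW : \bigcup_n W n = setT.

Lemma borel_pair1 (F : X * X -> \bar R) x :
  measurable_fun [set: borel (X * X)%type] F ->
  measurable_fun [set: borel X] (fun y => F (x, y)).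
Proof.
move=> mF; apply: (measurableT_comp mF).
apply: (@continuous_borel X (X * X)%type (pair x)) => // y.
by apply: cvg_pair; [exact: cvg_cst|exact: cvg_id].
Qed.

Lemma borel_pair2 (F : X * X -> \bar R) y :
  measurable_fun [set: borel (X * X)%type] F ->
  measurable_fun [set: borel X] (fun x => F (x, y)).
Proof.
move=> mF; apply: (measurableT_comp mF).
apply: (@continuous_borel X (X * X)%type (pair^~ y)) => // x.
by apply: cvg_pair; [exact: cvg_id|exact: cvg_cst].
Qed.

Lemma tonelli_borel (F : X * X -> \bar R) :
  measurable_fun [set: borel (X * X)%type] F -> (forall z, 0 <= F z) ->
  [/\ measurable_fun [set: borel X] (fun x => \int[mu]_y F (x, y)),
      measurable_fun [set: borel X] (fun y => \int[mu]_x F (x, y)) &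
      \int[mu]_x \int[mu]_y F (x, y) = \int[mu]_y \int[mu]_x F (x, y)].
Proof.
move: F; apply: (@ge0_mfun_ind _ (borel (X * X)%type)).
- move=> A mA.
  have Ex x : \int[mu]_y (EFin \o \1_A) (x, y) = mu (xsection A x).
    rewrite -[RHS]mul1e -integral_cst//; last exact: borel_xsection.
    rewrite [RHS]integral_mkcond; apply: eq_integral => y _ /=.
    by rewrite patchE mem_xsection indicE; case: ifPn.
  have Ey y : \int[mu]_x (EFin \o \1_A) (x, y) = mu (ysection A y).
    rewrite -[RHS]mul1e -integral_cst//; last exact: borel_ysection.
    rewrite [RHS]integral_mkcond; apply: eq_integral => x _ /=.
    by rewrite patchE mem_ysection indicE; case: ifPn.
  have [m1 m2 m12] := tonelli_borel_set hausX inner_open openW ndW finW bigW mA.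
  split.
  + by apply: eq_measurable_fun m1 => x _; rewrite Ex.
  + by apply: eq_measurable_fun m2 => y _; rewrite Ey.
  under eq_integral do rewrite Ex.
  by under [RHS]eq_integral do rewrite Ey.
- move=> c f c0 mf f0 [m1 m2 m12].
  have Ex x : \int[mu]_y (c%:E * f (x, y)) = c%:E * \int[mu]_y f (x, y).
    by rewrite ge0_integralZl//; exact: borel_pair1.
  have Ey y : \int[mu]_x (c%:E * f (x, y)) = c%:E * \int[mu]_x f (x, y).
    by rewrite ge0_integralZl//; exact: borel_pair2.
  split.
  + by under eq_fun do rewrite Ex; exact: measurable_funeM.
  + by under eq_fun do rewrite Ey; exact: measurable_funeM.
  under eq_integral do rewrite Ex.
  under [RHS]eq_integral do rewrite Ey.
  have c0e : 0 <= c%:E by rewrite lee_fin.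
  rewrite (ge0_integralZl mu measurableT m1 (fun x _ => integral_ge0 mu (fun y _ => f0 (x, y))) c0e).
  by rewrite (ge0_integralZl mu measurableT m2 (fun y _ => integral_ge0 mu (fun x _ => f0 (x, y))) c0e) m12.
- move=> f g mf mg f0 g0 [mf1 mf2 mf12] [mg1 mg2 mg12].
  have Ex x : \int[mu]_y (f \+ g) (x, y) =
      \int[mu]_y f (x, y) + \int[mu]_y g (x, y).
    by rewrite ge0_integralD//; exact: borel_pair1.
  have Ey y : \int[mu]_x (f \+ g) (x, y) =
      \int[mu]_x f (x, y) + \int[mu]_x g (x, y).
    by rewrite ge0_integralD//; exact: borel_pair2.
  split.
  + by under eq_fun do rewrite Ex; exact: emeasurable_funD.
  + by under eq_fun do rewrite Ey; exact: emeasurable_funD.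
  under eq_integral do rewrite Ex.
  under [RHS]eq_integral do rewrite Ey.
  have i0 (h : X * X -> \bar R) : (forall z, 0 <= h z) ->
      (forall x, 0 <= \int[mu]_y h (x, y)) /\ (forall y, 0 <= \int[mu]_x h (x, y)).
    by move=> h0; split=> z; apply: integral_ge0.
  have [[fx fy] [gx gy]] := (i0 _ f0, i0 _ g0).
  rewrite (ge0_integralD mu measurableT (fun x _ => fx x) mf1 (fun x _ => gx x) mg1).
  by rewrite (ge0_integralD mu measurableT (fun y _ => fy y) mf2 (fun y _ => gy y) mg2) mf12 mg12.
move=> f g mf f0 nd cvgf Pf.
have Ex x : \int[mu]_y f n (x, y) @[n --> \oo] --> \int[mu]_y g (x, y).
  rewrite (_ : (fun y => g (x, y)) = fun y => limn (fun n => f n (x, y))); last first.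
    by apply/funext => y; rewrite (cvg_lim _ (cvgf (x, y))).
  apply: cvg_monotone_convergence => //.
  by move=> n; exact: borel_pair1.
have Ey y : \int[mu]_x f n (x, y) @[n --> \oo] --> \int[mu]_x g (x, y).
  rewrite (_ : (fun x => g (x, y)) = fun x => limn (fun n => f n (x, y))); last first.
    by apply/funext => x; rewrite (cvg_lim _ (cvgf (x, y))).
  apply: cvg_monotone_convergence => //.
  by move=> n; exact: borel_pair2.
have mfx n : measurable_fun [set: borel X] (fun x => \int[mu]_y f n (x, y)).
  by have [] := Pf n.
have mfy n : measurable_fun [set: borel X] (fun y => \int[mu]_x f n (x, y)).
  by have [] := Pf n.
have ndx x : {homo (fun n => \int[mu]_y f n (x, y)) : m n / (m <= n)%N >-> m <= n}.
  move=> m n mn; apply: ge0_le_integral => //; try exact: borel_pair1.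
  by move=> y _; exact: nd.
have ndy y : {homo (fun n => \int[mu]_x f n (x, y)) : m n / (m <= n)%N >-> m <= n}.
  move=> m n mn; apply: ge0_le_integral => //; try exact: borel_pair2.
  by move=> x _; exact: nd.
split.
- by apply: (@emeasurable_fun_cvg _ (borel X) R setT (fun n x => \int[mu]_y f n (x, y))).
- by apply: (@emeasurable_fun_cvg _ (borel X) R setT (fun n y => \int[mu]_x f n (x, y))).
transitivity (limn (fun n => \int[mu]_x \int[mu]_y f n (x, y))).
  rewrite -monotone_convergence//; last by move=> n x _; apply: integral_ge0.
  by apply: eq_integral => x _; rewrite (cvg_lim _ (Ex x)).
transitivity (limn (fun n => \int[mu]_y \int[mu]_x f n (x, y))).
  by congr (limn _); apply/funext => n; have [] := Pf n.
rewrite -monotone_convergence//; last by move=> n x _; apply: integral_ge0.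
by apply: eq_integral => x _; rewrite (cvg_lim _ (Ey x)).
Qed.

End tonelli_functions.

(** * Haar measure *)

Section topological_groups.
Context {G : topologicalGroupType}.
Implicit Types (x y : G) (A B : set G).

Lemma mulg_cvg {T : Type} {F : set_system T} {FF : Filter F} (f h : T -> G) a b :
  f @ F --> a -> h @ F --> b -> (f t * h t)%g @[t --> F] --> (a * b)%g.
Proof.
move=> fa hb; apply: (@cvg_comp _ _ _ (fun t => (f t, h t)) (fun p => (p.1 * p.2)%g) _ (nbhs (a, b))).
  exact: cvg_pair.
exact: (@mulg_continuous G (a, b)).
Qed.

Lemma invg_cvg {T : Type} {F : set_system T} {FF : Filter F} (f : T -> G) a :
  f @ F --> a -> (f t)^-1%g @[t --> F] --> (a^-1)%g.
Proof.
move=> fa; apply: (@cvg_comp _ _ _ f (fun x => (x^-1)%g) _ (nbhs a)) => //.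
exact: (@invg_continuous G a).
Qed.

Lemma continuous_mull x : continuous (fun y => (x * y)%g).
Proof. by move=> y; apply: mulg_cvg; [exact: cvg_cst|exact: cvg_id]. Qed.

Lemma continuous_mulr x : continuous (fun y => (y * x)%g).
Proof. by move=> y; apply: mulg_cvg; [exact: cvg_id|exact: cvg_cst]. Qed.

Lemma continuous_ldiv : continuous (fun p : G * G => (p.1^-1 * p.2)%g).
Proof.
by move=> p; apply: mulg_cvg; [apply: invg_cvg; exact: cvg_fst|exact: cvg_snd].
Qed.

Definition prodset A B : set G := [set (a * b)%g | a in A & b in B].

Lemma compact_prodset A B : compact A -> compact B -> compact (prodset A B).
Proof.
move=> cA cB; have -> : prodset A B = (fun p : G * G => (p.1 * p.2)%g) @` (A `*` B).
  apply/seteqP; split=> [_ [a Aa [b Bb <-]]|_ [[a b] [Aa Bb] <-]]; first by exists (a, b).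
  by exists a => //; exists b.
apply: continuous_compact; last exact: compact_setX.
by apply: continuous_subspaceT; exact: mulg_continuous.
Qed.

Lemma ltranslateE A x : ltranslate A x = (fun y => (x^-1 * y)%g) @^-1` A.
Proof.
apply/seteqP; split => [_ [y Ay <-]|y Ay] /=; first by rewrite mulKg.
by exists (x^-1 * y)%g => //; rewrite mulVKg.
Qed.

Lemma rtranslateE A x : rtranslate A x = (fun y => (y * x^-1)%g) @^-1` A.
Proof.
apply/seteqP; split => [_ [y Ay <-]|y Ay] /=; first by rewrite mulgK.
by exists (y * x^-1)%g => //; rewrite mulgVK.
Qed.

Lemma compact_ltranslate A x : compact A -> compact (ltranslate A x).
Proof.
move=> cA; apply: continuous_compact => //.
by apply: continuous_subspaceT; exact: continuous_mull.
Qed.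

Lemma compact_rtranslate A x : compact A -> compact (rtranslate A x).
Proof.
move=> cA; apply: continuous_compact => //.
by apply: continuous_subspaceT; exact: continuous_mulr.
Qed.

Lemma compact_invset A : compact A -> compact [set (y^-1)%g | y in A].
Proof.
move=> cA; apply: continuous_compact => //.
by apply: continuous_subspaceT; exact: invg_continuous.
Qed.

Lemma measurable_ltranslate A x : measurable (A : set (borel G)) ->
  measurable (ltranslate A x : set (borel G)).
Proof.
move=> mA; rewrite ltranslateE -[X in measurable X]setTI.
exact: (continuous_borel (@continuous_mull x^-1%g)).
Qed.

Lemma measurable_rtranslate A x : measurable (A : set (borel G)) ->
  measurable (rtranslate A x : set (borel G)).
Proof.
move=> mA; rewrite rtranslateE -[X in measurable X]setTI.
exact: (continuous_borel (@continuous_mulr x^-1%g)).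
Qed.

Lemma open_prodset A B : open B -> open (prodset A B).
Proof.
move=> oB; have -> : prodset A B = \bigcup_(a in A) ((fun y => (a^-1 * y)%g) @^-1` B).
  apply/seteqP; split=> [_ [a Aa [b Bb <-]]|y [a Aa] /= Bay].
    by exists a => //=; rewrite mulKg.
  by exists a => //; exists (a^-1 * y)%g => //; rewrite mulVKg.
apply: bigcup_open => a _; apply: open_comp => // y _; exact: continuous_mull.
Qed.

Lemma measurable_ldiv d (T : measurableType d) (b : G -> T) :
  measurable_fun [set: borel G] b ->
  measurable_fun [set: borel (G * G)%type] (fun z : G * G => b (z.1^-1 * z.2)%g).
Proof.
move=> mb; apply: (measurableT_comp mb); exact: continuous_borel continuous_ldiv.
Qed.

Lemma measurable_proj1 d (T : measurableType d) (b : G -> T) :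
  measurable_fun [set: borel G] b ->
  measurable_fun [set: borel (G * G)%type] (fun z : G * G => b z.1).
Proof.
move=> mb; apply: (measurableT_comp mb); apply: continuous_borel => z; exact: cvg_fst.
Qed.

Lemma measurable_proj2 d (T : measurableType d) (b : G -> T) :
  measurable_fun [set: borel G] b ->
  measurable_fun [set: borel (G * G)%type] (fun z : G * G => b z.2).
Proof.
move=> mb; apply: (measurableT_comp mb); apply: continuous_borel => z; exact: cvg_snd.
Qed.

Lemma measurable_invg d (T : measurableType d) (b : G -> T) :
  measurable_fun [set: borel G] b ->
  measurable_fun [set: borel G] (fun z : G => b (z^-1)%g).
Proof.
move=> mb; apply: (measurableT_comp mb); exact: (continuous_borel (@invg_continuous G)).
Qed.

Lemma measurable_mull d (T : measurableType d) (b : G -> T) x :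
  measurable_fun [set: borel G] b ->
  measurable_fun [set: borel G] (fun z : G => b (x * z)%g).
Proof.
move=> mb; apply: (measurableT_comp mb); exact: (continuous_borel (@continuous_mull x)).
Qed.

Lemma measurable_mulr d (T : measurableType d) (b : G -> T) x :
  measurable_fun [set: borel G] b ->
  measurable_fun [set: borel G] (fun z : G => b (z * x)%g).
Proof.
move=> mb; apply: (measurableT_comp mb); exact: (continuous_borel (@continuous_mulr x)).
Qed.

End topological_groups.

Section almost_everywhere_filter.
Context {R : realType} {G : ptopologicalType}.
Variable mu : {measure set (borel G) -> \bar R}.
Implicit Types P Q : G -> Prop.

Lemma aeS P Q : (forall x, P x -> Q x) ->
  (\forall x \ae mu, P x) -> \forall x \ae mu, Q x.
Proof.
move=> PQ [N [mN N0 PN]]; exists N; split => // x /= nQ; apply: PN => /=.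
by move=> /PQ.
Qed.

Lemma ae_all P : (forall x, P x) -> \forall x \ae mu, P x.
Proof. by move=> HP; exists set0; split => // x /=; rewrite /= => /(_ (HP x)). Qed.

Lemma aeI P Q : (\forall x \ae mu, P x) -> (\forall x \ae mu, Q x) ->
  \forall x \ae mu, P x /\ Q x.
Proof.
move=> aP aQ; have := negligibleU aP aQ; apply: negligibleS => x /= /not_andP[]; by [left|right].
Qed.

Lemma aeS2 P Q S : (forall x, P x -> Q x -> S x) ->
  (\forall x \ae mu, P x) -> (\forall x \ae mu, Q x) -> \forall x \ae mu, S x.
Proof. by move=> PQS aP aQ; apply: aeS (aeI aP aQ) => x []; exact: PQS. Qed.

Lemma ae_nat (P : nat -> G -> Prop) : (forall n, \forall x \ae mu, P n x) ->
  \forall x \ae mu, forall n, P n x.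
Proof.
move=> aP; have := negligible_bigcup aP; apply: negligibleS => x /=.
by move=> /existsNP[n nP]; exists n.
Qed.

End almost_everywhere_filter.

Section haar.
Local Open Scope ereal_scope.
Context {R : realType} {G : topologicalGroupType}.
Variables (mu : {measure set (borel G) -> \bar R}) (Delta : G -> R) (V : set G).

Definition haar_group : Prop :=
  [/\ hausdorff_space G, sigma_compact G, left_haar mu,
      modular_function mu Delta & window V].

Hypothesis hG : haar_group.

Lemma mu_compact K : compact K -> mu K < +oo.
Proof. by move: K; have [_ _ [_ + _ _ _] _ _] := hG. Qed.

Lemma mu_ltranslate (A : set (borel G)) x : measurable A -> mu (ltranslate A x) = mu A.
Proof. by have [_ _ [_ _ + _ _] _ _] := hG; exact. Qed.

Lemma mu_rtranslate (A : set (borel G)) x : measurable A ->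
  mu (rtranslate A x) = (Delta x)%:E * mu A.
Proof. by have [_ _ _ + _] := hG; exact. Qed.

Lemma compact_borel (K : set G) : compact K -> measurable (K : set (borel G)).
Proof. by apply: borel_compact; case: hG. Qed.

Lemma windowV x : V (x^-1)%g = V x.
Proof.
have [_ _ _ _ [_ iV _ _]] := hG.
apply/propext; split => Vx; last by rewrite -iV; exists x.
by rewrite -iV; exists (x^-1)%g => //; rewrite invgK.
Qed.

Lemma mV : measurable (V : set (borel G)).
Proof. by have [_ _ _ _ []] := hG. Qed.

Lemma window1 : V 1%g.
Proof. by have [_ _ _ _ [nV _ _ _]] := hG; exact: nbhs_singleton. Qed.

Lemma exhaustion : exists Q : nat -> set G,
  [/\ forall n, compact (Q n), forall n m, (n <= m)%N -> Q n `<=` Q m &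
      \bigcup_n Q n = setT].
Proof.
have [_ [K [cK UK]] _ _ _] := hG.
exists (fun n => \big[setU/set0]_(i < n.+1) K i); split.
- move=> n; elim/big_ind : _ => //; [exact: compact0|exact: compactU].
- by move=> n m nm; exact: (@subset_bigsetU _ K n.+1 m.+1).
- rewrite -subTset -UK => x [n _ Knx]; exists n => //.
  by rewrite big_ord_recr/=; right.
Qed.

(** A compact set times the interior of [V] is open and lies in a compact set, hence has finite
    measure. *)
Lemma open_exhaustion : exists W : nat -> set G,
  [/\ forall n, open (W n), forall n m, (n <= m)%N -> W n `<=` W m,
      forall n, mu (W n) < +oo & \bigcup_n W n = setT].
Proof.
have [_ _ _ _ [nV _ cV _]] := hG.
have [Q [cQ ndQ UQ]] := exhaustion.
exists (fun n => prodset (Q n) V^°); split.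
- move=> n; apply: open_prodset; exact: open_interior.
- by move=> n m nm _ [a Qa [b Vb <-]]; exists a; [exact: ndQ Qa|exists b].
- move=> n; apply: (@le_lt_trans _ _ (mu (prodset (Q n) (closure V)))).
    apply: le_mu.
    + by apply: borel_open; apply: open_prodset; exact: open_interior.
    + by apply: compact_borel; exact: compact_prodset.
    + move=> _ [a Qa [b /interior_subset Vb <-]]; exists a => //; exists b => //.
      exact: subset_closure.
  by apply: mu_compact; exact: compact_prodset.
- rewrite -subTset -UQ => x [n _ Qx]; exists n => //; exists x => //.
  by exists 1%g; [exact: nV|rewrite mulg1].
Qed.

Lemma tonelli (F : G * G -> \bar R) :
  measurable_fun [set: borel (G * G)%type] F -> (forall z, 0 <= F z) ->
  [/\ measurable_fun [set: borel G] (fun x => \int[mu]_y F (x, y)),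
      measurable_fun [set: borel G] (fun y => \int[mu]_x F (x, y)) &
      \int[mu]_x \int[mu]_y F (x, y) = \int[mu]_y \int[mu]_x F (x, y)].
Proof.
have [W [oW ndW fW UW]] := open_exhaustion.
have [T2 _ [_ _ _ _ inner] _ _] := hG.
exact: (tonelli_borel T2 inner oW ndW fW UW).
Qed.

Lemma integral_mull (f : G -> \bar R) x : measurable_fun [set: borel G] f ->
  (forall y, 0 <= f y) -> \int[mu]_y f (x * y)%g = \int[mu]_y f y.
Proof.
move: f; apply: (@ge0_mfun_ind _ (borel G)).
- move=> A mA; rewrite [RHS]integral_indic// setIT.
  rewrite (_ : (fun y => _) = EFin \o \1_(ltranslate A (x^-1)%g)); last first.
    apply/funext => y /=; rewrite !indicE ltranslateE invgK.
    by congr ((nat_of_bool _)%:R%:E); apply/idP/idP; rewrite !inE.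
  rewrite integral_indic//; last exact: measurable_ltranslate.
  by rewrite setIT mu_ltranslate.
- move=> c f c0 mf f0 IH; rewrite !ge0_integralZl// ?IH//.
  exact: measurable_mull.
- move=> f g mf mg f0 g0 IHf IHg.
  rewrite ge0_integralD//; try exact: measurable_mull.
  by rewrite [RHS]ge0_integralD// IHf IHg.
move=> f g mf f0 nd cvgf IH.
have E (u : G -> G) : (forall n, measurable_fun [set: borel G] (f n \o u)) ->
    \int[mu]_y g (u y) = limn (fun n => \int[mu]_y f n (u y)).
  move=> mfu; rewrite -monotone_convergence//.
  by apply: eq_integral => y _; rewrite (cvg_lim _ (cvgf (u y))).
rewrite E; last by move=> n; exact: measurable_mull.
rewrite (E id)//; by congr (limn _); apply/funext => n.
Qed.

Lemma mu_setT_gt0 : 0 < mu setT.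
Proof. by have [_ _ [+ _ _ _ _] _ _] := hG. Qed.

Lemma compact_translates (K : set G) : compact K ->
  exists s : seq G, K `<=` \big[setU/set0]_(x <- s) ltranslate V x.
Proof.
have [_ _ _ _ [nV _ _ _]] := hG.
rewrite compact_cover => /(_ G setT (fun x => ltranslate V^° x)).
case.
- move=> x _; rewrite ltranslateE; apply: open_comp; last exact: open_interior.
  by move=> y _; exact: continuous_mull.
- move=> x _; exists x => //; exists 1%g; [exact: nV|by rewrite mulg1].
move=> D _ KD; exists (enum_fset D) => x /KD[y yD [v /interior_subset Vv <-]].
by rewrite -bigcup_seq; exists y => //; exists v.
Qed.

(** If [V] were null, so would be every compact set, being covered by finitely many translates of
    [V], and then [G] by sigma-compactness. *)
Lemma mu_window_gt0 : 0 < mu V.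
Proof.
rewrite lt0e measure_ge0 andbT; apply/eqP => V0.
have negK K : compact K -> mu.-negligible K.
  move=> /compact_translates[s Ks]; apply: (@negligibleS _ (borel G) _ mu _ _ Ks).
  elim: s {Ks} => [|x s IH]; first by rewrite big_nil; exact: negligible_set0.
  rewrite big_cons; apply: negligibleU => //.
  have mxV := measurable_ltranslate x mV.
  apply/negligibleP; first exact: mxV.
  exact: (etrans (mu_ltranslate x mV) V0).
have [Q [cQ _ UQ]] := exhaustion.
have : mu.-negligible (setT : set (borel G)).
  by rewrite -UQ; apply: negligible_bigcup => n; exact: negK.
by move/negligibleP => /(_ measurableT) T0; move: mu_setT_gt0; rewrite T0 ltxx.
Qed.

Lemma mu_window_fin : mu V < +oo.
Proof.
have [_ _ _ _ [_ _ cV mV']] := hG.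
apply: le_lt_trans (mu_compact cV); apply: le_mu => //.
  by apply: compact_borel.
exact: subset_closure.
Qed.

Definition volV : R := fine (mu V).

Lemma volVE : mu V = volV%:E.
Proof. by rewrite fineK// ge0_fin_numE//; exact: mu_window_fin. Qed.

Lemma volV_gt0 : (0 < volV)%R.
Proof. by rewrite -lte_fin -volVE; exact: mu_window_gt0. Qed.

(** Translating [V] by [x] and back by [x^-1] returns the positive number [mu V], so [Delta x]
    cannot vanish; it cannot be negative because [Delta x * mu V] is a measure. *)
Lemma modular_gt0 x : (0 < Delta x)%R.
Proof.
have : (Delta x)%:E * mu V = mu (rtranslate V x) by rewrite mu_rtranslate//; exact: mV.
have : (Delta (x^-1)%g)%:E * mu (rtranslate V x) = mu V.
  rewrite -mu_rtranslate; last by apply: measurable_rtranslate; exact: mV.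
  congr (mu _); apply/seteqP; split=> [_ [_ [y Vy <-] <-]|y Vy].
    by rewrite mulgK.
  by exists (y * x)%g; [exists y|rewrite mulgK].
move=> E1 E2; have V0 := mu_window_gt0.
have : 0 <= (Delta x)%:E * mu V by rewrite E2.
rewrite volVE -EFinM lee_fin pmulr_lge0; last exact: volV_gt0.
rewrite le_eqVlt => /predU1P[D0|//].
by move: V0; rewrite -E1 -E2 -D0 mul0e mule0 ltxx.
Qed.

Lemma integral_mulr (f : G -> \bar R) x : measurable_fun [set: borel G] f ->
  (forall y, 0 <= f y) ->
  \int[mu]_y f (y * x)%g = (Delta (x^-1)%g)%:E * \int[mu]_y f y.
Proof.
have D0 : 0 <= (Delta (x^-1)%g)%:E by rewrite lee_fin ltW// modular_gt0.
move: f; apply: (@ge0_mfun_ind _ (borel G)).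
- move=> A mA; rewrite [in RHS]integral_indic// setIT.
  rewrite (_ : (fun y => _) = EFin \o \1_(rtranslate A (x^-1)%g)); last first.
    apply/funext => y /=; rewrite !indicE rtranslateE invgK.
    by congr ((nat_of_bool _)%:R%:E); apply/idP/idP; rewrite !inE.
  rewrite integral_indic//; last exact: measurable_rtranslate.
  by rewrite setIT mu_rtranslate.
- move=> c f c0 mf f0 IH; rewrite !ge0_integralZl// ?IH//; first by rewrite muleCA.
  exact: measurable_mulr.
- move=> f g mf mg f0 g0 IHf IHg.
  rewrite ge0_integralD//; try exact: measurable_mulr.
  rewrite [in RHS]ge0_integralD// IHf IHg.
  by rewrite (@ge0_muleDr _ _ (\int[mu]_y f y) (\int[mu]_y g y))//; apply: integral_ge0.
move=> f g mf f0 nd cvgf IH.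
have E (u : G -> G) : (forall n, measurable_fun [set: borel G] (f n \o u)) ->
    \int[mu]_y f n (u y) @[n --> \oo] --> \int[mu]_y g (u y).
  move=> mfu.
  rewrite (_ : (fun y => g (u y)) = fun y => limn (fun n => f n (u y))); last first.
    by apply/funext => y; rewrite (cvg_lim _ (cvgf (u y))).
  exact: cvg_monotone_convergence.
have E1 := E (fun y => y * x)%g (fun n => measurable_mulr x (mf n)).
have E2 := E id mf.
rewrite -(cvg_lim _ E1)//.
under eq_fun do rewrite IH.
apply/cvg_lim => //; apply: cvgeZl => //.
Qed.

Lemma ae_mull (P : G -> Prop) x : (\forall z \ae mu, P z) ->
  \forall y \ae mu, P (x * y)%g.
Proof.
move=> [N [mN N0 PN]]; exists (ltranslate N (x^-1)%g); split.
- exact: measurable_ltranslate.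
- by rewrite mu_ltranslate.
- by move=> y /= /PN Nxy; exists (x * y)%g => //; rewrite mulKg.
Qed.

Lemma ae_mulr (P : G -> Prop) x : (\forall z \ae mu, P z) ->
  \forall y \ae mu, P (y * x)%g.
Proof.
move=> [N [mN N0 PN]]; exists (rtranslate N (x^-1)%g); split.
- exact: measurable_rtranslate.
- by rewrite mu_rtranslate// N0 mule0.
- by move=> y /= /PN Nxy; exists (y * x)%g => //; rewrite mulgK.
Qed.

Lemma integral_ltranslate (f : G -> \bar R) (A : set (borel G)) x :
  measurable_fun [set: borel G] f -> measurable A -> (forall y, 0 <= f y) ->
  \int[mu]_(y in ltranslate A x) f y = \int[mu]_(y in A) f (x * y)%g.
Proof.
move=> mf mA f0.
rewrite integral_mkcond -(integral_mull x); last 2 first.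
- apply/(measurable_restrictT _ _).1 => //; first exact: measurable_ltranslate.
  exact: measurable_funTS.
- by move=> y; rewrite /patch; case: ifP.
rewrite [RHS]integral_mkcond; apply: eq_integral => y _.
rewrite /patch ltranslateE; congr (if _ then _ else _).
by apply/idP/idP; rewrite !inE /= mulKg.
Qed.

(** Apply Tonelli to the indicator of [x^-1 y in N]. Integrating over [y] first gives [0] by left
    invariance; integrating over [x] first gives, for every [y], the measure of the inverse of [N].
    That measure times [mu G] is therefore [0], and [mu G > 0]. *)
Lemma negligible_inv (N : set (borel G)) : measurable N -> mu N = 0 ->
  mu [set y | N (y^-1)%g] = 0.
Proof.
move=> mN N0; pose F (z : G * G) := (\1_N (z.1^-1 * z.2)%g)%:E : \bar R.
have mI : measurable_fun [set: borel G] (fun z => (\1_N z)%:E : \bar R).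
  exact/measurable_EFinP/measurable_indic.
have mN' : measurable ([set y | N (y^-1)%g] : set (borel G)).
  rewrite -[X in measurable X]setTI.
  exact: (continuous_borel (@invg_continuous G)).
have [_ _] := @tonelli F (measurable_ldiv mI) (fun z => ltac:(by rewrite lee_fin)).
have -> : (fun x => \int[mu]_y F (x, y)) = fun=> 0.
  apply/funext => x.
  transitivity (\int[mu]_y (\1_N y)%:E).
    by apply: (integral_mull (x^-1)%g mI) => y; rewrite lee_fin.
  by rewrite integral_indic// setIT.
have -> : (fun x => \int[mu]_y F (y, x)) = fun=> mu [set y | N (y^-1)%g].
  apply/funext => x.
  have /= <- := @integral_mull (fun y => F (y, x)) x.
  - under eq_integral do rewrite /F /= invgM mulgVK.
    rewrite (_ : (fun y => _) = EFin \o \1_[set y | N (y^-1)%g]).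
      by rewrite integral_indic// setIT.
    apply/funext => y /=; rewrite !indicE.
    by congr ((nat_of_bool _)%:R%:E); apply/idP/idP; rewrite !inE.
  - by move: (borel_pair2 x (measurable_ldiv mI)).
  - by move=> y; rewrite lee_fin.
rewrite integral0 integral_cst// => /esym/eqP; rewrite mule_eq0 => /orP[/eqP//|].
by move=> /eqP T0; move: mu_setT_gt0; rewrite T0 ltxx.
Qed.

Lemma ae_inv (P : G -> Prop) : (\forall z \ae mu, P z) ->
  \forall y \ae mu, P (y^-1)%g.
Proof.
move=> [N [mN N0 PN]]; exists [set y | N (y^-1)%g]; split.
- rewrite -[X in measurable X]setTI.
  exact: (continuous_borel (@invg_continuous G)).
- exact: negligible_inv.
- by move=> y /= /PN.
Qed.

Lemma ae_ldiv (P : G -> Prop) x : (\forall z \ae mu, P z) ->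
  \forall y \ae mu, P (y^-1 * x)%g.
Proof.
by move=> aeP; have := ae_inv (ae_mulr x aeP).
Qed.

Lemma ge0_integral0_ae (f : G -> \bar R) : measurable_fun [set: borel G] f ->
  (forall x, 0 <= f x) -> \int[mu]_x f x = 0 -> \forall x \ae mu, f x = 0.
Proof.
move=> mf f0 If0.
have : \int[mu]_x `|f x| = 0.
  by rewrite -[RHS]If0; apply: eq_integral => x _; rewrite gee0_abs.
move/(ae_eq_integral_abs _ measurableT mf) => [N [mN N0 fN]].
by exists N; split => // x /= fx; apply: fN => /= /(_ Logic.I).
Qed.

(** The exceptional sets of [y] depend on [x] and there may be uncountably many of them, so they
    cannot be united; Tonelli for the complement of [A] exchanges the quantifiers instead. *)
Lemma ae_swap (A : set (borel (G * G)%type)) : measurable A ->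
  (forall x, \forall y \ae mu, A (x, y)) ->
  \forall y \ae mu, \forall x \ae mu, A (x, y).
Proof.
move=> mA Ax; have mAC := measurableC mA.
have [W [oW ndW fW UW]] := open_exhaustion.
have [T2 _ [_ _ _ _ inner] _ _] := hG.
have [m1 m2] := tonelli_borel_set T2 inner oW ndW fW UW mAC.
rewrite (_ : (fun x => mu (xsection _ x)) = fun=> 0); last first.
  apply/funext => x; apply/negligibleP; first exact: borel_xsection.
  apply: (@negligibleS _ (borel G) _ mu _ _ _ (Ax x)) => y.
  by rewrite xsectionE.
rewrite integral0 => /esym/(ge0_integral0_ae m2 (fun _ => measure_ge0 _ _)).
apply: aeS => y /negligibleP; rewrite ysectionE; apply.
by rewrite -ysectionE; exact: borel_ysection.
Qed.

End haar.

(** * Complex functions and Lebesgue spaces *)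

Section complex_modulus.
Context {R : realType}.
Implicit Types (a b : R[i]) (r : R).

Lemma cmod_ge0 a : 0 <= cmod a.
Proof. by case: a => x y; exact: sqrtr_ge0. Qed.

Lemma cmodM a b : cmod (a * b) = cmod a * cmod b.
Proof. exact: Normc.normcM. Qed.

Lemma cmodD a b : cmod (a + b) <= cmod a + cmod b.
Proof. exact: le_normcD. Qed.

Lemma cmodN a : cmod (- a) = cmod a.
Proof. exact: normcN. Qed.

Lemma cmod0 : cmod (0 : R[i]) = 0.
Proof. exact: Normc.normc0. Qed.

Lemma cmod1 : cmod (1 : R[i]) = 1.
Proof. exact: Normc.normc1. Qed.

Lemma cmod_eq0 a : cmod a = 0 -> a = 0.
Proof. exact: Normc.eq0_normc. Qed.

Lemma cmod_real r : cmod r%:C%C = `|r|.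
Proof. by rewrite /cmod /= expr0n /= addr0 sqrtr_sqr. Qed.

Lemma cmodB a b : cmod (a - b) <= cmod a + cmod b.
Proof. by rewrite -(cmodN b) cmodD. Qed.

Lemma cmod_sum (I : Type) (s : seq I) (F : I -> R[i]) :
  cmod (\sum_(i <- s) F i) <= \sum_(i <- s) cmod (F i).
Proof.
elim: s => [|i s IH]; first by rewrite !big_nil cmod0.
by rewrite !big_cons (le_trans (cmodD _ _))// lerD2l.
Qed.

End complex_modulus.

Section complex_functions.
Context {R : realType} {G : topologicalGroupType}.
Implicit Types (f g : G -> R[i]) (h : G -> R) (x : G).

Lemma measurable_cmod f : measurable_cfun f ->
  measurable_fun [set: borel G] (fun x => cmod (f x)).
Proof.
move=> [mr mi].
rewrite (_ : (fun x => _) = fun x =>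
    Num.sqrt (complex.Re (f x) ^+ 2 + complex.Im (f x) ^+ 2)).
  apply: (measurableT_comp (continuous_measurable_fun (@sqrt_continuous R))).
  by apply: measurable_funD; exact: measurable_funX.
by apply/funext => x; rewrite /cmod; case: (f x).
Qed.

Lemma measurable_ecmod f : measurable_cfun f ->
  measurable_fun [set: borel G] (fun x => (cmod (f x))%:E).
Proof. by move=> mf; apply/measurable_EFinP; exact: measurable_cmod. Qed.

Lemma measurable_toC h : measurable_fun [set: borel G] h -> measurable_cfun (toC h).
Proof. by move=> mh; split => //=; exact: measurable_cst. Qed.

Lemma measurable_cfunD f g : measurable_cfun f -> measurable_cfun g ->
  measurable_cfun (f + g).
Proof.
move=> [mf1 mf2] [mg1 mg2]; split.
- apply: eq_measurable_fun (measurable_funD mf1 mg1) => x _ /=.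
  by rewrite !fctE; case: (f x) (g x) => [a b] [c d].
- apply: eq_measurable_fun (measurable_funD mf2 mg2) => x _ /=.
  by rewrite !fctE; case: (f x) (g x) => [a b] [c d].
Qed.

Lemma measurable_cfunM f g : measurable_cfun f -> measurable_cfun g ->
  measurable_cfun (fun x => f x * g x).
Proof.
move=> [mf1 mf2] [mg1 mg2]; split.
- apply: eq_measurable_fun (measurable_funB (measurable_funM mf1 mg1) (measurable_funM mf2 mg2)) => x _ /=.
  by case: (f x) (g x) => [a b] [c d].
- apply: eq_measurable_fun (measurable_funD (measurable_funM mf1 mg2) (measurable_funM mf2 mg1)) => x _ /=.
  by case: (f x) (g x) => [a b] [c d].
Qed.

Lemma measurable_cfun_cst (a : R[i]) : measurable_cfun (fun _ : G => a).
Proof. by split; exact: measurable_cst. Qed.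

Lemma measurable_cfunZ (a : R[i]) f : measurable_cfun f -> measurable_cfun (a *: f).
Proof. exact: measurable_cfunM (measurable_cfun_cst a). Qed.

Lemma measurable_cfunN f : measurable_cfun f -> measurable_cfun (- f).
Proof.
move=> mf; rewrite (_ : - f = (-1) *: f); last by rewrite scaleN1r.
exact: measurable_cfunZ.
Qed.

Lemma measurable_cfunB f g : measurable_cfun f -> measurable_cfun g ->
  measurable_cfun (f - g).
Proof. by move=> mf mg; apply: measurable_cfunD => //; exact: measurable_cfunN. Qed.

Lemma measurable_indic_real (A : set (borel G)) : measurable A ->
  measurable_fun [set: borel G] (\1_A : G -> R).
Proof. by move=> mA; exact: measurable_indic. Qed.

Lemma measurable_cutoff (A : set (borel G)) f : measurable A -> measurable_cfun f ->
  measurable_cfun (cutoff A f).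
Proof.
move=> mA mf; apply: measurable_cfunM => //.
by apply: (@measurable_toC (\1_A)); exact: measurable_indic_real.
Qed.

Lemma cmod_cutoff (A : set G) f x : cmod (cutoff A f x) = \1_A x * cmod (f x).
Proof. by rewrite /cutoff cmodM cmod_real ger0_norm. Qed.

Lemma measurable_cfun_sum (I : Type) (s : seq I) (F : I -> G -> R[i]) :
  (forall i, measurable_cfun (F i)) ->
  measurable_cfun (fun x => \sum_(i <- s) F i x).
Proof.
move=> mF; elim: s => [|i s IH].
  by under eq_fun do rewrite big_nil; exact: measurable_cfun_cst.
under eq_fun do rewrite big_cons.
exact: (measurable_cfunD (mF i) IH).
Qed.

Lemma measurable_cfun_cvg (F : nat -> G -> R[i]) f :
  (forall n, measurable_cfun (F n)) ->
  (forall x, \forall n \near \oo, F n x = f x) -> measurable_cfun f.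
Proof.
move=> mF Ff; split.
- apply: (@measurable_fun_cvg _ (borel G) R setT (fun n x => complex.Re (F n x))).
    by move=> n; case: (mF n).
  move=> x _; apply: cvg_near_cst; have := Ff x.
  by apply: filterS => n ->.
- apply: (@measurable_fun_cvg _ (borel G) R setT (fun n x => complex.Im (F n x))).
    by move=> n; case: (mF n).
  move=> x _; apply: cvg_near_cst; have := Ff x.
  by apply: filterS => n ->.
Qed.

End complex_functions.

Section Lebesgue_spaces.
Context {R : realType} {G : topologicalGroupType}.
Variable mu : {measure set (borel G) -> \bar R}.
Implicit Types (f g : G -> R[i]) (w : G -> R).
Hypothesis muT : (0 < mu setT)%E.

Lemma Lp1_norm w f : (forall x, 0 <= w x) ->
  Lnorm mu 1%:E (fun x : borel G => (cmod (f x) * w x)%:E) =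
  (\int[mu]_x (cmod (f x) * w x)%:E)%E.
Proof.
move=> w0; rewrite Lnorm1; apply: eq_integral => x _.
by rewrite gee0_abs// lee_fin mulr_ge0// cmod_ge0.
Qed.

Lemma Lp1P w f : (forall x, 0 <= w x) -> measurable_fun [set: borel G] w ->
  measurable_cfun f -> (\int[mu]_x (cmod (f x) * w x)%:E < +oo)%E ->
  Lp mu 1%:E w f.
Proof.
move=> w0 mw mf fi; split => //; last by rewrite Lp1_norm.
by apply: measurable_funM => //; exact: measurable_cmod.
Qed.

Lemma Lp1_nrm w f : (forall x, 0 <= w x) ->
  nrm (Lp mu 1%:E w) f = fine (\int[mu]_x (cmod (f x) * w x)%:E)%E.
Proof. by move=> w0 /=; rewrite Lp1_norm. Qed.

Lemma Lpoo_norm w f : (forall x, 0 <= w x) ->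
  Lnorm mu +oo%E (fun x : borel G => (cmod (f x) * w x)%:E) =
  ess_sup mu (fun x : borel G => (cmod (f x) * w x)%:E).
Proof.
move=> w0; rewrite unlock /= muT; apply: eq_ess_sup; apply: ae_all => x /=.
by rewrite ger0_norm// mulr_ge0// cmod_ge0.
Qed.

Lemma Lpoo_bound w f : (forall x, 0 <= w x) -> Lp mu +oo%E w f ->
  \forall x \ae mu, cmod (f x) * w x <= nrm (Lp mu +oo%E w) f.
Proof.
move=> w0 [_ _ fin]; rewrite /=.
have n0 := Lnorm_ge0 mu +oo%E (fun x : borel G => (cmod (f x) * w x)%:E).
have : (ess_sup mu (fun x : borel G => (cmod (f x) * w x)%:E) <=
    Lnorm mu +oo%E (fun x : borel G => (cmod (f x) * w x)%:E))%E by rewrite Lpoo_norm.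
move=> /ess_supP; apply: aeS => x.
by rewrite -[X in (_ <= X)%E]fineK ?ge0_fin_numE// lee_fin.
Qed.

Lemma LpooP w f (M : R) : (forall x, 0 <= w x) -> measurable_fun [set: borel G] w ->
  measurable_cfun f -> (\forall x \ae mu, cmod (f x) * w x <= M) ->
  Lp mu +oo%E w f /\ nrm (Lp mu +oo%E w) f <= M.
Proof.
move=> w0 mw mf fM.
have le : (Lnorm mu +oo%E (fun x : borel G => (cmod (f x) * w x)%:E) <= M%:E)%E.
  by rewrite Lpoo_norm//; apply/ess_supP; apply: aeS fM => x; rewrite lee_fin.
have fin : (Lnorm mu +oo%E (fun x : borel G => (cmod (f x) * w x)%:E) < +oo)%E.
  by rewrite (le_lt_trans le)// ltry.
split; first by split => //; apply: measurable_funM => //; exact: measurable_cmod.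
have n0 := Lnorm_ge0 mu +oo%E (fun x : borel G => (cmod (f x) * w x)%:E).
by rewrite -lee_fin fineK// ge0_fin_numE.
Qed.

End Lebesgue_spaces.

(** * Solid translation-invariant BF spaces *)

Section seminormed_spaces.
Context {R : realType} {U : lmodType R[i]} (X : nspace U).
Hypothesis hX : seminormed X.
Implicit Types f g : U.

Lemma mem0 : X 0.
Proof. by case: hX. Qed.

Lemma mem_lin a f g : X f -> X g -> X (a *: f + g).
Proof. by case: hX => _ + _ _ _; apply. Qed.

Lemma nrm_ge0 f : X f -> 0 <= nrm X f.
Proof. by case: hX => _ _ + _ _; apply. Qed.

Lemma nrmZ a f : X f -> nrm X (a *: f) = cmod a * nrm X f.
Proof. by case: hX => _ _ _ + _; apply. Qed.

Lemma nrmD f g : X f -> X g -> nrm X (f + g) <= nrm X f + nrm X g.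
Proof. by case: hX => _ _ _ _; apply. Qed.

Lemma memD f g : X f -> X g -> X (f + g).
Proof. by move=> Xf Xg; rewrite -[f]scale1r; exact: mem_lin. Qed.

Lemma memZ a f : X f -> X (a *: f).
Proof. by move=> Xf; rewrite -[_ *: _]addr0; apply: mem_lin => //; exact: mem0. Qed.

Lemma memN f : X f -> X (- f).
Proof. by move=> Xf; rewrite -scaleN1r; exact: memZ. Qed.

Lemma memB f g : X f -> X g -> X (f - g).
Proof. by move=> Xf Xg; apply: memD => //; exact: memN. Qed.

Lemma nrmN f : X f -> nrm X (- f) = nrm X f.
Proof. by move=> Xf; rewrite -scaleN1r nrmZ// cmodN cmod1 mul1r. Qed.

Lemma nrm0 : nrm X 0 = 0.
Proof. by rewrite -(scale0r (0 : U)) nrmZ ?cmod0 ?mul0r//; exact: mem0. Qed.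

Lemma nrm_triangle f g h : X f -> X g -> X h ->
  nrm X (f - h) <= nrm X (f - g) + nrm X (g - h).
Proof.
move=> Xf Xg Xh; rewrite -(subrKA g f (-h)) nrmD//; exact: memB.
Qed.

Lemma nrm_leB f g : X f -> X g -> nrm X f <= nrm X (f - g) + nrm X g.
Proof. by move=> Xf Xg; rewrite -{1}(subrK g f) nrmD//; exact: memB. Qed.

Lemma nrm_distC f g : X f -> X g -> nrm X (f - g) = nrm X (g - f).
Proof. by move=> Xf Xg; rewrite -opprB nrmN//; exact: memB. Qed.

Hypothesis cX : norm_complete X.

Lemma geometric_limit (u : nat -> U) (c : R) : (forall n, X (u n)) ->
  (forall n, nrm X (u n.+1 - u n) <= c / 2 ^+ n) ->
  exists2 f, X f & forall e : R, 0 < e ->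
    exists N, forall n, (N <= n)%N -> nrm X (u n - f) < e.
Proof.
move=> Xu uS.
have c0 : 0 <= c.
  have := uS 0; rewrite expr0 divr1; apply: le_trans.
  by apply: nrm_ge0; exact: memB.
have p2 n : 0 < (2 ^+ n : R) by rewrite exprn_gt0.
have step m d : nrm X (u (m + d)%N - u m) <= 2 * c / 2 ^+ m.
  (* Subtracting the remaining tail of the geometric series makes the bound telescope, so that the
     induction on [d] closes. *)
  suff : nrm X (u (m + d)%N - u m) <= 2 * c / 2 ^+ m - 2 * c / 2 ^+ (m + d)%N.
    by move=> /le_trans; apply; rewrite gerBl divr_ge0// ?mulr_ge0// ltW.
  elim: d => [|d IH]; first by rewrite addn0 !subrr nrm0.
  apply: (le_trans (nrm_triangle (Xu _) (Xu (m + d)%N) (Xu _))).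
  rewrite addnS; apply: (le_trans (lerD (uS _) IH)).
  rewrite exprS invfM; set a := (2 ^+ (m + d))^-1; set b := (2 ^+ m)^-1.
  lra.
have [|f Xf uf] := cX Xu.
  move=> e e0; pose N := Num.trunc (4 * c / e); exists N.
  have small : 4 * c / 2 ^+ N < e.
    rewrite ltr_pdivrMr// (mulrC e) -ltr_pdivrMr//.
    have N2 : (N.+1%:R : R) <= 2 ^+ N by rewrite -natrX ler_nat ltn_expl.
    exact: lt_le_trans (truncnS_gt _) N2.
  move=> m n Nm Nn; apply: le_lt_trans small.
  apply: (le_trans (nrm_triangle (Xu _) (Xu N) (Xu _))).
  rewrite [X in _ + X]nrm_distC//.
  have := step N (m - N)%N; have := step N (n - N)%N; rewrite !subnKC//.
  set b := (2 ^+ N)^-1; lra.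
exists f => // e e0.
move/cvgrPdist_lt : uf => /(_ e e0)[N _ uN]; exists N => n Nn.
have := uN n Nn; rewrite /= sub0r normrN ger0_norm//.
by apply: nrm_ge0; exact: memB.
Qed.

End seminormed_spaces.

Section BF_spaces.
Context {R : realType} {G : topologicalGroupType}.
Variables (mu : {measure set (borel G) -> \bar R}) (Delta : G -> R) (V : set G).
Variable E : nspace (G -> R[i]).
Hypothesis hG : haar_group mu Delta V.
Hypothesis hE : solid_TI_BF mu Delta E.
Implicit Types (f g : G -> R[i]) (x : G).

Lemma BF_seminormed : seminormed E.
Proof. by case: hE => -[[]]. Qed.
Let sE := BF_seminormed.

Lemma BF_complete : norm_complete E.
Proof. by case: hE => -[[]]. Qed.

Lemma BF_measurable f : E f -> measurable_cfun f.
Proof. by case: hE => -[_ _ _ L _] _ _ /L[]. Qed.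

Lemma BF_nrm_eq0 f : E f -> (nrm E f = 0 <-> \forall x \ae mu, f x = 0).
Proof. by case: hE => -[_ _ + _ _] _ _; apply. Qed.

Lemma BF_solid f g : E f -> measurable_cfun g ->
  (\forall x \ae mu, cmod (g x) <= cmod (f x)) -> E g /\ nrm E g <= nrm E f.
Proof. by case: hE => _ + _; apply. Qed.

Lemma BF_abs f : E f -> E (toC (fun x => cmod (f x))) /\
  nrm E (toC (fun x => cmod (f x))) = nrm E f.
Proof.
move=> Ef; have mf := BF_measurable Ef.
have [|||Ea na] := @BF_solid f (toC (fun x => cmod (f x))) => //.
- by apply: measurable_toC; exact: measurable_cmod.
- by apply: ae_all => x; rewrite /toC cmod_real ger0_norm// cmod_ge0.
split => //; apply/le_anti; rewrite na /=.
have [|||//] := @BF_solid (toC (fun x => cmod (f x))) f => //.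
by apply: ae_all => x; rewrite /toC cmod_real ger0_norm// cmod_ge0.
Qed.

Lemma BF_ae f g : E f -> measurable_cfun g -> (\forall x \ae mu, f x = g x) ->
  E g /\ nrm E g = nrm E f.
Proof.
move=> Ef mg fg.
have [|||Eg ng] := @BF_solid f g => //; first by apply: aeS fg => x ->.
split => //; apply/le_anti; rewrite ng /=.
have [|||//] := @BF_solid g f => //; first exact: BF_measurable.
by apply: aeS fg => x ->.
Qed.

Lemma BF_nrm_le_eq0 f : E f -> (forall e : R, 0 < e -> nrm E f < e) ->
  \forall x \ae mu, f x = 0.
Proof.
move=> Ef fe; apply/(BF_nrm_eq0 Ef)/le_anti; rewrite (nrm_ge0 sE)// andbT.
by apply/ler_addgt0Pr => e e0; rewrite add0r ltW// fe.
Qed.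

(* A positive operator on a Banach lattice is bounded: otherwise the sum of a
   suitable series of nonnegative functions would have an image of infinite
   norm. *)
Lemma composition_bounded (tau : G -> G) :
  (forall P : G -> Prop, (\forall x \ae mu, P x) -> \forall x \ae mu, P (tau x)) ->
  (forall f, E f -> E (f \o tau)) ->
  exists M : R, forall f, E f -> nrm E (f \o tau) <= M * nrm E f.
Proof.
move=> aet Et; apply: contrapT => /forallNP nM.
have p2 n : 0 < (2 ^+ n : R) by rewrite exprn_gt0.
have /choice[h hP] : forall n : nat, exists f : G -> R, [/\ E (toC f),
    forall x, 0 <= f x, nrm E (toC f) <= 1 / 2 ^+ n &
    n%:R < nrm E (toC f \o tau)].
  move=> n; have /existsNP[f /not_implyP[Ef]] := nM (n%:R * 2 ^+ n).
  move=> /negP; rewrite -ltNge => fn.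
  have nf : 0 < nrm E f.
    rewrite lt_neqAle (nrm_ge0 sE)// andbT eq_sym; apply/eqP => nf0.
    have /(BF_nrm_eq0 (Et _ Ef)) nft : \forall x \ae mu, (f \o tau) x = 0.
      by have /(BF_nrm_eq0 Ef)/aet := nf0.
    by move: fn; rewrite nf0 nft mulr0 ltxx.
  have [Ea na] := BF_abs Ef; have [Eta nta] := BF_abs (Et _ Ef).
  (* The failing bound was taken with constant [n 2^n], so this scaling gives norm [2^-n], summable
     in [n], while the image keeps norm above [n]. *)
  set c := (2 ^+ n * nrm E f)^-1.
  have c0 : 0 < c by rewrite invr_gt0 mulr_gt0.
  have fE : toC (fun x => c * cmod (f x)) = c%:C%C *: toC (fun x => cmod (f x)).
    by apply/funext => x; rewrite /toC fctE rmorphM.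
  exists (fun x => c * cmod (f x)); rewrite fE; split.
  - exact: (memZ sE).
  - by move=> x; apply: mulr_ge0; [exact: ltW|exact: cmod_ge0].
  - rewrite (nrmZ sE)// na cmod_real (ger0_norm (ltW c0)) /c invfM -mulrA mulVf ?mulr1 ?div1r//.
    by rewrite gt_eqF.
  - rewrite (_ : _ \o _ = c%:C%C *: toC (fun x => cmod ((f \o tau) x)))//.
    rewrite (nrmZ sE)// nta cmod_real (ger0_norm (ltW c0)) /c mulrC ltr_pdivlMr ?mulr_gt0//.
    by rewrite mulrA.
pose S n := toC (fun x => \sum_(k < n) h k x).
have SS n : S n.+1 = S n + toC (h n).
  by apply/funext => x; rewrite /S /toC big_ord_recr rmorphD.
have Eh n : E (toC (h n)) by case: (hP n).
have h0 n x : 0 <= h n x by case: (hP n).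
have ES n : E (S n).
  elim: n => [|n IH]; last by rewrite SS; exact: (memD sE).
  rewrite (_ : S 0 = 0); first exact: (mem0 sE).
  by apply/funext => x; rewrite /S /toC big_ord0.
have [|F EF SF] := @geometric_limit _ _ E sE BF_complete S 1 ES.
  by move=> n; rewrite SS addrAC subrr add0r; case: (hP n).
(* [F] is only a limit in norm, so the comparison is not made pointwise: the positive part [d] of
   [h k - |F|] lies below [|S n - F|] for every [n > k], hence has norm [0]. *)
have hF k : \forall x \ae mu, cmod (toC (h k) x) <= cmod (F x).
  pose d : G -> R[i] := toC (fun x => Num.max 0 (h k x - cmod (F x))).
  have mh : measurable_fun [set: borel G] (h k).
    by have [+ _] := BF_measurable (Eh k).
  have md : measurable_cfun d.
    apply: measurable_toC; apply: measurable_maxr; first exact: measurable_cst.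
    by apply: measurable_funB => //; apply: measurable_cmod; exact: BF_measurable.
  have dS n : (k < n)%N -> forall x, cmod (d x) <= cmod ((S n - F) x).
    move=> kn x; rewrite /d /toC cmod_real ger0_norm ?le_max ?lexx//.
    rewrite ge_max cmod_ge0 /= lerBlDr.
    have hS : h k x <= cmod (S n x).
      rewrite /S /toC cmod_real ger0_norm; last by apply: sumr_ge0 => i _.
      by rewrite (bigD1 (Ordinal kn))//= lerDl sumr_ge0.
    apply: (le_trans hS); rewrite -{1}(subrK (F x) (S n x)); exact: cmodD.
  have Ed : E d.
    have [|||//] := @BF_solid (S k.+1 - F) d => //; first exact: (memB sE).
    by apply: ae_all; exact: dS.
  have : \forall x \ae mu, d x = 0.
    apply: BF_nrm_le_eq0 => // e e0; have [N SN] := SF e e0.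
    apply: le_lt_trans (SN (maxn N k.+1) (leq_maxl _ _)).
    have [|||//] := @BF_solid (S (maxn N k.+1) - F) d => //; first exact: (memB sE).
    by apply: ae_all; apply: dS; exact: leq_maxr.
  apply: aeS => x; rewrite /d {2}/toC cmod_real ger0_norm// => -[/eqP].
  by rewrite eq_maxl subr_le0.
pose k := Num.trunc (nrm E (F \o tau)).
have [_ _ _] := hP k.+1; rewrite ltNge => /negP; apply.
have [|||_ le] := @BF_solid (F \o tau) (toC (h k.+1) \o tau) => //.
- exact: Et.
- by apply: BF_measurable; exact: Et.
- exact: (aet _ (hF k.+1)).
by rewrite (le_trans le)// ltW// truncnS_gt.
Qed.

(** [opnorm] is a supremum of reals, and [composition_bounded] is what bounds the set above. A
    function of norm [0] cannot be normalised; it vanishes almost everywhere and so does its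
    composition with [tau]. *)
Lemma opnorm_composition (tau : G -> G) f :
  (forall P : G -> Prop, (\forall x \ae mu, P x) -> \forall x \ae mu, P (tau x)) ->
  (forall f, E f -> E (f \o tau)) -> E f ->
  nrm E (f \o tau) <= opnorm E (fun f => f \o tau) * nrm E f.
Proof.
move=> aet Et Ef; have [M bM] := composition_bounded aet Et.
have [nf0|nf0] := eqVneq (nrm E f) 0.
  rewrite nf0 mulr0 le_eqVlt; apply/orP; left; apply/eqP/(BF_nrm_eq0 (Et _ Ef)).
  by have /(BF_nrm_eq0 Ef)/aet := nf0.
have nf : 0 < nrm E f by rewrite lt_neqAle eq_sym nf0 (nrm_ge0 sE).
rewrite -ler_pdivrMr//.
have c0 : 0 < (nrm E f)^-1 by rewrite invr_gt0.
apply: sup_ubound.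
  exists `|M| => _ [g [Eg ng] <-]; apply: (le_trans (bM g Eg)).
  apply: (@le_trans _ _ (`|M| * nrm E g)).
    by rewrite ler_wpM2r ?ler_norm// (nrm_ge0 sE).
  by rewrite ler_piMr.
exists ((nrm E f)^-1%:C%C *: f).
  split; first exact: (memZ sE).
  by rewrite (nrmZ sE)// cmod_real ger0_norm ?mulVf// ltW.
rewrite (_ : _ \o tau = (nrm E f)^-1%:C%C *: (f \o tau))//.
by rewrite (nrmZ sE) ?cmod_real ?ger0_norm 1?mulrC ?ltW//; exact: Et.
Qed.

Lemma opnorm_ge0 (tau : G -> G) :
  (forall P : G -> Prop, (\forall x \ae mu, P x) -> \forall x \ae mu, P (tau x)) ->
  (forall f, E f -> E (f \o tau)) ->
  0 <= opnorm E (fun f => f \o tau).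
Proof.
move=> aet Et; have [M bM] := composition_bounded aet Et.
apply: (@le_trans _ _ (nrm E (0 \o tau))).
  by apply: (nrm_ge0 sE); apply: Et; exact: (mem0 sE).
apply: sup_ubound.
  exists `|M| => _ [g [Eg ng] <-]; apply: (le_trans (bM g Eg)).
  apply: (@le_trans _ _ (`|M| * nrm E g)).
    by rewrite ler_wpM2r ?ler_norm// (nrm_ge0 sE).
  by rewrite ler_piMr.
by exists 0 => //; split; [exact: (mem0 sE)|rewrite (nrm0 sE)].
Qed.

Lemma BF_Ltrans x f : E f -> E (Ltrans x f).
Proof. by case: hE => _ _ [/(_ x f) T _ _ _ _] /T[]. Qed.

Lemma BF_Rtrans x f : E f -> E (Rtrans x f).
Proof. by case: hE => _ _ [/(_ x f) T _ _ _ _] /T[]. Qed.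

Lemma Ltrans_bound x f : E f -> nrm E (Ltrans x f) <= uweight E x * nrm E f.
Proof.
move=> Ef; apply: (@opnorm_composition (fun y => x^-1 * y)%g) => //.
- by move=> P; exact: (ae_mull hG).
- by move=> h; exact: BF_Ltrans.
Qed.

Lemma uweight_ge0 x : 0 <= uweight E x.
Proof.
apply: (@opnorm_ge0 (fun y => x^-1 * y)%g) => //.
- by move=> P; exact: (ae_mull hG).
- by move=> h; exact: BF_Ltrans.
Qed.

Lemma vweight_ge0 x : 0 <= vweight Delta E x.
Proof.
apply: mulr_ge0; first by apply: ltW; exact: (modular_gt0 hG).
apply: (@opnorm_ge0 (fun y => y * x^-1)%g) => //.
- by move=> P; exact: (ae_mulr hG).
- by move=> h; exact: BF_Rtrans.
Qed.

(* [dominated a r]: [a] lies below the modulus of an element of [E] of norm at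
   most [r]; by solidity this controls every measurable function below [a]
   without [a] having to be real-valued or in [E] itself. *)
Definition dominated (a : G -> \bar R) (r : R) : Prop :=
  exists f, [/\ E f, nrm E f <= r & \forall x \ae mu, (a x <= (cmod (f x))%:E)%E].

Lemma dominated_mem a r f : dominated a r -> measurable_cfun f ->
  (\forall x \ae mu, ((cmod (f x))%:E <= a x)%E) -> E f /\ nrm E f <= r.
Proof.
move=> [g [Eg ng ag]] mf fa.
have [|Ef nf] := BF_solid Eg mf; last by split=> //; exact: le_trans ng.
by apply: aeS2 fa ag => x fx gx; rewrite -lee_fin (le_trans fx).
Qed.

Lemma dominated_self f : E f -> dominated (fun x => (cmod (f x))%:E) (nrm E f).
Proof. by move=> Ef; exists f; split => //; apply: ae_all. Qed.

Lemma dominated_le a b r s : (\forall x \ae mu, (b x <= a x)%E) -> r <= s ->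
  dominated a r -> dominated b s.
Proof.
move=> ba rs [f [Ef nf af]]; exists f; split => //; first exact: le_trans rs.
by apply: aeS2 ba af => x; exact: le_trans.
Qed.

Lemma dominated_ge0 a r : dominated a r -> 0 <= r.
Proof. by move=> [f [Ef nf _]]; apply: le_trans nf; exact: (nrm_ge0 sE). Qed.

Lemma dominatedD a b r s : dominated a r -> dominated b s ->
  dominated (fun x => a x + b x)%E (r + s).
Proof.
move=> [f [Ef nf af]] [g [Eg ng bg]].
have [Ea na] := BF_abs Ef; have [Eb nb] := BF_abs Eg.
exists (toC (fun x => cmod (f x)) + toC (fun x => cmod (g x))); split.
- exact: (memD sE).
- by rewrite (le_trans (nrmD sE _ _))// na nb lerD.
- apply: aeS2 af bg => x afx bgx; rewrite fctE /toC -rmorphD cmod_real.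
  by rewrite ger0_norm ?addr_ge0 ?cmod_ge0// EFinD leeD.
Qed.

Lemma dominatedZ a r (c : R) : 0 <= c -> dominated a r ->
  dominated (fun x => c%:E * a x)%E (c * r).
Proof.
move=> c0 [f [Ef nf af]]; exists (c%:C%C *: f); split.
- exact: (memZ sE).
- by rewrite (nrmZ sE)// cmod_real ger0_norm// ler_wpM2l.
- apply: aeS af => x afx; rewrite fctE -[_ *: _]/(_ * _) cmodM cmod_real.
  by rewrite ger0_norm// EFinM lee_wpmul2l.
Qed.

Lemma dominated_fin a r : (forall x, 0 <= a x)%E -> dominated a r ->
  \forall x \ae mu, (a x < +oo)%E.
Proof.
by move=> a0 [f [_ _ af]]; apply: aeS af => x /le_lt_trans; apply; rewrite ltry.
Qed.

Local Open Scope ereal_scope.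

(** For nonnegative functions this is meaningful at every point, unlike [convol], which needs an
    integrable integrand. Estimates are made with [econv] and transferred to [E] through
    [dominated]. *)
Definition econv (a b : G -> \bar R) (x : G) : \bar R :=
  \int[mu]_y (a y * b (y^-1 * x)%g).

Implicit Types a b : G -> \bar R.

Lemma econv_ge0 a b x : (forall y, 0 <= a y) -> (forall y, 0 <= b y) ->
  0 <= econv a b x.
Proof. by move=> a0 b0; apply: integral_ge0 => y _; rewrite mule_ge0. Qed.

Lemma measurable_ldivr d (T : measurableType d) (b : G -> T) x :
  measurable_fun [set: borel G] b ->
  measurable_fun [set: borel G] (fun y => b (y^-1 * x)%g).
Proof. by move=> mb; exact: (measurable_invg (measurable_mulr x mb)). Qed.

Lemma measurable_econv_integrand a b x : measurable_fun [set: borel G] a ->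
  measurable_fun [set: borel G] b ->
  measurable_fun [set: borel G] (fun y => a y * b (y^-1 * x)%g).
Proof.
by move=> ma mb; apply: emeasurable_funM => //; exact: measurable_ldivr.
Qed.

Lemma measurable_econv a b : measurable_fun [set: borel G] a ->
  measurable_fun [set: borel G] b -> (forall y, 0 <= a y) -> (forall y, 0 <= b y) ->
  measurable_fun [set: borel G] (econv a b).
Proof.
move=> ma mb a0 b0.
have [] // := @tonelli _ _ _ _ _ hG (fun z => a z.1 * b (z.1^-1 * z.2)%g).
- by apply: emeasurable_funM; [exact: measurable_proj1|exact: measurable_ldiv].
- by move=> z; rewrite mule_ge0.
Qed.

Lemma econv_ae_le a b a' b' x :
  measurable_fun [set: borel G] a -> measurable_fun [set: borel G] b ->
  measurable_fun [set: borel G] a' -> measurable_fun [set: borel G] b' ->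
  (forall y, 0 <= a y) -> (forall y, 0 <= b y) ->
  (\forall y \ae mu, a y <= a' y) -> (\forall y \ae mu, b y <= b' y) ->
  econv a b x <= econv a' b' x.
Proof.
move=> ma mb ma' mb' a0 b0 aa' bb'.
rewrite /econv.
have m1 := measurable_econv_integrand x ma mb.
have m2 := measurable_econv_integrand x ma' mb'.
have le : \forall y \ae mu, a y * b (y^-1 * x)%g <= a' y * b' (y^-1 * x)%g.
  apply: aeS2 aa' (ae_ldiv hG x bb') => y h1 h2.
  by apply: lee_pmul.
(* The comparison theorem asks for nonnegativity everywhere, which [a'] and [b'] satisfy only almost
   everywhere; truncation at [0] leaves the integral unchanged. *)
pose c y := maxe (a' y * b' (y^-1 * x)%g) 0.
have mc : measurable_fun [set: borel G] c by exact: measurable_maxe.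
apply: (@le_trans _ _ (\int[mu]_y c y)).
  apply: ae_ge0_le_integral => //.
  - by move=> y _; rewrite mule_ge0.
  - by move=> y _; rewrite le_max lexx orbT.
  - by apply: aeS le => y h _; rewrite le_max h.
rewrite le_eqVlt; apply/orP; left; apply/eqP; apply: ae_eq_integral => //.
apply: aeS le => y h _; rewrite /c; apply/max_idPl; apply: le_trans h.
by rewrite mule_ge0.
Qed.

End BF_spaces.

(** * Weights, Young's inequality and local bounds *)

Section weights.
Context {R : realType} {G : topologicalGroupType}.
Variables (mu : {measure set (borel G) -> \bar R}) (Delta : G -> R) (V : set G).
Variables (w : G -> R).
Hypothesis hw : admissible_weight Delta w.

Lemma weight_measurable : measurable_fun [set: borel G] w.
Proof. by case: hw. Qed.

Lemma weight_gt0 x : 0 < w x.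
Proof. by case: hw. Qed.

Lemma weight_ge0 x : 0 <= w x.
Proof. exact/ltW/weight_gt0. Qed.

Lemma weight_inv x : w x = Delta (x^-1)%g * w (x^-1)%g.
Proof. by case: hw. Qed.

Lemma weight_mul x y : w (x * y)%g <= w x * w y.
Proof. by case: hw. Qed.

Lemma measurable_weight_inv : measurable_fun [set: borel G] (fun x => (w x)^-1).
Proof.
rewrite (_ : (fun x => _) = fun x => w x `^ (-1)); last first.
  by apply/funext => x; rewrite powR_inv1// weight_ge0.
exact: (measurableT_comp (measurable_powR _) weight_measurable).
Qed.

Lemma weight_bounded (K : set G) : compact K ->
  exists2 M : R, 0 < M & forall x, K x -> w x <= M.
Proof.
move=> cK; have [_ _ loc _ _] := hw.
have : \forall M \near +oo, K `<=` (fun x => w x <= M).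
  apply: ((compact_near_coveringP K).1 cK _ _ (fun M x => w x <= M)) => x _.
  have [M xM] := loc x.
  exists ([set y | w y <= M], [set N | M <= N]) => /=.
    by split => //; apply: nbhs_pinfty_ge; exact: num_real.
  by move=> [y N] /= [/le_trans]; apply.
move=> [M0 [_ KM]]; exists (`|M0| + 1); first by rewrite ltr_wpDl.
by move=> x; apply: KM; rewrite (le_lt_trans (ler_norm _))// ltrDl.
Qed.

Lemma measurable_eweight : measurable_fun [set: borel G] (fun x => (w x)%:E).
Proof. by apply/measurable_EFinP; exact: weight_measurable. Qed.

End weights.

Section weighted_BF_spaces.
Context {R : realType} {G : topologicalGroupType}.
Variables (mu : {measure set (borel G) -> \bar R}) (Delta : G -> R) (V : set G).
Variables (E : nspace (G -> R[i])) (w : G -> R).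
Hypothesis hG : haar_group mu Delta V.
Hypothesis hE : solid_TI_BF mu Delta E.
Hypothesis hw : admissible_for Delta E w.
Implicit Types (f g : G -> R[i]) (x : G).

Let hwa : admissible_weight Delta w := proj1 hw.

Lemma weight_dominates : exists2 c : R, 0 < c & forall x,
  [/\ uweight E x <= c * w x, uweight E (x^-1)%g <= c * w x & vweight Delta E x <= c * w x].
Proof.
have [_ [c c0 wc]] := hw; exists c^-1; first by rewrite invr_gt0.
move=> x; have := wc x; rewrite -ler_pdivlMl// !ge_max => /andP[/andP[-> ->] /andP[-> _]].
by [].
Qed.

Local Open Scope ereal_scope.

(** This is the convolution relation of [E] with [L^1_v], together with [v <= c w]. Hypothesis and
    conclusion on [a] are both domination, so the estimate can be iterated along convolutions that
    are not themselves known to be elements of [E]. *)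
Lemma young : exists2 c : R, (0 < c)%R &
  forall (a b : G -> \bar R) (r s : R),
    measurable_fun [set: borel G] a -> measurable_fun [set: borel G] b ->
    (forall x, 0 <= a x) -> (forall x, 0 <= b x) ->
    dominated mu E a r -> \int[mu]_x (b x * (w x)%:E) <= s%:E ->
    dominated mu E (econv mu a b) (c * r * s).
Proof.
have [c c0 wc] := weight_dominates; exists c => // a b r s ma mb a0 b0.
move=> da bs; have r0 := dominated_ge0 hE da.
have [f [Ef nf af]] := da; have mf := BF_measurable hE Ef.
have [Ea na] := BF_abs hE Ef.
pose b' := fun x => fine (b x).
have mb' : measurable_fun [set: borel G] b'.
  exact: (measurableT_comp (@fine_measurable R setT measurableT)).
have b'0 x : (0 <= b' x)%R by exact: fine_ge0.
(* [b] is finite almost everywhere, since [b w] is integrable and [w > 0]. *)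
have bb' : \forall x \ae mu, b x = (b' x)%:E.
  have mbw : measurable_fun [set: borel G] (fun x => b x * (w x)%:E).
    by apply: emeasurable_funM => //; exact: measurable_eweight hwa.
  have : mu.-integrable [set: borel G] (fun x => b x * (w x)%:E).
    apply/integrableP; split => //; apply: le_lt_trans (ltry s).
    apply: le_trans bs; under eq_integral do rewrite gee0_abs ?mule_ge0 ?lee_fin ?(weight_ge0 hwa)//.
    by [].
  move=> /(integrable_ae measurableT); apply: aeS => x /(_ Logic.I).
  rewrite /b'; have := b0 x; case: (b x) => //= _.
  by rewrite gt0_mulye// lte_fin; exact: weight_gt0 hwa x.
have mv : measurable_fun [set: borel G] (vweight Delta E).
  by case: hE => _ _ [].
have intb' : \int[mu]_x (cmod (toC b' x) * vweight Delta E x)%:E <= (c * s)%:E.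
  apply: (@le_trans _ _ (\int[mu]_x (c%:E * (b x * (w x)%:E)))).
    apply: ae_ge0_le_integral => //.
    - by move=> x _; rewrite lee_fin mulr_ge0 ?cmod_ge0 ?(vweight_ge0 hG hE).
    - apply/measurable_EFinP/measurable_funM => //.
      by apply: measurable_cmod; exact: measurable_toC.
    - by move=> x _; rewrite !mule_ge0// lee_fin ?(weight_ge0 hwa)// ltW.
    - apply: measurable_funeM; apply: emeasurable_funM => //.
      exact: measurable_eweight hwa.
    apply: aeS bb' => x bx _; rewrite bx /toC cmod_real ger0_norm// -(EFinM (b' x)) -(EFinM c) lee_fin.
    by rewrite (mulrCA c) ler_wpM2l//; case: (wc x).
  rewrite ge0_integralZl//.
  - by rewrite EFinM lee_wpmul2l// lee_fin ltW.
  - by apply: emeasurable_funM => //; exact: measurable_eweight hwa.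
  - by move=> x _; rewrite mule_ge0// lee_fin (weight_ge0 hwa).
  - by rewrite lee_fin ltW.
have Lb' : Lp mu 1%:E (vweight Delta E) (toC b').
  apply: (Lp1P (vweight_ge0 hG hE) mv (measurable_toC mb')).
  by rewrite (le_lt_trans intb')// ltry.
have [_ _ [_ _ _ _ /(_ _ _ Ea Lb')[cd Ec nc]]] := hE.
exists (convol mu (toC (fun x => cmod (f x))) (toC b')); split => //.
  apply: (le_trans nc); rewrite na Lp1_nrm; last exact: (vweight_ge0 hG hE).
  apply: (@le_trans _ _ (r * (c * s))%R); last by rewrite mulrCA mulrA.
  apply: ler_pM => //; first exact: (nrm_ge0 (BF_seminormed hE)).
  + by apply: fine_ge0; apply: integral_ge0 => x _; rewrite lee_fin mulr_ge0 ?cmod_ge0 ?(vweight_ge0 hG hE).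
  + rewrite -lee_fin fineK// ge0_fin_numE ?(le_lt_trans intb') ?ltry//.
    by apply: integral_ge0 => x _; rewrite lee_fin mulr_ge0 ?cmod_ge0 ?(vweight_ge0 hG hE).
apply: aeS cd => x [mI II].
pose h y := (cmod (f y) * b' (y^-1 * x)%g)%R.
have h0 y : (0 <= h y)%R by rewrite mulr_ge0 ?cmod_ge0.
have hE' y : (toC (fun x => cmod (f x)) y * toC b' (y^-1 * x)%g = (h y)%:C%C)%R.
  by rewrite /toC -rmorphM.
have fin_h : \int[mu]_y (h y)%:E < +oo.
  move: II; under eq_integral do rewrite hE' cmod_real ger0_norm//.
  by [].
have -> : convol mu (toC (fun x => cmod (f x))) (toC b') x = (fine (\int[mu]_y (h y)%:E))%:C%C.
  rewrite /convol /cintegral; congr (_ +i* _)%C.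
    by rewrite /Rintegral; congr fine; apply: eq_integral => y _; rewrite hE'.
  under eq_Rintegral do rewrite hE' /=.
  by rewrite /Rintegral integral0.
have Ih0 : 0 <= \int[mu]_y (h y)%:E by apply: integral_ge0 => y _; rewrite lee_fin.
rewrite cmod_real ger0_norm ?fine_ge0// fineK ?ge0_fin_numE//.
have -> : \int[mu]_y (h y)%:E = econv mu (fun y => (cmod (f y))%:E) (fun y => (b' y)%:E) x.
  by apply: eq_integral => y _; rewrite -EFinM.
apply: (econv_ae_le hG) => //.
- exact: measurable_ecmod.
- exact/measurable_EFinP.
- by apply: aeS bb' => y ->.
Qed.

(* The embedding of [E] into [W(L^1, L^oo_{1/w})], on arbitrary compact sets. *)
Lemma BF_local_bound (K : set G) : compact K -> exists2 c : R, (0 <= c)%R &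
  forall f x, E f ->
    \int[mu]_(y in ltranslate K x) (cmod (f y))%:E <= (c * w x * nrm E f)%:E.
Proof.
move=> cK; have [c c0 wc] := weight_dominates.
have [[_ _ _ _ /(_ K cK)[C0 hC]] _ _] := hE.
exists (`|C0| * c)%R; first by rewrite mulr_ge0// ltW.
move=> f x Ef; have mf := BF_measurable hE Ef.
rewrite (integral_ltranslate hG)//; last 3 first.
- exact: measurable_ecmod.
- exact: (compact_borel hG).
- by move=> y; rewrite lee_fin cmod_ge0.
have := hC _ (BF_Ltrans hE (x^-1)%g Ef); rewrite /Ltrans.
under eq_integral do rewrite invgK.
move=> /le_trans; apply; rewrite lee_fin.
apply: (@le_trans _ _ (`|C0| * nrm E (Ltrans (x^-1)%g f))%R).
  by rewrite ler_wpM2r ?ler_norm//; apply: (nrm_ge0 (BF_seminormed hE)); exact: (BF_Ltrans hE _ Ef).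
rewrite -!mulrA ler_wpM2l// (le_trans (Ltrans_bound hG hE _ Ef))// mulrA ler_wpM2r//.
  exact: (nrm_ge0 (BF_seminormed hE)).
by case: (wc x).
Qed.

(* [uweight x * uweight x^-1 >= 1] as soon as [E] is nontrivial. *)
Lemma weight_bounded_below f : E f -> nrm E f != 0%R ->
  exists2 c : R, (0 < c)%R & forall x, (c <= w x)%R.
Proof.
move=> Ef nf0; have [c c0 wc] := weight_dominates.
have nf : (0 < nrm E f)%R by rewrite lt_neqAle eq_sym nf0 (nrm_ge0 (BF_seminormed hE)).
exists c^-1%R; first by rewrite invr_gt0.
move=> x; rewrite -[(c^-1)%R]mulr1 ler_pdivrMl//.
have [u1 u2 _] := wc x; set W := (c * w x)%R in u1 u2 *.
have W0 : (0 <= W)%R by rewrite mulr_ge0 ?ltW// (weight_gt0 hwa).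
have fE : Ltrans x (Ltrans (x^-1)%g f) = f.
  by apply/funext => y; rewrite /Ltrans invgK mulVKg.
have Ef' : E (Ltrans (x^-1)%g f) by exact: (BF_Ltrans hE _ Ef).
have W2 : (nrm E f <= W * (W * nrm E f))%R.
  rewrite -[X in (X <= _)%R](congr1 (nrm E) fE).
  apply: (le_trans (Ltrans_bound hG hE _ Ef')); apply: ler_pM => //.
  - exact: (uweight_ge0 hG hE).
  - exact: (nrm_ge0 (BF_seminormed hE)).
  apply: (le_trans (Ltrans_bound hG hE _ Ef)).
  by rewrite ler_wpM2r// ltW.
rewrite leNgt; apply/negP => W1; move: W2; rewrite leNgt => /negP; apply.
rewrite mulrA gtr_pMl//; apply: (le_lt_trans _ W1); rewrite ler_piMl//; exact: ltW.
Qed.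

End weighted_BF_spaces.

Section restrictions.
Local Open Scope ereal_scope.
Context d (T : measurableType d) {R : realType}.
Variable mu : {measure set T -> \bar R}.
Implicit Types (f : T -> \bar R) (A B : set T).

Lemma measurable_patch A f : measurable A -> measurable_fun setT f ->
  measurable_fun setT (f \_ A).
Proof.
move=> mA mf; apply/(measurable_restrictT f mA).1; exact: measurable_funTS.
Qed.

Lemma patch_ge0 A f : (forall x, 0 <= f x) -> forall x, 0 <= (f \_ A) x.
Proof. by move=> f0 x; rewrite /patch; case: ifP. Qed.

Lemma integralU_le A B f : measurable A -> measurable B ->
  measurable_fun setT f -> (forall x, 0 <= f x) ->
  \int[mu]_(x in A `|` B) f x <= \int[mu]_(x in A) f x + \int[mu]_(x in B) f x.
Proof.
move=> mA mB mf f0; rewrite [X in X + _]integral_mkcond [X in _ + X]integral_mkcond.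
rewrite -ge0_integralD//; try by [exact: measurable_patch|move=> x _; exact: patch_ge0].
rewrite integral_mkcond; apply: ge0_le_integral => //.
- by move=> x _; exact: patch_ge0.
- by apply: measurable_patch => //; exact: measurableU.
- by apply: emeasurable_funD; exact: measurable_patch.
move=> x _; have := patch_ge0 A f0 x; have := patch_ge0 B f0 x.
rewrite {3}/patch; case: ifPn; last by move=> _ *; exact: adde_ge0.
rewrite inE => -[|] h; rewrite ?[X in X + _]/patch ?[X in _ + X]/patch (mem_set h) => *.
  by rewrite leeDl.
by rewrite leeDr.
Qed.

End restrictions.

Section domain.
Local Open Scope ereal_scope.
Context {R : realType} {G : topologicalGroupType}.
Variables (mu : {measure set (borel G) -> \bar R}) (Delta : G -> R) (V : set G).
Variable (w : G -> R).
Hypothesis hG : haar_group mu Delta V.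
Hypothesis hw : admissible_weight Delta w.
Implicit Types (f g : G -> R[i]) (x : G).

Lemma integral_cutoff (K : set (borel G)) f :
  \int[mu]_x (cmod (cutoff K f x) * 1)%:E = \int[mu]_(x in K) (cmod (f x))%:E.
Proof.
rewrite [RHS]integral_mkcond; apply: eq_integral => x _.
rewrite cmod_cutoff mulr1 patchE indicE; case: ifPn => _ /=; first by rewrite mul1r.
by rewrite mul0r.
Qed.

Lemma control_L1 f x :
  control V (L1 mu) f x = fine (\int[mu]_(y in ltranslate V x) (cmod (f y))%:E).
Proof. by rewrite /control /L1 Lp1_nrm// integral_cutoff. Qed.

(** A compact set is covered by finitely many translates of [V], so the bound on translates gives
    local integrability; the control function is measurable by Tonelli. *)
Lemma domain_mem f (M : R) : measurable_cfun f ->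
  (forall x, \int[mu]_(y in ltranslate V x) (cmod (f y))%:E <= (M * w x)%:E) ->
  amalgam V (L1 mu) (Linf_inv mu w) f.
Proof.
move=> mf fM; have mef := measurable_ecmod mf; have mV := mV hG.
have ef0 x : 0 <= (cmod (f x))%:E by rewrite lee_fin cmod_ge0.
have mT x : measurable (ltranslate V x : set (borel G)) by exact: measurable_ltranslate.
split; first split => //.
- move=> K cK; have mK := compact_borel hG cK.
  apply: Lp1P => //; first exact: (@measurable_cutoff _ _ K).
  rewrite integral_cutoff.
  have [s Ks] := compact_translates hG cK.
  apply: (@le_lt_trans _ _ (\int[mu]_(x in \big[setU/set0]_(x <- s) ltranslate V x) (cmod (f x))%:E)).
    apply: ge0_subset_integral => //; first by apply: bigsetU_measurable => x _.
    exact: measurable_funTS.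
  elim: s {Ks} => [|x s IH]; first by rewrite big_nil integral_set0.
  rewrite big_cons; apply: (@le_lt_trans _ _ (\int[mu]_(y in ltranslate V x) (cmod (f y))%:E +
      \int[mu]_(y in \big[setU/set0]_(x <- s) ltranslate V x) (cmod (f y))%:E)).
    have mS : measurable (\big[setU/set0]_(x <- s) ltranslate V x : set (borel G)).
      by apply: bigsetU_measurable => y _.
    exact: integralU_le.
  by rewrite lte_add_pinfty// (le_lt_trans (fM x))// ltry.
have M0 x : (0 <= M * w x)%R.
  by rewrite -lee_fin (le_trans _ (fM x))//; apply: integral_ge0.
have Ifin x : \int[mu]_(y in ltranslate V x) (cmod (f y))%:E \is a fin_num.
  by rewrite ge0_fin_numE ?(le_lt_trans (fM x)) ?ltry//; apply: integral_ge0.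
have wi0 x : (0 <= (w x)^-1)%R by rewrite invr_ge0 (weight_ge0 hw).
have [] // := @LpooP _ _ mu (mu_setT_gt0 hG) (fun x => (w x)^-1)%R (toC (control V (L1 mu) f)) M wi0.
- exact: (measurable_weight_inv hw).
- apply: measurable_toC.
  rewrite (_ : control _ _ _ = fun x => fine (\int[mu]_(y in ltranslate V x) (cmod (f y))%:E)); last first.
    by apply/funext => x; exact: control_L1.
  apply: (measurableT_comp (@fine_measurable R setT measurableT)).
  pose F (z : G * G) := (\1_V (z.1^-1 * z.2)%g)%:E * (cmod (f z.2))%:E : \bar R.
  have mI : measurable_fun [set: borel G] (fun z => (\1_V z)%:E : \bar R).
    exact/measurable_EFinP/measurable_indic.
  have [] := @tonelli _ _ _ _ _ hG F.
  + by apply: emeasurable_funM; [exact: (measurable_ldiv mI)|exact: (measurable_proj2 mef)].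
  + by move=> z; rewrite mule_ge0// lee_fin.
  move=> m1 _ _; apply: eq_measurable_fun m1 => x _.
  rewrite [RHS]integral_mkcond; apply: eq_integral => y _.
  rewrite /F /patch ltranslateE indicE /=.
  rewrite (_ : (y \in _) = (x^-1 * y \in V)%g); last by apply/idP/idP; rewrite !inE.
  by case: ifP => _ ; rewrite ?mul1e ?mul0e.
apply: ae_all => x; rewrite /toC cmod_real control_L1 ger0_norm ?fine_ge0//.
  rewrite ler_pdivrMr ?(weight_gt0 hw)// -lee_fin fineK//.
by apply: integral_ge0.
Qed.

End domain.

(** * Majorants from amalgam norms *)

Section majorants.
Local Open Scope ereal_scope.
Context {R : realType} {G : topologicalGroupType}.
Variables (mu : {measure set (borel G) -> \bar R}) (Delta : G -> R) (V : set G).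
Variable (w : G -> R).
Hypothesis hG : haar_group mu Delta V.
Hypothesis hw : admissible_weight Delta w.
Implicit Types (f : G -> R[i]) (x t : G) (K : set G).

Definition eindic (A : set G) (z : G) : \bar R := (\1_A z)%:E.

Lemma eindic_ge0 A z : 0 <= eindic A z.
Proof. by rewrite lee_fin. Qed.

Lemma measurable_eindic (A : set (borel G)) : measurable A ->
  measurable_fun [set: borel G] (eindic A).
Proof. by move=> mA; exact/measurable_EFinP/measurable_indic. Qed.

Lemma integral_eindic (A : set (borel G)) : measurable A -> \int[mu]_x eindic A x = mu A.
Proof. by move=> mA; rewrite integral_indic// setIT. Qed.

Lemma eindic1 A z : A z -> eindic A z = 1.
Proof. by move=> Az; rewrite /eindic indicE mem_set. Qed.

Lemma eindic0 A z : ~ A z -> eindic A z = 0.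
Proof. by move=> Az; rewrite /eindic indicE memNset. Qed.

Lemma eindic_le (A B : set G) y z : (A y -> B z) -> eindic A y <= eindic B z.
Proof.
move=> AB; have [Ay|nAy] := pselect (A y); last by rewrite eindic0// eindic_ge0.
by rewrite !eindic1//; exact: AB.
Qed.

Lemma mew : measurable_fun [set: borel G] (fun x => (w x)%:E).
Proof. exact: measurable_eweight hw. Qed.

Lemma ew0 x : 0 <= (w x)%:E.
Proof. by rewrite lee_fin (weight_ge0 hw). Qed.

(** Put [t = x s]: then [s^-1] lies in [K] and [w (x s) <= w x * w s], where [w] is bounded on the
    compact set of inverses. *)
Lemma ldiv_kernel K : compact K -> exists2 c : R, (0 <= c)%R & forall x,
  \int[mu]_t (eindic K (t^-1 * x)%g * (w t)%:E) <= (c * w x)%:E.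
Proof.
have [mew' ew0'] := (mew, ew0).
move=> cK; have cK' := compact_invset cK; have mK' := compact_borel hG cK'.
have [M M0 wM] := weight_bounded hw cK'.
have finK' : mu [set (y^-1)%g | y in K] \is a fin_num.
  by rewrite ge0_fin_numE//; exact: (mu_compact hG).
exists (M * fine (mu [set (y^-1)%g | y in K]))%R.
  by rewrite mulr_ge0 ?fine_ge0// ltW.
move=> x; rewrite -(integral_mull hG x); last 2 first.
- apply: emeasurable_funM => //; apply: measurable_ldivr.
  by apply: measurable_eindic; exact: (compact_borel hG).
- by move=> y; rewrite mule_ge0// eindic_ge0.
apply: (@le_trans _ _ (\int[mu]_t ((M * w x)%:E * eindic [set (y^-1)%g | y in K] t))).
  apply: ge0_le_integral => //.
  - by move=> t _; rewrite mule_ge0// eindic_ge0.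
  - apply: (@measurable_mull _ _ _ (fun t => eindic K (t^-1 * x)%g * (w t)%:E)).
    apply: emeasurable_funM => //; apply: measurable_ldivr.
    by apply: measurable_eindic; exact: (compact_borel hG).
  - by apply: measurable_funeM; exact: measurable_eindic.
  move=> t _; rewrite invgM mulgVK.
  have [Kt|nKt] := pselect (K (t^-1)%g); last first.
    by rewrite eindic0// mul0e mule_ge0 ?eindic_ge0// lee_fin mulr_ge0 ?(weight_ge0 hw)// ltW.
  have K't : [set (y^-1)%g | y in K] t by exists (t^-1)%g => //; rewrite invgK.
  rewrite !eindic1// mul1e mule1 lee_fin (le_trans (weight_mul hw _ _))// mulrC.
  by rewrite ler_wpM2r ?(weight_ge0 hw)// wM.
rewrite ge0_integralZl//.
- by rewrite integral_eindic// -[X in _ * X]fineK// -EFinM mulrAC.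
- exact: measurable_eindic.
- by move=> t _; exact: eindic_ge0.
- by rewrite lee_fin mulr_ge0 ?(weight_ge0 hw)// ltW.
Qed.

(** Right translation produces the factor [Delta (x^-1)] and submultiplicativity the factor
    [w (x^-1)]; their product is [w x] by the symmetry of an admissible weight. *)
Lemma mul_kernel K : compact K -> exists2 c : R, (0 <= c)%R & forall x,
  \int[mu]_t (eindic K (t * x)%g * (w t)%:E) <= (c * w x)%:E.
Proof.
have [mew' ew0'] := (mew, ew0).
move=> cK; have mK := compact_borel hG cK.
have [M M0 wM] := weight_bounded hw cK.
have finK : mu K \is a fin_num by rewrite ge0_fin_numE//; exact: (mu_compact hG).
exists (M * fine (mu K))%R; first by rewrite mulr_ge0 ?fine_ge0// ltW.
move=> x; pose F t := eindic K t * (w (t * x^-1)%g)%:E.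
have mF : measurable_fun [set: borel G] F.
  apply: emeasurable_funM; first exact: measurable_eindic.
  exact: (measurable_mulr (x^-1)%g mew).
have F0 t : 0 <= F t by rewrite mule_ge0// eindic_ge0.
rewrite (_ : (fun t => _) = fun t => F (t * x)%g); last first.
  by apply/funext => t; rewrite /F mulgK.
rewrite (integral_mulr hG)//.
have wx0 := weight_ge0 hw (x^-1)%g.
apply: (@le_trans _ _ ((Delta (x^-1)%g)%:E * \int[mu]_t ((M * w (x^-1)%g)%:E * eindic K t))).
  apply: lee_wpmul2l; first by rewrite lee_fin ltW// (modular_gt0 hG).
  apply: ge0_le_integral => //.
  - by apply: measurable_funeM; exact: measurable_eindic.
  move=> t _; rewrite /F; have [Kt|nKt] := pselect (K t); last first.
    by rewrite eindic0// mul0e mule0.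
  rewrite !eindic1// mul1e mule1 lee_fin (le_trans (weight_mul hw _ _))//.
  by rewrite ler_wpM2r// wM.
rewrite ge0_integralZl//.
- rewrite integral_eindic// -[X in _ * (_ * X)]fineK// -!EFinM lee_fin.
  by rewrite (weight_inv hw x) le_eqVlt; apply/orP; left; apply/eqP; ring.
- exact: measurable_eindic.
- by move=> t _; exact: eindic_ge0.
- by rewrite lee_fin mulr_ge0 ?(weight_ge0 hw)// ltW.
Qed.

(** A Schur-type bound: Tonelli moves the weight onto the kernel, where the estimate holds for each
    fixed [x]. *)
Lemma kernel_weight (k : G -> \bar R) (kappa : G * G -> \bar R) (c : R) :
  measurable_fun [set: borel G] k -> (forall x, 0 <= k x) ->
  measurable_fun [set: borel (G * G)%type] kappa -> (forall z, 0 <= kappa z) ->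
  (0 <= c)%R ->
  (forall x, \int[mu]_t (kappa (t, x) * (w t)%:E) <= (c * w x)%:E) ->
  \int[mu]_t (\int[mu]_x (k x * kappa (t, x)) * (w t)%:E) <=
    c%:E * \int[mu]_x (k x * (w x)%:E).
Proof.
move=> mk k0 mkap kap0 c0 kapc.
pose F (z : G * G) := k z.2 * kappa z * (w z.1)%:E.
have mF : measurable_fun [set: borel (G * G)%type] F.
  apply: emeasurable_funM; last exact: (measurable_proj1 mew).
  by apply: emeasurable_funM; [exact: (measurable_proj2 mk)|exact: mkap].
have F0 z : 0 <= F z by apply: mule_ge0 (ew0 _); exact: mule_ge0.
have mkt t : measurable_fun [set: borel G] (fun x => k x * kappa (t, x)).
  by apply: emeasurable_funM => //; exact: (borel_pair1 t mkap).
have mkx x : measurable_fun [set: borel G] (fun t => kappa (t, x) * (w t)%:E).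
  by apply: emeasurable_funM; [exact: (borel_pair2 x mkap)|exact: mew].
have [_ m2 FT] := tonelli hG mF F0.
have E1 t : \int[mu]_x (k x * kappa (t, x) * (w t)%:E) =
    \int[mu]_x (k x * kappa (t, x)) * (w t)%:E.
  exact: (ge0_integralZr mu measurableT (mkt t)
    (fun x _ => mule_ge0 (k0 x) (kap0 (t, x))) (ew0 t)).
have E2 x : \int[mu]_t (k x * kappa (t, x) * (w t)%:E) =
    k x * \int[mu]_t (kappa (t, x) * (w t)%:E).
  under eq_integral do rewrite -muleA.
  exact: (ge0_integralZl mu measurableT (mkx x)
    (fun t _ => mule_ge0 (kap0 (t, x)) (ew0 t)) (k0 x)).
have mkw : measurable_fun [set: borel G] (fun x => k x * (w x)%:E).
  exact: emeasurable_funM mk mew.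
have E3 : \int[mu]_x (c%:E * (k x * (w x)%:E)) = c%:E * \int[mu]_x (k x * (w x)%:E).
  exact: (ge0_integralZl mu measurableT mkw
    (fun x _ => mule_ge0 (k0 x) (ew0 x)) (c0 : 0 <= c%:E)).
have E4 : \int[mu]_t (\int[mu]_x (k x * kappa (t, x)) * (w t)%:E) =
    \int[mu]_x (k x * \int[mu]_t (kappa (t, x) * (w t)%:E)).
  transitivity (\int[mu]_t \int[mu]_x F (t, x)).
    by apply: eq_integral => t _; rewrite -E1.
  by rewrite FT; apply: eq_integral => x _; rewrite -E2.
have m2' : measurable_fun [set: borel G]
    (fun x => k x * \int[mu]_t (kappa (t, x) * (w t)%:E)).
  by apply: eq_measurable_fun m2 => x _; rewrite -E2.
rewrite E4 -E3; apply: ge0_le_integral.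
- exact: measurableT.
- move=> x _; apply: mule_ge0; first exact: k0.
  by apply: integral_ge0 => t _; exact: mule_ge0 (kap0 _) (ew0 _).
- exact: m2'.
- exact: measurable_funeM mkw.
by move=> x _; rewrite muleCA -EFinM; apply: lee_wpmul2l; [exact: k0|exact: kapc].
Qed.

Lemma locally_bounded_bound f (K : set G) : locally_in (Linf mu) f -> compact (closure K) ->
  measurable (K : set (borel G)) ->
  (0 <= nrm (Linf mu) (cutoff K f))%R /\
  \forall y \ae mu, K y -> (cmod (f y) <= nrm (Linf mu) (cutoff K f))%R.
Proof.
move=> [mf locf] cK mK; have muT := mu_setT_gt0 hG.
have mcK : measurable (closure K : set (borel G)) by exact: (compact_borel hG).
have LK : Linf mu (cutoff K f).
  have := Lpoo_bound muT (fun x => ler01 : (0 <= 1 :> R)%R) (locf _ cK).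
  set M := nrm _ _ => bM.
  have [||||//] := @LpooP _ _ mu muT (fun=> 1%R) (cutoff K f) M => //.
    exact: (@measurable_cutoff _ _ K).
  apply: aeS bM => x; apply: le_trans; rewrite !mulr1 !cmod_cutoff !indicE.
  have [Kx|nKx] := boolP (x \in K).
    by rewrite (mem_set (subset_closure (set_mem Kx))).
  by rewrite mul0r mulr_ge0// cmod_ge0.
split; first by rewrite fine_ge0// Lnorm_ge0.
have := Lpoo_bound muT (fun x => ler01 : (0 <= 1 :> R)%R) LK.
by apply: aeS => y + Ky; rewrite mulr1 cmod_cutoff indicE mem_set// mul1r.
Qed.

Let cV : compact (closure V). Proof. by have [_ _ _ _ []] := hG. Qed.
Let m0 : (0 < volV mu V)%R. Proof. exact: (volV_gt0 hG). Qed.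

Let average_bound (r : \bar R) (k : G -> \bar R) (A : set (borel G)) :
  0 <= r -> measurable A -> mu A = (volV mu V)%:E ->
  measurable_fun [set: borel G] k -> (forall x, 0 <= k x) ->
  (\forall x \ae mu, A x -> r <= k x) ->
  r <= ((volV mu V)^-1)%:E * \int[mu]_x (k x * eindic A x).
Proof.
move=> r0 mA muA mk k0 rk.
rewrite -[leLHS]mul1e -(mulVf (lt0r_neq0 m0)) EFinM -muleA.
apply: lee_wpmul2l; first by rewrite lee_fin invr_ge0 ltW.
rewrite -muA -integral_eindic// muleC -ge0_integralZl//.
- apply: ae_ge0_le_integral => //.
  + by move=> x _; rewrite mule_ge0// eindic_ge0.
  + by apply: measurable_funeM; exact: measurable_eindic.
  + by move=> x _; rewrite mule_ge0// eindic_ge0.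
  + by apply: emeasurable_funM => //; exact: measurable_eindic.
  apply: aeS rk => x rk _; have [Ax|nAx] := pselect (A x).
    by rewrite eindic1// !mule1; exact: rk.
  by rewrite eindic0// !mule0.
- exact: measurable_eindic.
- by move=> x _; exact: eindic_ge0.
Qed.

Lemma measurable_kernel_integral (k : G -> \bar R) (kappa : G * G -> \bar R) :
  measurable_fun [set: borel G] k -> (forall x, 0 <= k x) ->
  measurable_fun [set: borel (G * G)%type] kappa -> (forall z, 0 <= kappa z) ->
  measurable_fun [set: borel G] (fun t => \int[mu]_x (k x * kappa (t, x))).
Proof.
move=> mk k0 mkap kap0.
have [] // := @tonelli _ _ _ _ _ hG (fun z => k z.2 * kappa z).
- by apply: emeasurable_funM => //; exact: (measurable_proj2 mk).
- by move=> z; rewrite mule_ge0.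
Qed.

Lemma measurable_implies_le (A : set (borel (G * G)%type)) (a b : G * G -> R) :
  measurable A -> measurable_fun [set: borel (G * G)%type] a ->
  measurable_fun [set: borel (G * G)%type] b ->
  measurable ([set z | A z -> (a z <= b z)%R] : set (borel (G * G)%type)).
Proof.
move=> mA ma mb.
rewrite (_ : [set z | _] = ~` A `|` [set z | (a z)%:E <= (b z)%:E]); last first.
  apply/seteqP; split=> z /=; rewrite lee_fin.
    by move=> h; have [Az|nAz] := pselect (A z); [right; exact: h|left].
  by move=> [nAz Az|].
apply: measurableU; first exact: measurableC.
rewrite -[X in measurable X]setTI; apply: measurable_lee => //; exact/measurable_EFinP.
Qed.

(** The normalisation is by [mu V] for every [A]. For the relation defining the majorant the
    sections have exactly this measure; for a larger relation the result dominates the majorant at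
    shifted points. *)
Let smoothed (k : G -> \bar R) (A : set (G * G)) t : \bar R :=
  ((volV mu V)^-1)%:E * \int[mu]_x (k x * (\1_A (t, x))%:E).

Let smoothed_measurable (k : G -> R) (A : set (G * G)) :
  measurable_fun [set: borel G] k -> (forall x, 0 <= k x)%R ->
  measurable (A : set (borel (G * G)%type)) ->
  measurable_fun [set: borel G] (smoothed (EFin \o k) A) /\
  forall y, 0 <= smoothed (EFin \o k) A y.
Proof.
move=> mk k0 mA.
have mke : measurable_fun [set: borel G] (EFin \o k) by exact/measurable_EFinP.
have ke0 x : 0 <= (EFin \o k) x by rewrite lee_fin.
have mI : measurable_fun [set: borel (G * G)%type] (fun z => (\1_A z)%:E : \bar R).
  exact/measurable_EFinP/measurable_indic.
have I0 z : 0 <= (\1_A z)%:E :> \bar R by rewrite lee_fin.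
split; first by apply: measurable_funeM; apply: (measurable_kernel_integral mke ke0 mI I0).
move=> y; apply: mule_ge0; first by rewrite lee_fin invr_ge0 ltW.
by apply: integral_ge0 => x _; apply: mule_ge0; [exact: ke0|exact: I0].
Qed.

(* [h1] averages the control function of [f] over the translates of [V]
   containing the point; it dominates [f] almost everywhere, and varying the
   point only enlarges the set over which the average is taken. *)
Let control_average (f : G -> R[i]) (k : G -> R) (A : set (G * G)) :
  measurable_cfun f -> measurable_fun [set: borel G] k -> (forall x, 0 <= k x)%R ->
  measurable (A : set (borel (G * G)%type)) ->
  (forall y, mu (xsection A y) = (volV mu V)%:E) ->
  (forall x, \forall y \ae mu, A (y, x) -> (cmod (f y) <= k x)%R) ->
  let ke := EFin \o k in \forall y \ae mu, (cmod (f y))%:E <= smoothed ke A y.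
Proof.
move=> mf mk k0 mA muA fk ke.
have mke : measurable_fun [set: borel G] ke by exact/measurable_EFinP.
have ke0 x : 0 <= ke x by rewrite lee_fin.
pose B := [set z : G * G | A (z.2, z.1) -> (cmod (f z.2) <= k z.1)%R].
have mB : measurable (B : set (borel (G * G)%type)).
  apply: (@measurable_implies_le [set z | A (z.2, z.1)]).
  - rewrite -[X in measurable X]setTI.
    have := @continuous_borel (G * G)%type (G * G)%type (fun z => (z.2, z.1)) _.
    apply => // z; apply: cvg_pair; [exact: cvg_snd|exact: cvg_fst].
  - exact: (measurable_proj2 (measurable_cmod mf)).
  - exact: (measurable_proj1 mk).
have := ae_swap hG mB fk; apply: aeS => y fy.
have -> : smoothed ke A y = ((volV mu V)^-1)%:E * \int[mu]_x (ke x * eindic (xsection A y) x).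
  congr (_ * _); apply: eq_integral => x _; rewrite /eindic !indicE.
  by rewrite mem_xsection.
apply: average_bound => //.
- by rewrite lee_fin cmod_ge0.
- exact: borel_xsection.
- by apply: aeS fy => x /= h; rewrite /xsection /= inE => /h; rewrite lee_fin.
Qed.

Let smoothed_weight (k : G -> R) (A : set (G * G)) (c s : R) :
  measurable_fun [set: borel G] k -> (forall x, 0 <= k x)%R ->
  measurable (A : set (borel (G * G)%type)) -> (0 <= c)%R ->
  \int[mu]_x ((k x)%:E * (w x)%:E) <= s%:E ->
  (forall x, \int[mu]_t ((\1_A (t, x))%:E * (w t)%:E) <= (c * w x)%:E) ->
  \int[mu]_t (smoothed (EFin \o k) A t * (w t)%:E) <= ((volV mu V)^-1 * (c * s))%:E.
Proof.
move=> mk k0 mA c0 ks Ac.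
have mke : measurable_fun [set: borel G] (EFin \o k) by exact/measurable_EFinP.
have ke0 x : 0 <= (EFin \o k) x by rewrite lee_fin.
have mI : measurable_fun [set: borel (G * G)%type] (fun z => (\1_A z)%:E : \bar R).
  exact/measurable_EFinP/measurable_indic.
have I0 z : 0 <= (\1_A z)%:E :> \bar R by rewrite lee_fin.
under eq_integral do rewrite /smoothed -muleA.
rewrite ge0_integralZl//.
- rewrite EFinM; apply: lee_wpmul2l; first by rewrite lee_fin invr_ge0 ltW.
  apply: (le_trans (kernel_weight mke ke0 mI I0 c0 Ac)).
  by rewrite EFinM lee_wpmul2l.
- apply: emeasurable_funM; first exact: (measurable_kernel_integral mke ke0 mI I0).
  exact: mew.
- move=> t _; apply: mule_ge0; last exact: ew0.
  by apply: integral_ge0 => x _; apply: mule_ge0; [exact: ke0|exact: I0].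
- by rewrite lee_fin invr_ge0 ltW.
Qed.

Let smoothed_le (k : G -> R) (A B : set (G * G)) t t' :
  measurable_fun [set: borel G] k -> (forall x, 0 <= k x)%R ->
  measurable (A : set (borel (G * G)%type)) -> measurable (B : set (borel (G * G)%type)) ->
  (forall x, A (t, x) -> B (t', x)) ->
  smoothed (EFin \o k) A t <= smoothed (EFin \o k) B t'.
Proof.
move=> mk k0 mA mB AB.
have mke : measurable_fun [set: borel G] (EFin \o k) by exact/measurable_EFinP.
have mI C : measurable (C : set (borel (G * G)%type)) ->
    measurable_fun [set: borel (G * G)%type] (fun z => (\1_C z)%:E : \bar R).
  by move=> mC; exact/measurable_EFinP/measurable_indic.
apply: lee_wpmul2l; first by rewrite lee_fin invr_ge0 ltW.
apply: ge0_le_integral => //.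
- by move=> x _; rewrite mule_ge0// lee_fin.
- by apply: emeasurable_funM => //; exact: (borel_pair1 t (mI _ mA)).
- by apply: emeasurable_funM => //; exact: (borel_pair1 t' (mI _ mB)).
move=> x _; apply: lee_wpmul2l; first by rewrite lee_fin.
rewrite lee_fin !indicE ler_nat; have [/set_mem/AB h|//] := boolP ((t, x) \in A).
by rewrite mem_set.
Qed.

Let L1w_control (k : G -> R) : (forall x, 0 <= k x)%R -> L1w mu w (toC k) ->
  measurable_fun [set: borel G] k /\
  exists s : R, \int[mu]_x ((k x)%:E * (w x)%:E) <= s%:E.
Proof.
move=> k0 [[mk _] _]; rewrite Lp1_norm => [fin|]; last exact: (weight_ge0 hw).
have E : \int[mu]_x ((k x)%:E * (w x)%:E) = \int[mu]_x (cmod (toC k x) * w x)%:E.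
  by apply: eq_integral => x _; rewrite /toC cmod_real ger0_norm.
split => //; exists (fine (\int[mu]_x ((k x)%:E * (w x)%:E))).
rewrite fineK// ge0_fin_numE ?E//; apply: integral_ge0 => x _.
by rewrite lee_fin mulr_ge0 ?cmod_ge0// (weight_ge0 hw).
Qed.

Let ldiv_set (K : set G) : set (G * G) := [set z | K (z.1^-1 * z.2)%g].
Let mul_set (K : set G) : set (G * G) := [set z | K (z.1 * z.2)%g].

Let measurable_ldiv_set K : measurable (K : set (borel G)) ->
  measurable (ldiv_set K : set (borel (G * G)%type)).
Proof.
move=> mK; rewrite -[X in measurable X]setTI.
exact: (continuous_borel (@continuous_ldiv G)).
Qed.

Let measurable_mul_set K : measurable (K : set (borel G)) ->
  measurable (mul_set K : set (borel (G * G)%type)).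
Proof.
move=> mK; rewrite -[X in measurable X]setTI.
exact: (continuous_borel (@mulg_continuous G)).
Qed.

Let mmV : measurable (V : set (borel G)) := mV hG.
Let closureV v : V v -> closure V v. Proof. exact: subset_closure. Qed.

Let closed_translate (x : G) : compact (closure (ltranslate V x)) /\
  compact (closure (rtranslate V x)).
Proof.
have T2 : hausdorff_space G by case: hG.
have sub (A K : set G) : compact K -> A `<=` K -> compact (closure A).
  move=> cK AK; apply: (@subclosed_compact _ _ K) => //; first exact: closed_closure.
  rewrite [X in _ `<=` X]((closure_id K).1 (compact_closed T2 cK)).
  exact: closure_subset.
split.
- apply: (sub (ltranslate V x) (ltranslate (closure V) x)).
    exact: (@compact_ltranslate G (closure V) x cV).
  by move=> _ [v Vv <-]; exists v => //; exact: closureV.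
- apply: (sub (rtranslate V x) (rtranslate (closure V) x)).
    exact: (@compact_rtranslate G (closure V) x cV).
  by move=> _ [v Vv <-]; exists v => //; exact: closureV.
Qed.

(** The control function bounds [|f y|] by [k x] for [y] in [x V], that is for [x] in [y V], and
    [h1] is the average of [k] over [y V]. At [t v] the average runs over [t v V], which lies in
    [t KK]; hence [hs]. Weighted integrals are compared by [ldiv_kernel]. *)
Lemma left_majorant f : amalgam V (Linf mu) (L1w mu w) f ->
  exists h1 hs : G -> \bar R, exists s : R,
  [/\ measurable_fun [set: borel G] h1 /\ (forall x, 0 <= h1 x),
      measurable_fun [set: borel G] hs /\ (forall x, 0 <= hs x),
      \forall y \ae mu, (cmod (f y))%:E <= h1 y,
      forall t v, V v -> h1 (t * v)%g <= hs t &
      \int[mu]_x (hs x * (w x)%:E) <= s%:E].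
Proof.
move=> [locf]; set k := control _ _ _ => L1k.
have bnd x := locally_bounded_bound locf (proj1 (closed_translate x)) (measurable_ltranslate x mmV).
have k0 x : (0 <= k x)%R := (bnd x).1.
have [mk [s ks]] := L1w_control k0 L1k.
have mf : measurable_cfun f by case: locf.
pose KK := prodset (closure V) (closure V).
have cKK : compact KK by exact: compact_prodset.
have mKK := compact_borel hG cKK.
have [c c0 cKKw] := ldiv_kernel cKK.
exists (smoothed (EFin \o k) (ldiv_set V)), (smoothed (EFin \o k) (ldiv_set KK)).
exists ((volV mu V)^-1 * (c * s))%R; split.
- exact: smoothed_measurable (measurable_ldiv_set mmV).
- exact: smoothed_measurable (measurable_ldiv_set mKK).
- apply: control_average => //.
  + exact: measurable_ldiv_set.
  + move=> y; rewrite xsectionE.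
    rewrite (_ : _ @^-1` _ = ltranslate V y) ?(mu_ltranslate hG)//; last first.
      by rewrite ltranslateE.
    exact: (volVE hG).
  + move=> x; apply: aeS (bnd x).2 => y h; rewrite /ldiv_set /= => Vyx; apply: h.
    by rewrite ltranslateE /= -(windowV hG) invgM invgK.
- move=> t v Vv; apply: smoothed_le => //; try exact: measurable_ldiv_set.
  move=> x; rewrite /ldiv_set /= => Vx; exists v; first exact: closureV.
  exists ((t * v)^-1 * x)%g; first exact: closureV.
  by rewrite invgM -!mulgA mulVKg.
- apply: smoothed_weight => //; first exact: measurable_ldiv_set.
Qed.

(** Now [y] lies in [V x^-1] when [x] lies in [y^-1 V], so [h1] averages [k] over [y^-1 V]. If
    [q t x] is in [V] then [t x] is in [Q^-1 V], so left shifts by a compact [Q] only enlarge the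
    relation. [h1] is fixed before [Q]. The integral of [hs] after inversion is there for the
    majorant of [g], which is convolved in inverted form. *)
Lemma right_majorant f : amalgamR V (Linf mu) (L1w mu w) f ->
  exists h1 : G -> \bar R,
  [/\ measurable_fun [set: borel G] h1, (forall x, 0 <= h1 x),
      \forall y \ae mu, (cmod (f y))%:E <= h1 y &
  forall Q : set G, compact Q -> exists (hs : G -> \bar R) (s : R),
  [/\ measurable_fun [set: borel G] hs /\ (forall x, 0 <= hs x),
      forall q t, Q q -> h1 (q * t)%g <= hs t,
      \int[mu]_x (hs x * (w x)%:E) <= s%:E &
      \int[mu]_x (hs (x^-1)%g * (w x)%:E) <= s%:E]].
Proof.
move=> [locf]; set k := controlR _ _ _ => L1k.
have bnd x := locally_bounded_bound locf (proj2 (closed_translate (x^-1)%g)) (measurable_rtranslate (x^-1)%g mmV).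
have k0 x : (0 <= k x)%R := (bnd x).1.
have [mk [s ks]] := L1w_control k0 L1k.
have s0 : (0 <= s)%R.
  rewrite -lee_fin; apply: le_trans ks; apply: integral_ge0 => x _.
  by apply: mule_ge0; [rewrite lee_fin; exact: k0|exact: ew0].
have mf : measurable_cfun f by case: locf.
have [mh1 h10] := smoothed_measurable mk k0 (measurable_mul_set mmV).
exists (smoothed (EFin \o k) (mul_set V)); split => //.
- apply: control_average => //.
  + exact: measurable_mul_set.
  + move=> y; rewrite xsectionE.
    rewrite (_ : _ @^-1` _ = ltranslate V (y^-1)%g) ?(mu_ltranslate hG)//; last first.
      by rewrite ltranslateE invgK.
    exact: (volVE hG).
  + move=> x; apply: aeS (bnd x).2 => y h; rewrite /mul_set /= => Vyx; apply: h.
    by rewrite rtranslateE /= invgK.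
move=> Q cQ; pose K := prodset [set (y^-1)%g | y in Q] (closure V).
have cK : compact K by apply: compact_prodset => //; exact: compact_invset.
have mK := compact_borel hG cK.
have [c c0 Kw] := mul_kernel cK; have [d d0 Kw'] := ldiv_kernel cK.
have [mhs hs0] := smoothed_measurable mk k0 (measurable_mul_set mK).
(* The factor [c + d] serves both integrals: [c] comes from the relation [t x in K], and [d] from
   [t^-1 x in K], which appears after inversion. *)
exists (smoothed (EFin \o k) (mul_set K)), ((volV mu V)^-1 * ((c + d) * s))%R; split.
- by split.
- move=> q t Qq; apply: smoothed_le => //; try exact: measurable_mul_set.
  move=> x; rewrite /mul_set /= => Vx; exists (q^-1)%g; first by exists q.
  exists (q * t * x)%g; first exact: closureV.
  by rewrite -!mulgA mulKg.
- apply: (@le_trans _ _ ((volV mu V)^-1 * (c * s))%:E).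
    apply: smoothed_weight => //; first exact: measurable_mul_set.
  by rewrite lee_fin ler_wpM2l ?invr_ge0 ?(ltW m0)// ler_wpM2r// lerDl.
- apply: (@le_trans _ _ ((volV mu V)^-1 * (d * s))%:E).
    rewrite (_ : (fun x => _) = fun x => smoothed (EFin \o k) (ldiv_set K) x * (w x)%:E).
      apply: smoothed_weight => //; first exact: measurable_ldiv_set.
    by apply/funext => x.
  by rewrite lee_fin ler_wpM2l ?invr_ge0 ?(ltW m0)// ler_wpM2r// lerDr.
Qed.

End majorants.

#[global] Opaque eindic.

#[local] Opaque integral.

Lemma mulVKe (R : realType) (m : R) (x : \bar R) : (0 < m)%R ->
  ((m^-1)%:E * (m%:E * x) = x)%E.
Proof. by move=> m0; rewrite muleA -EFinM mulVf ?mul1e// gt_eqF. Qed.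

(** * Tails of integrals and averaging over the window *)

Section tails.
Local Open Scope ereal_scope.
Context {R : realType} {G : topologicalGroupType}.
Variables (mu : {measure set (borel G) -> \bar R}) (Delta : G -> R) (V : set G).
Hypothesis hG : haar_group mu Delta V.

Lemma integral_tail (a : G -> \bar R) (Q : nat -> set G) :
  measurable_fun [set: borel G] a -> (forall x, 0 <= a x) ->
  \int[mu]_x a x < +oo -> (forall n, measurable (Q n : set (borel G))) ->
  (forall n m, (n <= m)%N -> Q n `<=` Q m) -> \bigcup_n Q n = setT ->
  forall e : R, (0 < e)%R -> exists n, \int[mu]_x (a x * eindic (~` Q n) x) <= e%:E.
Proof.
move=> ma a0 afin mQ ndQ UQ e e0.
pose b n x := a x * eindic (Q n) x.
have mb n : measurable_fun [set: borel G] (b n).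
  by apply: emeasurable_funM => //; exact: measurable_eindic.
have mc n : measurable_fun [set: borel G] (fun x => a x * eindic (~` Q n) x).
  by apply: emeasurable_funM => //; apply: measurable_eindic; exact: measurableC.
have b0 n x : 0 <= b n x by rewrite mule_ge0// eindic_ge0.
have c0 n x : 0 <= a x * eindic (~` Q n) x by rewrite mule_ge0// eindic_ge0.
have split n : \int[mu]_x a x = \int[mu]_x b n x + \int[mu]_x (a x * eindic (~` Q n) x).
  rewrite -ge0_integralD//; apply: eq_integral => x _; rewrite /b.
  have [Qx|nQx] := pselect (Q n x).
    by rewrite eindic1// eindic0 ?mule1 ?mule0 ?adde0// => /(_ Qx).
  by rewrite eindic0// eindic1 ?mule1 ?mule0 ?add0e.
have cvgb : \int[mu]_x b n x @[n --> \oo] --> \int[mu]_x a x.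
  rewrite (_ : \int[mu]_x a x = \int[mu]_x limn (b ^~ x)).
    apply: cvg_monotone_convergence => // x _ n m nm.
    by apply: lee_wpmul2l => //; apply: eindic_le; exact: ndQ.
  apply: eq_integral => x _; apply/esym/cvg_lim => //.
  have [k _ Qkx] : (\bigcup_n Q n) x by rewrite UQ.
  apply: cvg_near_cst; exists k => // n /= kn.
  by rewrite /b eindic1 ?mule1//; exact: ndQ kn _ Qkx.
have If : \int[mu]_x a x \is a fin_num by rewrite ge0_fin_numE//; exact: integral_ge0.
have [N _ /(_ N (leqnn N)) bN] : \forall n \near \oo, \int[mu]_x a x - e%:E <= \int[mu]_x b n x.
  have := cvgb; rewrite -(fineK If) => /fine_cvgP[bfin /cvgrPdist_le/(_ e e0)].
  move: bfin; apply: filterS2 => n bn.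
  rewrite -[X in _ <= X]fineK// -EFinB lee_fin => /(le_trans (ler_norm _)).
  by rewrite /= lerBlDr addrC -lerBlDr.
exists N; have bfin : \int[mu]_x b N x \is a fin_num.
  rewrite ge0_fin_numE ?integral_ge0//; apply: le_lt_trans afin.
  by rewrite (split N) leeDl// integral_ge0.
move: bN; rewrite {1}(split N) leeBlDr// leeD2lE//.
Qed.

Lemma ldiv_indic_integral y : \int[mu]_t eindic V (y^-1 * t)%g = (volV mu V)%:E.
Proof.
have mV := mV hG.
rewrite (integral_mull hG (y^-1)%g (measurable_eindic mV) (eindic_ge0 V)).
by rewrite integral_eindic// (volVE hG).
Qed.

(** Write [mu V] as the integral over [t] of the indicator of [y^-1 t in V] and exchange integrals;
    where [t^-1 y] lies in [V], [a y] may be replaced by [F t]. The regularity of [a] thus pays for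
    the irregularity of [b], of which only averages over translates of [V] remain. *)
Lemma averaging (a f1 F b : G -> \bar R) :
  measurable_fun [set: borel G] a -> measurable_fun [set: borel G] f1 ->
  measurable_fun [set: borel G] F -> measurable_fun [set: borel G] b ->
  (forall x, 0 <= a x) -> (forall x, 0 <= f1 x) ->
  (forall x, 0 <= F x) -> (forall x, 0 <= b x) ->
  (\forall x \ae mu, a x <= f1 x) -> (forall t v, V v -> f1 (t * v)%g <= F t) ->
  \int[mu]_y (a y * b y) <= ((volV mu V)^-1)%:E *
    \int[mu]_t (F t * \int[mu]_y (eindic V (t^-1 * y)%g * b y)).
Proof.
move=> ma mf1 mF mb a0 f10 F0 b0 af1 f1F.
have m0 : (0 < volV mu V)%R := volV_gt0 hG.
have m0e : 0 <= (volV mu V)%:E by rewrite lee_fin ltW.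
have mV := mV hG; have meV := @measurable_eindic R _ _ mV.
have V0 := @eindic_ge0 R G V.
pose K (z : G * G) := F z.1 * (eindic V (z.1^-1 * z.2)%g * b z.2).
have mK : measurable_fun [set: borel (G * G)%type] K.
  apply: emeasurable_funM; first exact: (measurable_proj1 mF).
  by apply: emeasurable_funM; [exact: (measurable_ldiv meV)|exact: (measurable_proj2 mb)].
have K0 z : 0 <= K z by apply: mule_ge0 => //; exact: mule_ge0.
have [_ m2 KT] := tonelli hG mK K0.
have mtV t : measurable_fun [set: borel G] (fun y => eindic V (t^-1 * y)%g * b y).
  by apply: emeasurable_funM; [exact: (measurable_mull (t^-1)%g meV)|exact: mb].
have E0 t : \int[mu]_y (F t * (eindic V (t^-1 * y)%g * b y)) =
    F t * \int[mu]_y (eindic V (t^-1 * y)%g * b y).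
  exact: (ge0_integralZl mu measurableT (mtV t) (fun y _ => mule_ge0 (V0 (t^-1 * y)%g) (b0 y)) (F0 t)).
have E1 : \int[mu]_t \int[mu]_y K (t, y) =
    \int[mu]_t (F t * \int[mu]_y (eindic V (t^-1 * y)%g * b y)).
  by apply: eq_integral => t _; rewrite -E0.
rewrite -E1 KT.
have mab : measurable_fun [set: borel G] (fun y => a y * b y) by exact: emeasurable_funM.
have mVy (y : G) : measurable_fun [set: borel G] (fun t : G => eindic V (y^-1 * t)%g : \bar R).
  exact: (@measurable_mull G _ _ (eindic V) (y^-1)%g meV).
have E2 : \int[mu]_y ((volV mu V)%:E * (a y * b y)) = (volV mu V)%:E * \int[mu]_y (a y * b y).
  exact: (ge0_integralZl mu measurableT mab (fun y _ => mule_ge0 (a0 y) (b0 y)) m0e).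
rewrite -[leLHS](mulVKe _ m0) -E2.
apply: lee_wpmul2l; first by rewrite lee_fin invr_ge0 ltW.
apply: ae_ge0_le_integral.
- exact: measurableT.
- by move=> y _; apply: mule_ge0; [exact: m0e|apply: mule_ge0; [exact: a0|exact: b0]].
- exact: measurable_funeM mab.
- by move=> y _; apply: integral_ge0 => x _; exact: K0.
- exact: m2.
apply: aeS af1 => y ay _.
rewrite -(ldiv_indic_integral y) muleC.
rewrite -(ge0_integralZl mu measurableT (mVy y) (fun t _ => V0 (y^-1 * t)%g) (mule_ge0 (a0 y) (b0 y))).
apply: ge0_le_integral.
- exact: measurableT.
- by move=> t _; apply: mule_ge0; [apply: mule_ge0; [exact: a0|exact: b0]|exact: V0].
- exact: measurable_funeM (mVy y).
- exact: (borel_pair2 y mK).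
move=> t _.
have RH0 : 0 <= F t * (eindic V (t^-1 * y)%g * b y).
  by apply: mule_ge0; [exact: F0|apply: mule_ge0; [exact: V0|exact: b0]].
have [Vt|nVt] := pselect (V (y^-1 * t)%g); last first.
  by rewrite (eindic0 nVt) mule0; exact: RH0.
have Vt' : V (t^-1 * y)%g.
  by have := windowV hG (y^-1 * t)%g; rewrite invgM invgK => ->.
rewrite /K /= (eindic1 Vt) (eindic1 Vt') mule1 mul1e.
apply: lee_wpmul2r; first exact: b0.
by apply: (le_trans ay); have := f1F t _ Vt'; rewrite mulVKg.
Qed.

End tails.

(** * Sums over relatively separated sets *)

Section exhausting_lists.
Context {I : choiceType}.
Implicit Types (L : nat -> seq I).

(** Sums over [Gam] are limits along finite subsets. An increasing sequence of lists turns them into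
    limits of sequences, to which almost everywhere arguments and convergence theorems apply. *)
Definition exhausting L : Prop :=
  [/\ forall n, uniq (L n), forall n m, (n <= m)%N -> {subset L n <= L m}
    & forall i, exists n, i \in L n].

Lemma countable_exhausting : countable [set: I] -> exists L, exhausting L.
Proof.
move=> /countable_injP[f finj].
have {}finj i j : f i = f j -> i = j by apply: finj; rewrite inE.
pose e k : option I := if pselect (exists i, f i = k) is left h
  then Some (projT1 (cid h)) else None.
have fe : ocancel e f.
  by move=> k; rewrite /e; case: pselect => //= h; case: cid.
have ef i : e (f i) = Some i.
  rewrite /e; case: pselect => [h|]; last by case; exists i.
  by congr Some; case: cid => j /= /finj.
have memL n i : (i \in pmap e (iota 0 n)) = (f i < n)%N.
  rewrite mem_pmap; apply/mapP/idP => [[k kn ik]|fn].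
    by have := fe k; rewrite -ik /= => ->; move: kn; rewrite mem_iota add0n.
  by exists (f i); rewrite ?mem_iota ?add0n// ef.
exists (fun n => pmap e (iota 0 n)); split.
- by move=> n; apply: (pmap_uniq fe); exact: iota_uniq.
- by move=> n m nm i; rewrite !memL => /leq_trans; apply.
- by move=> i; exists (f i).+1; rewrite memL.
Qed.

Lemma fset_bound (A : set I) (N : nat) :
  (forall s : seq I, uniq s -> (forall i, i \in s -> A i) -> (size s <= N)%N) ->
  finite_set A.
Proof.
move=> h; apply: contrapT => /(infinite_set_fset N.+1)[X XA].
by apply/negP; rewrite -leqNgt; apply: h => [|i iX]; [exact: fset_uniq|exact: XA].
Qed.

Lemma exhausting_near L (A : set I) : exhausting L -> finite_set A ->
  \forall n \near \oo, forall i, A i -> i \in L n.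
Proof.
move=> [_ ndL UL] /finite_fsetP[X ->].
have [N hN] : exists N, forall i, i \in (X : seq I) -> i \in L N.
  elim: (X : seq I) => [|i s [N hN]]; first by exists 0%N.
  have [M hM] := UL i; exists (maxn N M) => j; rewrite inE => /predU1P[->|/hN].
    exact: ndL (leq_maxr _ _) _ hM.
  exact: ndL (leq_maxl _ _) _.
by exists N => // n /= Nn i /= /hN; exact: ndL.
Qed.

Lemma exhausting_fsbig L (U : zmodType) (a : I -> U) : exhausting L ->
  finite_set [set i | a i != 0] ->
  \forall n \near \oo, \sum_(i \in [set: I]) a i = \sum_(i <- L n) a i.
Proof.
move=> hL /(exhausting_near hL); case: (hL) => uL _ _; apply: filterS => n hn.
rewrite (@fsbigE _ _ _ _ _ (L n)) //; last first.
  by move=> i _ /negP iL; apply: contrapT => /eqP ai; apply: iL; exact: hn.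
by apply: eq_bigl => i; rewrite in_setT.
Qed.

Lemma exhausting_unconditional_sum L (R : realType) (a : I -> R[i]) (l : R[i]) :
  exhausting L -> unconditional_sum a l ->
  forall e : R, 0 < e -> \forall n \near \oo, cmod (\sum_(i <- L n) a i - l) < e.
Proof.
move=> hL hs e /hs[F0 hF]; have [uL _ _] := hL.
have := exhausting_near hL (finite_fset F0); apply: filterS => n hn.
have := hF [fset i | i in L n]%fset.
rewrite (perm_big (L n)); first by apply; apply/fsubsetP => i /hn; rewrite !inE.
apply: uniq_perm; [exact: fset_uniq|exact: uL|by move=> i; rewrite !inE].
Qed.

Lemma sum_le_esum (R : realType) (a : I -> \bar R) (s : seq I) : uniq s ->
  (\sum_(i <- s) a i <= \esum_(i in [set: I]) a i)%E.
Proof.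
move=> us; rewrite fsbig_seq//; apply: ereal_sup_ubound.
by exists [set` s] => //; split => //; exact: finite_seq.
Qed.

End exhausting_lists.

Section separated.
Context {R : realType} {G : topologicalGroupType}.
Variables (mu : {measure set (borel G) -> \bar R}) (Delta : G -> R) (V : set G).
Hypothesis hG : haar_group mu Delta V.
Variable Gam : set G.
Hypothesis hGam : relatively_separated V Gam.
Implicit Types (s : seq Gam) (x : G).

(** Separation counts the points of [Gam] in [x V]; by symmetry of [V] this is the number of sets
    [gam V] that contain [x]. *)
Lemma separated_count : exists N : nat, forall x s, uniq s ->
  (forall gam, gam \in s -> V ((\val gam)^-1 * x)%g) -> (size s <= N)%N.
Proof.
have [N hN] := hGam; exists N => x s us sV.
have /pcard_leP[f] := hN x.
have sI gam : gam \in s -> (Gam `&` ltranslate V x) (\val gam).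
  move=> /sV Vg; split; first exact: set_valP.
  exists (x^-1 * \val gam)%g; last by rewrite mulVKg.
  by have := windowV hG ((\val gam)^-1 * x)%g; rewrite invgM invgK => ->.
rewrite -(size_map (fun gam : Gam => f (\val gam)) s).
rewrite -[leqRHS](size_iota 0 N).
apply: uniq_leq_size => [|k /mapP[gam /sI gI ->]]; last first.
  by rewrite mem_iota add0n leq0n /=; exact: (@funS _ _ _ _ f _ gI).
rewrite map_inj_in_uniq// => i j /sI Ii /sI Ij fij; apply: val_inj.
by apply: (@inj _ _ _ f) fij; rewrite inE.
Qed.

(** Cover the inverse of [U] by translates [z V]. If [gam^-1 x] is in [U], then [gam^-1 x z] is in
    [V] for one of the finitely many [z], and each [z] accounts for at most [N] points. *)
Lemma compact_count (U : set G) : compact U -> exists N : nat, forall x s, uniq s ->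
  (forall gam, gam \in s -> U ((\val gam)^-1 * x)%g) -> (size s <= N)%N.
Proof.
move=> /compact_invset/(compact_translates hG)[l hl].
have [N hN] := separated_count; exists (N * size l)%N => x s us sU.
have {sU hl} : forall gam, gam \in s -> exists2 z, z \in l & V ((\val gam)^-1 * (x * z))%g.
  move=> gam /sU Ug; have : (\big[setU/set0]_(z <- l) ltranslate V z) (x^-1 * \val gam)%g.
    by apply: hl; exists ((\val gam)^-1 * x)%g; rewrite // invgM invgK.
  rewrite -bigcup_seq => -[z /= zl [v Vv vE]]; exists z => //.
  have -> : ((\val gam)^-1 * (x * z) = v^-1)%g.
    by apply: (canRL invgK); rewrite !invgM invgK -mulgA -vE mulKg.
  by rewrite (windowV hG).
elim: l s us => [|z l IH] s us hs.
  by case: s us hs => // a s _ /(_ a (mem_head _ _))[].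
pose p (gam : Gam) := `[< V ((\val gam)^-1 * (x * z))%g >].
rewrite /= mulnS -(count_predC p s) -!size_filter; apply: leq_add.
  apply: (hN (x * z)%g) => [|gam]; first exact: filter_uniq.
  by rewrite mem_filter => /andP[/asboolP].
apply: IH => [|gam]; first exact: filter_uniq.
rewrite mem_filter => /andP[/= np /hs[y]]; rewrite inE => /predU1P[->|yl Vy].
  by move=> h; case/negP: np; exact/asboolP.
by exists y.
Qed.

Lemma compact_finite (U : set G) x : compact U ->
  finite_set [set gam : Gam | U ((\val gam)^-1 * x)%g].
Proof. by move=> /compact_count[N hN]; apply: (@fset_bound _ _ N); exact: hN. Qed.

(** Each set of a compact exhaustion of [G] meets [Gam] in finitely many points, so [Gam] is
    countable. *)
Lemma separated_exhausting : exists L : nat -> seq Gam, exhausting L.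
Proof.
apply: countable_exhausting.
have [Q [cQ _ UQ]] := exhaustion hG.
have -> : [set: Gam] = \bigcup_n [set gam : Gam | [set y^-1 | y in Q n]%g ((\val gam)^-1 * 1)%g].
  apply/seteqP; split => // gam _; have [n _ Qn] : (\bigcup_n Q n) (\val gam) by rewrite UQ.
  by exists n => //=; exists (\val gam) => //; rewrite mulg1.
apply: bigcup_countable => // n _; apply: finite_set_countable.
by apply: compact_finite; exact: compact_invset.
Qed.

(* Each point of [G] lies in at most [N] of the sets [gam V]. *)
Lemma separated_sum : exists2 K : R, (0 <= K)%R & forall s (a : Gam -> \bar R) (psi : G -> \bar R),
  uniq s -> measurable_fun [set: borel G] psi -> (forall t, (0 <= psi t)%E) ->
  (forall gam, (0 <= a gam)%E) ->
  (forall gam t, V ((\val gam)^-1 * t)%g -> (a gam <= psi t)%E) ->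
  (\sum_(gam <- s) a gam <= K%:E * \int[mu]_t psi t)%E.
Proof.
have [N hN] := separated_count; have m0 := volV_gt0 hG.
exists ((volV mu V)^-1 * N%:R)%R; first by rewrite mulr_ge0// invr_ge0 ltW.
move=> s a psi us mpsi psi0 a0 aV.
have mV := mV hG.
have mVg (gam : Gam) : measurable_fun [set: borel G]
    (fun t : G => eindic V ((\val gam)^-1 * t)%g : \bar R).
  exact: (measurable_mull _ (measurable_eindic mV)).
have mF (gam : Gam) : measurable_fun [set: borel G]
    (fun t : G => psi t * eindic V ((\val gam)^-1 * t)%g)%E.
  exact: (emeasurable_funM mpsi (mVg gam)).
have F0 (gam : Gam) (t : borel G) : setT t -> (0 <= psi t * eindic V ((\val gam)^-1 * t)%g)%E.
  by move=> _; apply: mule_ge0; [exact: psi0|exact: eindic_ge0].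
have step (gam : Gam) : ((volV mu V)%:E * a gam <=
    \int[mu]_t (psi t * eindic V ((\val gam)^-1 * t)%g))%E.
  rewrite -(ldiv_indic_integral hG (\val gam)) muleC.
  rewrite -(ge0_integralZl mu measurableT (mVg gam) (fun t _ => eindic_ge0 V _) (a0 gam)).
  apply: ge0_le_integral.
  - exact: measurableT.
  - by move=> t _; apply: mule_ge0; [exact: a0|exact: eindic_ge0].
  - exact: measurable_funeM (mVg gam).
  - exact: mF.
  move=> t _; have [Vt|nVt] := pselect (V ((\val gam)^-1 * t)%g).
    by rewrite (eindic1 Vt) !mule1; exact: aV Vt.
  by rewrite (eindic0 nVt) !mule0.
rewrite EFinM -muleA -[leLHS](mulVKe _ m0).
apply: lee_wpmul2l; first by rewrite lee_fin invr_ge0 ltW.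
rewrite ge0_sume_distrr; last by move=> gam _; exact: a0.
apply: (@le_trans _ _ (\sum_(gam <- s) \int[mu]_t (psi t * eindic V ((\val gam)^-1 * t)%g))%E).
  by apply: lee_sum => gam _; exact: step.
rewrite -(ge0_integral_sum mu measurableT mF F0).
have N0 : (0 <= (N%:R : R)%:E)%E by rewrite lee_fin.
rewrite -(ge0_integralZl mu measurableT mpsi (fun t _ => psi0 t) N0).
apply: ge0_le_integral.
- exact: measurableT.
- by move=> t _; apply: sume_ge0 => gam _; exact: (F0 gam t).
- exact: emeasurable_sum.
- exact: measurable_funeM mpsi.
move=> t _; rewrite -ge0_sume_distrr; last by move=> gam _; exact: eindic_ge0.
rewrite muleC; apply: lee_wpmul2r; first exact: psi0.
have -> : (\sum_(gam <- s) eindic V ((\val gam)^-1 * t)%g =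
    ((size [seq gam <- s | `[< V ((\val gam)^-1 * t)%g >]])%:R : R)%:E)%E.
  elim: (s) => [|gam l IH]; first by rewrite big_nil.
  rewrite big_cons IH /=; case: asboolP => [Vt|nVt].
    by rewrite (eindic1 Vt) /= -addn1 natrD EFinD addeC.
  by rewrite (eindic0 nVt) add0e.
rewrite lee_fin ler_nat; apply: (hN t) => [|gam]; first exact: filter_uniq.
by rewrite mem_filter => /andP[/asboolP].
Qed.

End separated.

(** * The operator P on BF spaces *)

Section isometric_spaces.
Local Open Scope ereal_scope.
Context {R : realType} {G : topologicalGroupType}.
Variables (mu : {measure set (borel G) -> \bar R}) (Delta : G -> R) (V : set G).
Variable B : nspace (G -> R[i]).
Hypothesis hG : haar_group mu Delta V.
Hypothesis hB : solid_isometric_TI_BF mu Delta B.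

Let hB' : solid_TI_BF mu Delta B. Proof. by case: hB. Qed.

Lemma isometric_uweight_le1 x : (uweight B x <= 1)%R.
Proof.
have sB := BF_seminormed hB'.
apply: ge_sup => [|_ [f [Bf nf] <-]]; last by case: hB => _ ->.
pose z : G -> R[i] := 0%R.
by exists (nrm B (Ltrans x z)), z => //; split; [exact: mem0|rewrite nrm0].
Qed.

(** Here the convolution relation with [L^1_u] on the left is used; [u <= 1] because left
    translations are isometries, so a plain [L^1] bound on [f] is enough. *)
Lemma isometric_young (f h : G -> R[i]) (s : R) : measurable_cfun f -> B h ->
  \int[mu]_x (cmod (f x))%:E <= s%:E ->
  dominated mu B (econv mu (fun x => (cmod (f x))%:E) (fun x => (cmod (h x))%:E))
    (s * nrm B h).
Proof.
move=> mf Bh fs; have [Bh' nh] := BF_abs hB' Bh.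
have u0 := uweight_ge0 hG hB'; have mu' : measurable_fun [set: borel G] (uweight B).
  by case: hB' => _ _ [].
pose F := toC (fun x => cmod (f x)).
have mF : measurable_cfun F by apply: measurable_toC; exact: measurable_cmod.
have F0 x : (0 <= cmod (F x) * uweight B x)%R by apply: mulr_ge0; [exact: cmod_ge0|exact: u0].
have intF : \int[mu]_x (cmod (F x) * uweight B x)%:E <= s%:E.
  apply: le_trans fs; apply: ge0_le_integral.
  - exact: measurableT.
  - by move=> x _; rewrite lee_fin.
  - by apply/measurable_EFinP/measurable_funM => //; exact: measurable_cmod.
  - exact: measurable_ecmod.
  move=> x _; rewrite lee_fin cmod_real ger0_norm ?cmod_ge0//.
  by rewrite ler_piMr ?cmod_ge0 ?isometric_uweight_le1.
have LF : Lp mu 1%:E (uweight B) F.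
  by apply: (Lp1P u0 mu' mF); rewrite (le_lt_trans intF)// ltry.
have [_ _ [_ _ _ /(_ _ _ LF Bh')[cd Bc nc] _]] := hB'.
exists (convol mu F (toC (fun x => cmod (h x)))); split => //.
  apply: (le_trans nc); rewrite nh; apply: ler_wpM2r.
    exact: (nrm_ge0 (BF_seminormed hB')).
  rewrite Lp1_nrm// -lee_fin fineK// ge0_fin_numE ?(le_lt_trans intF) ?ltry//.
  by apply: integral_ge0 => x _; rewrite lee_fin.
apply: aeS cd => x [mI II].
pose k y := (cmod (f y) * cmod (h (y^-1 * x)%g))%R.
have k0 y : (0 <= k y)%R by rewrite mulr_ge0 ?cmod_ge0.
have kE y : (F y * toC (fun x => cmod (h x)) (y^-1 * x)%g = (k y)%:C%C)%R.
  by rewrite /F /toC -rmorphM.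
have fin_k : \int[mu]_y (k y)%:E < +oo.
  move: II; under eq_integral do rewrite kE cmod_real ger0_norm//.
  by [].
have -> : convol mu F (toC (fun x => cmod (h x))) x = (fine (\int[mu]_y (k y)%:E))%:C%C.
  rewrite /convol /cintegral; congr (_ +i* _)%C.
    by rewrite /Rintegral; congr fine; apply: eq_integral => y _; rewrite kE.
  under eq_Rintegral do rewrite kE /=.
  by rewrite /Rintegral integral0.
have Ik0 : 0 <= \int[mu]_y (k y)%:E by apply: integral_ge0 => y _; rewrite lee_fin.
by rewrite cmod_real ger0_norm ?fine_ge0// fineK ?ge0_fin_numE.
Qed.

(** Translating back to the fixed set [U] costs nothing in norm, so the constant does not depend on
    [x]. *)
Lemma isometric_local_bound (U : set G) : compact U -> exists2 c : R, (0 <= c)%R &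
  forall f x, B f -> \int[mu]_(y in ltranslate U x) (cmod (f y))%:E <= (c * nrm B f)%:E.
Proof.
move=> cU; have [[_ _ _ _ /(_ _ cU)[c hc]] _ _] := hB'.
exists `|c|%R => // f x Bf; have mf := BF_measurable hB' Bf.
rewrite (integral_ltranslate hG); last by move=> y; rewrite lee_fin cmod_ge0.
- have BL := BF_Ltrans hB' (x^-1)%g Bf.
  have := hc _ BL; rewrite (proj2 hB)// => h.
  apply: (@le_trans _ _ (c * nrm B f)%:E); last first.
    by rewrite lee_fin ler_wpM2r ?ler_norm// (nrm_ge0 (BF_seminormed hB')).
  by apply: le_trans h; under [leRHS]eq_integral do rewrite /Ltrans invgK.
- exact: measurable_ecmod.
- exact: (compact_borel hG).
Qed.

End isometric_spaces.

Section operator_domain.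
Local Open Scope ereal_scope.
Context {R : realType} {G : topologicalGroupType}.
Variables (mu : {measure set (borel G) -> \bar R}) (Delta : G -> R) (V : set G).
Variables (w : G -> R).
Hypothesis hG : haar_group mu Delta V.
Hypothesis hw : admissible_weight Delta w.
Implicit Types f g : G -> R[i].

(* A description of [W(L^1, L^oo_{1/w})] that is visibly a linear space. *)
Definition locally_weighted f : Prop := measurable_cfun f /\
  exists2 M : R, (0 <= M)%R & forall x,
    \int[mu]_(y in ltranslate V x) (cmod (f y))%:E <= (M * w x)%:E.

Lemma locally_weighted_domain f : locally_weighted f ->
  amalgam V (L1 mu) (Linf_inv mu w) f.
Proof. by move=> [mf [M _ hM]]; exact: (domain_mem hG hw mf hM). Qed.

Lemma locally_weighted_lin a f g : locally_weighted f -> locally_weighted g ->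
  locally_weighted (a *: f + g)%R.
Proof.
move=> [mf [M M0 hM]] [mg [N N0 hN]].
have mag : measurable_cfun (a *: f + g)%R by apply: measurable_cfunD => //; exact: measurable_cfunZ.
split=> //; exists (cmod a * M + N)%R; first by rewrite addr_ge0// mulr_ge0// cmod_ge0.
move=> x; have mVx := measurable_ltranslate x (mV hG).
apply: (@le_trans _ _ (\int[mu]_(y in ltranslate V x)
    ((cmod a)%:E * (cmod (f y))%:E + (cmod (g y))%:E))).
  apply: ge0_le_integral.
  - exact: mVx.
  - by move=> y _; rewrite lee_fin cmod_ge0.
  - by apply: measurable_funTS; exact: measurable_ecmod.
  - apply: measurable_funTS; apply: emeasurable_funD; last exact: measurable_ecmod.
    by apply: measurable_funeM; exact: measurable_ecmod.
  move=> y _; rewrite -EFinM -EFinD lee_fin -cmodM; exact: cmodD.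
rewrite ge0_integralD//.
- rewrite ge0_integralZl//.
  + rewrite mulrDl EFinD -mulrA EFinM; apply: leeD; last exact: hN.
    by apply: lee_wpmul2l; [rewrite lee_fin cmod_ge0|exact: hM].
  + by apply: measurable_funTS; exact: measurable_ecmod.
  + by move=> y _; rewrite lee_fin cmod_ge0.
  + by rewrite lee_fin cmod_ge0.
- by move=> y _; rewrite -EFinM lee_fin mulr_ge0 ?cmod_ge0.
- by apply: measurable_funTS; apply: measurable_funeM; exact: measurable_ecmod.
- by move=> y _; rewrite lee_fin cmod_ge0.
- by apply: measurable_funTS; exact: measurable_ecmod.
Qed.

Lemma locally_weighted_le (c : R) f g : (0 <= c)%R -> locally_weighted f ->
  measurable_cfun g -> (\forall x \ae mu, cmod (g x) <= c * cmod (f x))%R ->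
  locally_weighted g.
Proof.
move=> c0 [mf [M M0 hM]] mg gf; split => //; exists (c * M)%R; first exact: mulr_ge0.
move=> x; have mVx := measurable_ltranslate x (mV hG).
apply: (@le_trans _ _ (\int[mu]_(y in ltranslate V x) (c%:E * (cmod (f y))%:E))).
  apply: ae_ge0_le_integral.
  - exact: mVx.
  - by move=> y _; rewrite lee_fin cmod_ge0.
  - by apply: measurable_funTS; exact: measurable_ecmod.
  - by move=> y _; rewrite -EFinM lee_fin mulr_ge0 ?cmod_ge0.
  - by apply: measurable_funTS; apply: measurable_funeM; exact: measurable_ecmod.
  by apply: aeS gf => y gfy _; rewrite -EFinM lee_fin.
rewrite ge0_integralZl//.
- by rewrite -mulrA EFinM; apply: lee_wpmul2l; [rewrite lee_fin|exact: hM].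
- by apply: measurable_funTS; exact: measurable_ecmod.
- by move=> y _; rewrite lee_fin cmod_ge0.
Qed.

Lemma BF_locally_weighted E f : solid_TI_BF mu Delta E -> admissible_for Delta E w ->
  E f -> locally_weighted f.
Proof.
move=> hE hwE Ef; have mf := BF_measurable hE Ef; split => //.
have [_ _ _ _ [_ _ cV _]] := hG.
have [c c0 hc] := BF_local_bound hG hE hwE cV.
exists (c * nrm E f)%R; first by rewrite mulr_ge0// (nrm_ge0 (BF_seminormed hE)).
move=> x; have := hc _ x Ef; rewrite mulrAC; apply: le_trans.
apply: ge0_subset_integral.
- exact: (measurable_ltranslate x (mV hG)).
- by apply: measurable_ltranslate; exact: (compact_borel hG cV).
- by apply: measurable_funTS; exact: measurable_ecmod.
- by move=> y _; rewrite lee_fin cmod_ge0.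
by move=> _ [v Vv <-]; exists v => //; exact: subset_closure.
Qed.

End operator_domain.

Section dominated_operator.
Local Open Scope ereal_scope.
Context {R : realType} {G : topologicalGroupType}.
Variables (mu : {measure set (borel G) -> \bar R}) (Delta : G -> R) (V : set G).
Variables (w : G -> R) (P : (G -> R[i]) -> (G -> R[i])) (H : G -> R).
Hypothesis hG : haar_group mu Delta V.
Hypothesis hw : admissible_weight Delta w.
Hypothesis hP : bounded_linear (amalgam V (L1 mu) (Linf_inv mu w)) (Linf_inv mu w) P.
Hypothesis mH : measurable_cfun (toC H).
Hypothesis hPH : forall f, amalgam V (L1 mu) (Linf_inv mu w) f ->
  \forall x \ae mu,
    (cmod (P f x))%:E <= \int[mu]_y (cmod (f y) * H (y^-1 * x)%g)%:E.
Implicit Types f g : G -> R[i].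

Lemma operator_measurable f : locally_weighted mu V w f -> measurable_cfun (P f).
Proof.
by move=> /(locally_weighted_domain hG hw) hf; have [/(_ _ hf)[]] := hP.
Qed.

(** [H] may change sign, so the kernel bound is first passed to [|H|] and then to the majorant
    [h]. *)
Lemma operator_le f (h : G -> \bar R) : locally_weighted mu V w f ->
  measurable_fun [set: borel G] h -> (forall x, 0 <= h x) ->
  (\forall x \ae mu, (cmod (toC H x))%:E <= h x) ->
  \forall x \ae mu, (cmod (P f x))%:E <= econv mu (fun y => (cmod (f y))%:E) h x.
Proof.
move=> hf mh h0 Hh; have [mf _] := hf.
have mef := measurable_ecmod mf; have meH := measurable_ecmod mH.
have mH' : measurable_fun [set: borel G] (fun x => (H x)%:E).
  by apply/measurable_EFinP; case: mH.
apply: aeS (hPH (locally_weighted_domain hG hw hf)) => x hx.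
apply: (le_trans hx).
apply: (@le_trans _ _ (econv mu (fun y => (cmod (f y))%:E) (fun y => (cmod (toC H y))%:E) x)).
  apply: (le_trans (lee_abs _)).
  have mF : measurable_fun [set: borel G] (fun y => (cmod (f y) * H (y^-1 * x)%g)%:E).
    under eq_fun do rewrite EFinM.
    exact: (measurable_econv_integrand x mef mH').
  apply: (le_trans (le_abse_integral mu measurableT mF)).
  rewrite le_eqVlt; apply/orP; left; apply/eqP; apply: eq_integral => y _.
  by rewrite -EFinM abse_EFin normrM ger0_norm ?cmod_ge0// cmod_real.
apply: (econv_ae_le hG) => //.
- by move=> y; rewrite lee_fin cmod_ge0.
- by move=> y; rewrite lee_fin cmod_ge0.
- by apply: ae_all => y.
Qed.

(** [bounded_linear] only gives norm [0] for the defect of linearity. As [nrm] is a [fine] value,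
    which is also [0] when the essential supremum is infinite, the defect must first be shown to
    belong to the space. *)
Lemma operator_linear a f g : locally_weighted mu V w f -> locally_weighted mu V w g ->
  \forall x \ae mu, (P (a *: f + g)%R x = a * P f x + P g x)%R.
Proof.
move=> hf hg; have hfg := locally_weighted_lin hG a hf hg.
have [_ /(_ a f g)hL _] := hP.
have {}hL := hL (locally_weighted_domain hG hw hf) (locally_weighted_domain hG hw hg).
have w0 x : (0 <= (w x)^-1)%R by rewrite invr_ge0 (weight_ge0 hw).
have muT := mu_setT_gt0 hG.
have LP k : locally_weighted mu V w k -> Linf_inv mu w (P k).
  by move=> /(locally_weighted_domain hG hw) hk; have [/(_ _ hk)] := hP.
have mw : measurable_fun [set: borel G] (fun x => (w x)^-1)%R.
  exact: (measurable_weight_inv hw).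
have LD : Linf_inv mu w (P (a *: f + g) - (a *: P f + P g))%R.
  have mm : measurable_cfun (P (a *: f + g) - (a *: P f + P g))%R.
    apply: measurable_cfunB; first exact: operator_measurable.
    apply: measurable_cfunD; last exact: operator_measurable.
    by apply: measurable_cfunZ; exact: operator_measurable.
  pose M := (nrm (Linf_inv mu w) (P (a *: f + g)) + (cmod a * nrm (Linf_inv mu w) (P f) +
     nrm (Linf_inv mu w) (P g)))%R.
  apply: (proj1 (@LpooP _ _ _ muT _ _ M w0 mw mm _)).
  apply: (aeS2 _ (Lpoo_bound muT w0 (LP _ hfg)) (aeI (Lpoo_bound muT w0 (LP _ hf)) (Lpoo_bound muT w0 (LP _ hg)))).
  move=> x h1 [h2 h3]; rewrite /M.
  apply: (@le_trans _ _ ((cmod (P (a *: f + g) x) + (cmod a * cmod (P f x) + cmod (P g x))) * (w x)^-1)%R).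
    apply: ler_wpM2r => //; apply: (le_trans (cmodB _ _)); apply: lerD => //.
    by apply: (le_trans (cmodD _ _)); rewrite cmodM.
  rewrite !mulrDl -mulrA; apply: lerD => //; apply: lerD => //.
  by apply: ler_wpM2l => //; exact: cmod_ge0.
have := Lpoo_bound muT w0 LD; rewrite hL; apply: aeS => x hx.
apply: subr0_eq; apply: cmod_eq0; apply/eqP; rewrite eq_le cmod_ge0 andbT.
by move: hx; rewrite pmulr_lle0// invr_gt0; exact: weight_gt0 hw x.
Qed.

Lemma locally_weighted0 : locally_weighted mu V w (fun=> 0%R).
Proof.
split; first exact: measurable_cfun_cst.
exists 0%R => // x; rewrite mul0r.
by under eq_integral do rewrite cmod0; rewrite integral0.
Qed.

Lemma operator0 : \forall x \ae mu, (P (fun=> 0) x = 0)%R.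
Proof.
apply: aeS (operator_linear (-1) locally_weighted0 locally_weighted0) => x.
rewrite (_ : (- 1 *: _ + _)%R = (fun _ : G => 0%R : R[i])); last first.
  by apply/funext => y; rewrite fctE /= scaler0 addr0.
by rewrite mulN1r addNr.
Qed.

Lemma operatorB f g : locally_weighted mu V w f -> locally_weighted mu V w g ->
  \forall x \ae mu, (P (f - g)%R x = P f x - P g x)%R.
Proof.
move=> hf hg; apply: aeS (operator_linear (-1) hg hf) => x.
by rewrite scaleN1r (addrC (- g)%R) mulN1r (addrC (- P g x)%R).
Qed.

Lemma locally_weighted_sum (I : Type) (s : seq I) (F : I -> G -> R[i]) :
  (forall i, locally_weighted mu V w (F i)) ->
  locally_weighted mu V w (fun x => \sum_(i <- s) F i x)%R.
Proof.
move=> hF; elim: s => [|i s IH].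
  by rewrite (_ : (fun _ => _) = fun=> 0%R); [exact: locally_weighted0|apply/funext => x; rewrite big_nil].
rewrite (_ : (fun _ => _) = ((1 : R[i]) *: F i + (fun x => \sum_(j <- s) F j x))%R).
  exact: (locally_weighted_lin hG (1 : R[i]) (hF i) IH).
by apply/funext => x; rewrite big_cons fctE /= scale1r.
Qed.

Lemma operator_sum (I : Type) (s : seq I) (F : I -> G -> R[i]) :
  (forall i, locally_weighted mu V w (F i)) ->
  \forall x \ae mu, (P (fun x => \sum_(i <- s) F i x)%R x = \sum_(i <- s) P (F i) x)%R.
Proof.
move=> hF; elim: s => [|i s IH].
  rewrite (_ : (fun x => \sum_(i <- [::]) F i x)%R = fun=> 0%R).
    by apply: aeS operator0 => x Px; rewrite big_nil.
  by apply/funext => y; rewrite big_nil.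
apply: (aeS2 _ (operator_linear (1 : R[i]) (hF i) (locally_weighted_sum s hF)) IH) => x h1 h2.
rewrite big_cons -h2 -[X in (X + _)%R]mul1r -h1; congr (P _ x).
by apply/funext => y; rewrite big_cons -[X in (X + _)%R = _](@scale1r R[i] (R[i] : lmodType R[i])).
Qed.

Section bounded_on_BF_spaces.
Variable E : nspace (G -> R[i]).
Hypothesis hE : solid_TI_BF mu Delta E.
Hypothesis hwE : admissible_for Delta E w.
Variables (h : G -> \bar R) (sh : R).
Hypothesis mh : measurable_fun [set: borel G] h.
Hypothesis h0 : forall x, 0 <= h x.
Hypothesis Hh : \forall x \ae mu, (cmod (toC H x))%:E <= h x.
Hypothesis hsh : \int[mu]_x (h x * (w x)%:E) <= sh%:E.

(* Stated for dominated functions because [f - Phi_U(c)] is only known to lie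
   below an element of [E]. *)
Lemma operator_bounded : exists2 c : R, (0 < c)%R & forall f r,
  locally_weighted mu V w f ->
  dominated mu E (fun x => (cmod (f x))%:E) r -> E (P f) /\ (nrm E (P f) <= c * r)%R.
Proof.
have [c c0 hc] := young hG hE hwE.
exists (c * (`|sh| + 1))%R => [|f r hf df]; first by rewrite mulr_gt0// ltr_wpDl.
have [mf _] := hf.
have d0 := hc _ h r sh (measurable_ecmod mf) mh (fun x => cmod_ge0 _) h0 df hsh.
have [Ef nf] := dominated_mem hE d0 (operator_measurable hf) (operator_le hf mh h0 Hh).
split=> //; apply: (le_trans nf).
rewrite -!mulrA; apply: ler_wpM2l; first exact: ltW.
rewrite mulrC; apply: ler_wpM2r; first exact: (dominated_ge0 hE df).
by rewrite (le_trans (ler_norm _))// lerDl.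
Qed.

End bounded_on_BF_spaces.

End dominated_operator.

(** Fatou's lemma in the form needed for sums over exhausting lists, where the index from which the
    lower bound holds depends on the point. *)
Lemma integral_liminf_le d (T : measurableType d) (R : realType)
    (mu : {measure set T -> \bar R}) (f : nat -> T -> \bar R) (g : T -> \bar R) (c : \bar R) :
  (forall n, measurable_fun setT (f n)) -> (forall n x, (0 <= f n x)%E) ->
  measurable_fun setT g -> (forall x, (0 <= g x)%E) ->
  (forall x, \forall n \near \oo, (g x <= f n x)%E) ->
  (forall n, (\int[mu]_x f n x <= c)%E) -> (\int[mu]_x g x <= c)%E.
Proof.
move=> mf f0 mg g0 gf fc.
have le_einf (u : nat -> \bar R) b : (\forall n \near \oo, (b <= u n)%E) -> (b <= limn_einf u)%E.
  move=> [N _ hN]; rewrite limn_einf_lim; apply: lime_ge; first exact: is_cvg_einfs.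
  exists N => // n /= Nn; apply: le_ereal_inf_tmp => _ [k /= nk <-].
  by apply: hN; exact: leq_trans nk.
have einf_le (u : nat -> \bar R) b : (forall n, (u n <= b)%E) -> (limn_einf u <= b)%E.
  move=> ub; rewrite limn_einf_lim; apply: lime_le; first exact: is_cvg_einfs.
  exists 0%N => // n _; apply: (le_trans _ (ub n)); apply: ereal_inf_lbound.
  by exists n => /=.
apply: (@le_trans _ _ (limn_einf (fun n => \int[mu]_x f n x)%E)); last exact: einf_le.
apply: (@le_trans _ _ (\int[mu]_x limn_einf (f ^~ x))%E); last first.
  by apply: fatou => // n x _; exact: f0.
apply: ge0_le_integral.
- exact: measurableT.
- by move=> x _; exact: g0.
- exact: mg.
- apply: (emeasurable_fun_cvg _ _ (fun n => measurable_fun_einfs mf n)) => x _.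
  by rewrite limn_einf_lim; exact: is_cvg_einfs.
- by move=> x _; apply: le_einf; exact: gf.
Qed.

(** * Synthesis from coefficients *)

Section synthesis.
Context {R : realType} {G : topologicalGroupType}.
Variables (mu : {measure set (borel G) -> \bar R}) (Delta : G -> R) (V : set G).
Hypothesis hG : haar_group mu Delta V.
Variable Gam : set G.
Hypothesis hGam : relatively_separated V Gam.

Lemma ltranslate_indic (A : set G) x y : \1_(ltranslate A x) y = \1_A (x^-1 * y)%g :> R.
Proof.
rewrite !indicE ltranslateE; congr ((nat_of_bool _)%:R).
Qed.

Definition synthesis (U : set G) (c : Gam -> G -> R[i]) : G -> R[i] :=
  fun x => \sum_(gam \in [set: Gam]) cutoff (ltranslate U (\val gam)) (c gam) x.

Lemma synthesis_near L U c x : exhausting L -> compact U ->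
  \forall n \near \oo,
    synthesis U c x = \sum_(gam <- L n) cutoff (ltranslate U (\val gam)) (c gam) x.
Proof.
move=> hL cU; apply: exhausting_fsbig => //.
apply: sub_finite_set (compact_finite hG hGam x cU) => gam /= /eqP h.
apply: contrapT => nU; apply: h; by rewrite /cutoff ltranslate_indic indicE memNset// mul0r.
Qed.

Lemma measurable_synthesis U c : compact U -> (forall gam, measurable_cfun (c gam)) ->
  measurable_cfun (synthesis U c).
Proof.
move=> cU mc; have [L hL] := separated_exhausting hG hGam.
have mU := compact_borel hG cU.
apply: (measurable_cfun_cvg (F := fun n x => \sum_(gam <- L n) cutoff (ltranslate U (\val gam)) (c gam) x)).
  move=> n; apply: measurable_cfun_sum => gam; apply: measurable_cutoff => //.
  exact: measurable_ltranslate.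
by move=> x; have := synthesis_near c x hL cU; apply: filterS => n ->.
Qed.

Lemma steps_near L (a : Gam -> R[i]) x : exhausting L -> \forall n \near \oo,
  steps V a x = \sum_(gam <- L n) (cmod (a gam) * \1_V ((\val gam)^-1 * x)%g).
Proof.
move=> hL; have [_ _ _ _ [_ _ cV _]] := hG.
have fin : finite_set [set gam : Gam | cmod (a gam) * \1_(ltranslate V (\val gam)) x != 0].
  apply: sub_finite_set (compact_finite hG hGam x cV) => gam /= /eqP h.
  apply: contrapT => nV; apply: h; rewrite ltranslate_indic indicE memNset ?mulr0//.
  by move=> /(@subset_closure _ V).
have := exhausting_fsbig hL fin; apply: filterS => n hn.
by rewrite /steps hn; apply: eq_bigr => gam _; rewrite ltranslate_indic.
Qed.

Lemma steps_ge0 (a : Gam -> R[i]) x : 0 <= steps V a x.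
Proof.
have [L hL] := separated_exhausting hG hGam.
have [n _ /(_ n (leqnn n)) ->] := steps_near a x hL.
by apply: sumr_ge0 => gam _; rewrite mulr_ge0 ?cmod_ge0.
Qed.

Lemma measurable_steps (a : Gam -> R[i]) : measurable_fun [set: borel G] (steps V a).
Proof.
have [L hL] := separated_exhausting hG hGam.
have mF n : measurable_cfun (toC (fun x : G => \sum_(gam <- L n) (cmod (a gam) * \1_V ((\val gam)^-1 * x)%g))).
  apply: measurable_toC; apply: measurable_sum => gam; apply: measurable_funM => //.
  exact: (measurable_mull (\val gam)^-1%g (measurable_indic_real (mV hG))).
have [] // := @measurable_cfun_cvg R G _ (toC (steps V a)) mF.
by move=> x; have := steps_near a x hL; apply: filterS => n; rewrite /toC => ->.
Qed.

Lemma le_steps (a : Gam -> R[i]) gam x : V ((\val gam)^-1 * x)%g -> cmod (a gam) <= steps V a x.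
Proof.
move=> Vx; have [L hL] := separated_exhausting hG hGam.
have := filterI (steps_near a x hL) (exhausting_near hL (finite_set1 gam)).
move=> [n _ /(_ n (leqnn n))[-> /(_ gam erefl) gL]].
have [uL _ _] := hL.
rewrite (bigD1_seq gam)//= indicE mem_set// mulr1 lerDl.
by apply: sumr_ge0 => i _; rewrite mulr_ge0 ?cmod_ge0.
Qed.

Lemma steps_le : exists2 K : R, 0 <= K & forall (a : Gam -> R[i]) x (M : R), 0 <= M ->
  (forall gam, V ((\val gam)^-1 * x)%g -> cmod (a gam) <= M) -> steps V a x <= K * M.
Proof.
have [N hN] := separated_count hG hGam; exists N%:R => // a x M M0 aM.
have [L hL] := separated_exhausting hG hGam.
have [n _ /(_ n (leqnn n)) ->] := steps_near a x hL.
have [uL _ _] := hL.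
pose p (gam : Gam) := `[< V ((\val gam)^-1 * x)%g >].
apply: (@le_trans _ _ (\sum_(gam <- [seq gam <- L n | p gam]) M)).
  rewrite big_filter [leRHS]big_mkcond; apply: ler_sum => gam _; rewrite /p indicE.
  case: asboolP => [Vx|nVx]; first by rewrite mem_set// mulr1; exact: aM.
  by rewrite memNset// mulr0.
rewrite big_const_seq count_predT iter_addr_0 -[leLHS]mulr_natl.
apply: ler_wpM2r => //; rewrite ler_nat.
apply: (hN x) => [|gam]; first exact: filter_uniq.
by rewrite mem_filter => /andP[/asboolP].
Qed.

Variable B : nspace (G -> R[i]).
Hypothesis hB : solid_isometric_TI_BF mu Delta B.

(** Elements of [B] are controlled through local integrals, so [synthesis] is compared with [steps]
    only after integration against a slowly varying [psi]. The piece on [gam U] contributes at most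
    a constant times [nrm B (c gam)] times any value of [psih] on [gam V], and [separated_sum] adds
    the pieces. *)
Lemma synthesis_pairing U : compact U -> exists2 K : R, 0 <= K &
  forall (c : Gam -> G -> R[i]) (psi psih : G -> \bar R), (forall gam, B (c gam)) ->
  measurable_fun [set: borel G] psi -> measurable_fun [set: borel G] psih ->
  (forall x, (0 <= psi x)%E) -> (forall x, (0 <= psih x)%E) ->
  (forall s u v, U u -> V v -> (psi (s * u)%g <= psih (s * v)%g)%E) ->
  (\int[mu]_x ((cmod (synthesis U c x))%:E * psi x) <=
   K%:E * \int[mu]_x ((steps V (norms B c) x)%:E * psih x))%E.
Proof.
move=> cU; have [CU CU0 hU] := isometric_local_bound hG hB cU.
have [K K0 hK] := separated_sum hG hGam.
have mU := compact_borel hG cU; have hB' : solid_TI_BF mu Delta B by case: hB.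
exists (K * CU); first exact: mulr_ge0.
move=> c psi psih Bc mpsi mpsih psi0 psih0 psile.
have [L hL] := separated_exhausting hG hGam; have [uL _ _] := hL.
have mc gam : measurable_cfun (c gam) by exact: (BF_measurable hB' (Bc gam)).
have mcut (gam : Gam) : measurable_cfun (cutoff (ltranslate U (\val gam)) (c gam)).
  by apply: measurable_cutoff => //; exact: measurable_ltranslate.
pose a (gam : Gam) := (\int[mu]_x ((cmod (cutoff (ltranslate U (\val gam)) (c gam) x))%:E * psi x))%E.
have ma (gam : Gam) : measurable_fun [set: borel G]
    (fun x : G => ((cmod (cutoff (ltranslate U (\val gam)) (c gam) x))%:E * psi x)%E).
  by apply: emeasurable_funM => //; exact: measurable_ecmod.
have a0' (gam : Gam) (x : borel G) : setT x ->
    (0 <= (cmod (cutoff (ltranslate U (\val gam)) (c gam) x))%:E * psi x)%E.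
  by move=> _; apply: mule_ge0; [rewrite lee_fin cmod_ge0|exact: psi0].
have a0 gam : (0 <= a gam)%E by apply: integral_ge0 => x; exact: a0'.
have mst : measurable_fun [set: borel G] (fun x => ((steps V (norms B c) x)%:E * psih x)%E).
  by apply: emeasurable_funM => //; apply/measurable_EFinP; exact: measurable_steps.
have st0 x : (0 <= (steps V (norms B c) x)%:E * psih x)%E.
  by apply: mule_ge0; [rewrite lee_fin steps_ge0|exact: psih0].
have mphi : measurable_cfun (synthesis U c) by exact: measurable_synthesis.
apply: (@integral_liminf_le _ _ _ mu
  (fun n x => \sum_(gam <- L n) ((cmod (cutoff (ltranslate U (\val gam)) (c gam) x))%:E * psi x))%E).
- by move=> n; exact: emeasurable_sum.
- by move=> n x; apply: sume_ge0 => gam _; exact: (a0' gam x).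
- by apply: emeasurable_funM => //; exact: measurable_ecmod.
- by move=> x; apply: mule_ge0; [rewrite lee_fin cmod_ge0|exact: psi0].
- move=> x; have := synthesis_near c x hL cU; apply: filterS => n ->.
  rewrite -ge0_sume_distrl; last by move=> gam _; rewrite lee_fin cmod_ge0.
  apply: lee_wpmul2r; first exact: psi0.
  by rewrite sumEFin lee_fin; exact: cmod_sum.
move=> n; rewrite (ge0_integral_sum mu measurableT ma a0').
have CUe : (0 <= CU%:E :> \bar R)%E by rewrite lee_fin.
rewrite EFinM -muleA -(ge0_integralZl mu measurableT mst (fun t _ => st0 t) CUe).
apply: hK; [exact: uL|exact: measurable_funeM mst| |exact: a0|].
  by move=> t; apply: mule_ge0; [exact: CUe|exact: st0].
move=> gam t Vt; rewrite /a.
have nc0 : (0 <= nrm B (c gam))%R by exact: (nrm_ge0 (BF_seminormed hB') (Bc gam)).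
apply: (@le_trans _ _ (\int[mu]_x ((cmod (cutoff (ltranslate U (\val gam)) (c gam) x))%:E * psih t))%E).
  apply: ge0_le_integral.
  - exact: measurableT.
  - exact: a0'.
  - exact: ma.
  - by apply: emeasurable_funM; [exact: measurable_ecmod|exact: measurable_cst].
  move=> x _; rewrite cmod_cutoff ltranslate_indic indicE.
  have [Ux|nUx] := pselect (U ((\val gam)^-1 * x)%g); last by rewrite memNset// mul0r !mul0e.
  rewrite mem_set// mul1r; apply: lee_wpmul2l; first by rewrite lee_fin cmod_ge0.
  by have := psile (\val gam) _ _ Ux Vt; rewrite !mulVKg.
rewrite (ge0_integralZr mu measurableT); last exact: psih0.
  have -> : (\int[mu]_x (cmod (cutoff (ltranslate U (\val gam)) (c gam) x))%:E =
     \int[mu]_(x in ltranslate U (\val gam)) (cmod (c gam x))%:E)%E.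
    by rewrite -[RHS]integral_cutoff; apply: eq_integral => x _; rewrite mulr1.
  rewrite muleA; apply: lee_wpmul2r; first exact: psih0.
  apply: (le_trans (hU _ _ (Bc gam))); rewrite -EFinM lee_fin; apply: ler_wpM2l => //.
  have := le_steps (norms B c) Vt; rewrite /norms {1}/toC cmod_real ger0_norm//.
- exact: measurable_ecmod.
- by move=> x _; rewrite lee_fin cmod_ge0.
Qed.

End synthesis.

Section integral_tools.
Local Open Scope ereal_scope.
Context d (T : measurableType d) {R : realType}.
Variable mu : {measure set T -> \bar R}.

Lemma integral_vanishing (r : nat -> T -> R) (k : T -> \bar R) (c : R) :
  (forall n, measurable_fun setT (r n)) -> measurable_fun setT k ->
  (forall n x, (0 <= r n x)%R) -> (forall x, 0 <= k x) ->
  {ae mu, forall x, forall n, (r n x <= c)%R} ->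
  {ae mu, forall x, forall e : R, (0 < e)%R -> \forall n \near \oo, (r n x < e)%R} ->
  \int[mu]_x k x < +oo -> forall e : R, (0 < e)%R ->
  \forall n \near \oo, \int[mu]_x ((r n x)%:E * k x) < e%:E.
Proof.
move=> mr mk r0 k0 rc rcvg kfin e e0.
have ik : mu.-integrable setT k.
  by apply/integrableP; split => //; under eq_integral do rewrite gee0_abs//.
have mrk n : measurable_fun setT (fun x => (r n x)%:E * k x).
  by apply: emeasurable_funM => //; exact/measurable_EFinP.
have rk0 n x : 0 <= (r n x)%:E * k x by apply: mule_ge0; [rewrite lee_fin|].
have [| | | |_ _] := @dominated_convergence _ T R mu setT measurableT
    (fun n x => (r n x)%:E * k x) (fun=> 0) (fun x => c%:E * k x) mrk.
- exact: measurable_cst.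
- have kf := integrable_ae measurableT ik.
  apply: filterS2 rcvg kf => x rx /(_ I) kx _.
  rewrite -(fineK kx); have -> : (fun n => (r n x)%:E * (fine (k x))%:E) =
    EFin \o (fun n => r n x * fine (k x))%R by [].
  rewrite (_ : 0 = (0 * fine (k x))%:E); last by rewrite mul0r.
  apply: cvg_EFin; first exact: nearW.
  apply: cvgMl; apply/cvgrPdist_lt => f /rx; apply: filterS => n.
  by rewrite sub0r normrN ger0_norm.
- by apply: integrableZl.
- apply: filterS rc => x rx n _; rewrite gee0_abs//.
  by apply: lee_wpmul2r => //; rewrite lee_fin.
rewrite integral0 => /fine_cvgP[fin /cvgrPdist_lt/(_ _ e0)].
move: fin; apply: filterS2 => n fn; rewrite /= sub0r normrN => h.
rewrite -[ltLHS]fineK// lte_fin; apply: le_lt_trans h; exact: ler_norm.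
Qed.

Lemma integral_mul_indic (A : set T) (f : T -> \bar R) :
  \int[mu]_(x in A) f x = \int[mu]_x (f x * (\1_A x)%:E).
Proof.
rewrite integral_mkcond; apply: eq_integral => x _; rewrite patchE indicE.
by case: ifP => _; rewrite ?mule1 ?mule0.
Qed.

End integral_tools.

(** * Inverting up to a contraction *)

Section approximate_inverse.
Context {R : realType} {U W : lmodType R[i]}.
Variables (X : nspace U) (S : U -> Prop) (Y : nspace W) (A : U -> W) (Q : W -> U).
Hypothesis hX : seminormed X.
Hypothesis cX : norm_complete X.
Hypothesis hS : closed_subspace S X.
Hypothesis linY : forall a c d, Y c -> Y d -> Y (a *: c + d).
Hypothesis AY : forall f, S f -> Y (A f).
Hypothesis hQ : bounded_linear Y (subnspace S X) Q.
Let T f := Q (A f).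
Hypothesis linT : forall a f g, S f -> S g -> nrm X (T (a *: f + g) - (a *: T f + T g)) = 0.
Hypothesis nearT : forall f, S f -> nrm X (f - T f) <= nrm X f / 2.

Let SX f : S f -> X f. Proof. by case: hS => /(_ f). Qed.
Let S0 : S 0. Proof. by case: hS. Qed.
Let Slin a f g : S f -> S g -> S (a *: f + g). Proof. by case: hS => _ _ /(_ a f g). Qed.
Let SD f g : S f -> S g -> S (f + g).
Proof. by move=> Sf Sg; rewrite -[f]scale1r; exact: Slin. Qed.
Let SB f g : S f -> S g -> S (f - g).
Proof. by move=> Sf Sg; rewrite addrC -scaleN1r; exact: Slin. Qed.
Let ST f : S f -> S (T f). Proof. by move=> Sf; case: hQ => /(_ _ (AY Sf)). Qed.
Let n0 f : S f -> 0 <= nrm X f. Proof. by move=> /SX; exact: nrm_ge0. Qed.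

(* [nrm X (f - g) = 0] is equality of classes; all distances may be computed
   up to it. *)
Let nrm_eq f g : S f -> S g -> nrm X (f - g) = 0 -> nrm X f = nrm X g.
Proof.
move=> Sf Sg h; apply/eqP; rewrite eq_le.
have h' : nrm X (g - f) = 0 by rewrite (nrm_distC hX) //; exact: SX.
have := nrm_leB hX (SX Sf) (SX Sg); rewrite h add0r => ->.
by have := nrm_leB hX (SX Sg) (SX Sf); rewrite h' add0r => ->.
Qed.

Let TD f g : S f -> S g -> nrm X (T (f + g) - (T f + T g)) = 0.
Proof. by move=> Sf Sg; have := linT 1 Sf Sg; rewrite !scale1r. Qed.

Let lower f : S f -> nrm X f <= 2 * nrm X (T f).
Proof.
move=> Sf; have := nrm_leB hX (SX Sf) (SX (ST Sf)); have := nearT Sf; lra.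
Qed.

Let upper f : S f -> nrm X (T f) <= 2 * nrm X f.
Proof.
move=> Sf; have := nrm_leB hX (SX (ST Sf)) (SX Sf); have := nearT Sf.
have := n0 Sf; rewrite (nrm_distC hX (SX (ST Sf)) (SX Sf)); lra.
Qed.

(** The iterates from [0] are, up to norm [0], the partial sums of the Neumann series for the
    inverse of [T] at [s]. *)
Let step s u := u + (s - T u).
Let iterates s n := iter n (step s) 0.

Let Siter s n : S s -> S (iterates s n).
Proof.
by move=> Ss; elim: n => [|n IH]; [exact: S0|apply: SD => //; apply: SB => //; exact: ST].
Qed.

(** With [r] the old residual, the new one is [r - T r] up to norm [0], and [nearT] halves it. *)
Let iter_residual s n : S s ->
  nrm X (s - T (iterates s n)) <= nrm X (s - T 0) / 2 ^+ n.
Proof.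
move=> Ss; elim: n => [|n IH]; first by rewrite expr0 divr1.
set u := iterates s n in IH *; have Su : S u by exact: Siter.
have Sr : S (s - T u) by apply: SB => //; exact: ST.
have Su1 : S (iterates s n.+1) by exact: Siter.
have -> : nrm X (s - T (iterates s n.+1)) = nrm X ((s - T u) - T (s - T u)).
  apply: nrm_eq; [by apply: SB => //; exact: ST|by apply: SB => //; exact: ST|].
  rewrite -[iterates s n.+1]/(u + (s - T u)) -[s - T u - T _]addrA -opprD.
  rewrite opprB [X in nrm X _ = _]/= [_ + (_ - s)]addrC subrKA -opprB.
  by rewrite (nrmN hX) ?TD//; apply: SX; apply: SB; [exact: ST (SD Su Sr)|exact: SD (ST Su) (ST Sr)].
apply: (le_trans (nearT Sr)); rewrite exprSr invfM mulrA.
by rewrite ler_wpM2r// invr_ge0.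
Qed.

Let surjective s : S s -> exists2 r, S r & nrm X (T r - s) = 0.
Proof.
move=> Ss; pose u := iterates s; pose c := nrm X (s - T 0).
have Su n : S (u n) by exact: Siter.
have Sres n : S (s - T (u n)) by apply: SB => //; exact: ST.
have [r Xr ur] : exists2 r, X r & forall e : R, 0 < e ->
    exists N, forall n, (N <= n)%N -> nrm X (u n - r) < e.
  apply: (@geometric_limit R U X hX cX u c) => [n|n]; first exact: SX.
  rewrite (_ : u n.+1 - u n = s - T (u n)); first exact: iter_residual.
  by rewrite -[u n.+1]/(u n + (s - T (u n))) addrC addKr.
have Sr : S r.
  case: hS => _ _ _; apply=> // e /ur[N /(_ N (leqnn N)) h].
  by exists (u N) => //; rewrite (nrm_distC hX) //; exact: SX.
exists r => //; have STr := ST Sr; have Sd : S (T r - s) by exact: SB.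
apply/eqP; rewrite eq_le n0// andbT; apply/ler_addgt0Pr => e e0; rewrite add0r.
(* The final estimate is [2 (e / 4) + e / 4], where the factor [2] bounds [T] on [S]. *)
have e4 : 0 < e / 4 by lra.
have [N hN] := ur _ e4.
have c0 : 0 <= c by apply: n0; apply: SB => //; exact: ST.
have [k hk] : exists k, c / 2 ^+ k < e / 4.
  have [k hk] : exists k : nat, c / (e / 4) < k%:R.
    by exists (Num.truncn (c / (e / 4))).+1; rewrite truncnS_gt// ?divr_ge0//; lra.
  exists k; rewrite ltr_pdivrMr ?exprn_gt0// mulrC -ltr_pdivrMr//.
  by apply: (lt_le_trans hk); rewrite -natrX ler_nat ltnW// ltn_expl.
pose n := maxn N k; have Sn := Su n.
have h1 : nrm X (u n - r) < e / 4 by apply: hN; exact: leq_maxl.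
have h2 : nrm X (s - T (u n)) < e / 4.
  apply: le_lt_trans hk; apply: (le_trans (iter_residual n Ss)); rewrite ler_wpM2l//.
  by rewrite lef_pV2 ?posrE ?exprn_gt0// ler_eXn2l ?leq_maxr// ltr1n.
have h3 : nrm X (T r - T (u n)) <= 2 * nrm X (r - u n).
  have Sru := SB Sr Sn.
  rewrite (_ : nrm X (T r - T (u n)) = nrm X (T (r - u n))); first exact: upper.
  apply: nrm_eq; [exact: SB STr (ST Sn)|exact: ST|].
  have := TD Sru Sn; rewrite subrK => <-; congr (nrm X _).
  by rewrite opprD addrA addrAC.
have := nrm_triangle hX (SX STr) (SX (ST Sn)) (SX Ss).
rewrite (nrm_distC hX (SX (ST Sn)) (SX Ss)).
move: h3; rewrite (nrm_distC hX (SX Sr) (SX Sn)); lra.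
Qed.

(** The left inverse is the inverse of [T] after [Q]. It is a choice of preimages, determined only
    up to norm [0]; its linearity in that sense follows from injectivity of [T], which the lower
    bound provides. *)
Lemma left_invertible_of_approximate : left_invertible (subnspace S X) Y A.
Proof.
have [QS Qlin [C hC]] := hQ.
(* Outside [Y] the default [0] is taken, so that [D] is defined everywhere with values in [S]. *)
have inv c : exists r, S r /\ (Y c -> nrm X (T r - Q c) = 0).
  have [Yc|nYc] := pselect (Y c); last by exists 0; split => // Yc; case: (nYc Yc).
  by have [r Sr hr] := surjective (QS _ Yc); exists r; split.
pose D c := projT1 (cid (inv c)).
have DS c : S (D c) by rewrite /D; case: cid => r [Sr h].
have TDQ c : Y c -> nrm X (T (D c) - Q c) = 0 by move=> Yc; rewrite /D; case: cid => r [Sr h] /=; exact: h.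
have small z : S z -> nrm X (T z) = 0 -> nrm X z = 0.
  by move=> Sz h; apply/eqP; rewrite eq_le n0// andbT; have := lower Sz; rewrite h mulr0.
have tr f g h : S f -> S g -> S h -> nrm X (f - g) = 0 -> nrm X (g - h) = 0 -> nrm X (f - h) = 0.
  move=> Sf Sg Sh h1 h2; apply/eqP; rewrite eq_le (n0 (SB Sf Sh)) andbT.
  by have := nrm_triangle hX (SX Sf) (SX Sg) (SX Sh); rewrite h1 h2 addr0.
have sym f g : S f -> S g -> nrm X (f - g) = 0 -> nrm X (g - f) = 0.
  by move=> Sf Sg; rewrite (nrm_distC hX) //; exact: SX.
have inj f g : S f -> S g -> nrm X (T f - T g) = 0 -> nrm X (f - g) = 0.
  move=> Sf Sg h; have Sfg := SB Sf Sg; apply: small => //.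
  rewrite -h; apply: nrm_eq; [exact: ST|exact: SB (ST Sf) (ST Sg)|].
  have := TD Sfg Sg; rewrite subrK => h2.
  rewrite (_ : _ - _ = - (T f - (T (f - g) + T g))); last by rewrite !opprB addrA.
  rewrite (nrmN hX) ?h2//; apply: SX; apply: SB; first exact: ST.
  by apply: SD; exact: ST.
have lin2 a f g f' g' : S f -> S g -> S f' -> S g' -> nrm X (f - f') = 0 ->
    nrm X (g - g') = 0 -> nrm X ((a *: f + g) - (a *: f' + g')) = 0.
  move=> Sf Sg Sf' Sg' h1 h2; apply/eqP; rewrite eq_le (n0 (SB (Slin a Sf Sg) (Slin a Sf' Sg'))) andbT.
  rewrite opprD addrACA -scalerBr.
  have Xf := SX (SB Sf Sf'); have Xg := SX (SB Sg Sg').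
  by have := nrmD hX (memZ hX a Xf) Xg; rewrite (nrmZ hX) // h1 h2 mulr0 addr0.
exists D; last first.
  move=> f Sf /=; apply: inj => //; exact: TDQ (AY Sf).
split => [c _|a c d Yc Yd|]; first exact: DS.
  have Ycd := linY a Yc Yd.
  have SL : S (a *: D c + D d) by exact: Slin.
  apply: inj => //.
  have SQ : S (a *: Q c + Q d) by apply: Slin; exact: QS.
  apply: (tr _ (Q (a *: c + d))) => //; [exact: ST|exact: QS|exact: ST|exact: TDQ|].
  apply: (tr _ (a *: Q c + Q d)) => //; [exact: QS|exact: ST|exact: Qlin|].
  apply: (tr _ (a *: T (D c) + T (D d))) => //; [by apply: Slin; exact: ST|exact: ST| |].
    apply: lin2; [exact: QS|exact: QS|exact: ST|exact: ST|apply: sym|apply: sym];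
      by [exact: ST|exact: QS|exact: TDQ].
  by apply: sym; [exact: ST|by apply: Slin; exact: ST|exact: linT].
exists (2 * C) => c Yc /=; apply: (le_trans (lower (DS c))).
rewrite -mulrA ler_wpM2l// (nrm_eq (ST (DS c)) (QS _ Yc) (TDQ _ Yc)).
exact: hC.
Qed.

End approximate_inverse.

(** * Sampling and reconstruction *)

Section frame.
Context {R : realType} {G : topologicalGroupType}.
Variables (mu : {measure set (borel G) -> \bar R}) (Delta : G -> R) (V : set G).
Variables (E : nspace (G -> R[i])) (w : G -> R) (S : (G -> R[i]) -> Prop).
Variables (P : (G -> R[i]) -> (G -> R[i])) (H : G -> R).
Variables (Gam : set G) (eta : Gam -> G -> R[i]) (g : G -> R) (B : nspace (G -> R[i])).
Hypothesis hG : haar_group mu Delta V.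
Hypothesis hE : solid_TI_BF mu Delta E.
Hypothesis hw : admissible_for Delta E w.
Hypothesis hS : closed_subspace S E.
Hypothesis hP : bounded_linear (amalgam V (L1 mu) (Linf_inv mu w)) (Linf_inv mu w) P.
Hypothesis hPE : forall f, E f -> S (P f).
Hypothesis hPid : forall f, S f -> \forall x \ae mu, P f x = f x.
Hypothesis hPH : forall f, amalgam V (L1 mu) (Linf_inv mu w) f ->
  \forall x \ae mu,
    ((cmod (P f x))%:E <= \int[mu]_y (cmod (f y) * H (y^-1 * x)%g)%:E)%E.
Hypothesis hGam : relatively_separated V Gam.
Hypothesis heta_meas : forall gam, measurable_cfun (eta gam).
Hypothesis hg : L1loc mu (toC g).
Hypothesis heta_g : forall gam x, cmod (eta gam x) <= g ((\val gam)^-1 * x)%g.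
Hypothesis heta_sum : \forall x \ae mu, unconditional_sum (fun gam => eta gam x) 1.
Variable M : R.
Hypothesis heta_bnd : \forall x \ae mu,
  (\esum_(gam in [set: Gam]) (cmod (eta gam x))%:E <= M%:E)%E.
Hypothesis hB : solid_isometric_TI_BF mu Delta B.
Hypothesis BH : B (toC H).

Local Open Scope ereal_scope.
(* [H1] and [H2] are the majorants of [H] given by its left and right amalgam
   norms, [g1] the one of [|g| * chi_V]; [Hs] and [gb] bound [H1] and [g1] along
   translates by [V]. *)
Variables (H1 Hs H2 g1 gb : G -> \bar R) (s1 sg : R).
Hypothesis mH1 : measurable_fun [set: borel G] H1.
Hypothesis H10 : forall x, 0 <= H1 x.
Hypothesis mHs : measurable_fun [set: borel G] Hs.
Hypothesis Hs0 : forall x, 0 <= Hs x.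
Hypothesis HH1 : \forall x \ae mu, (cmod (toC H x))%:E <= H1 x.
Hypothesis H1s : forall t v, V v -> H1 (t * v)%g <= Hs t.
Hypothesis intHs : \int[mu]_x (Hs x * (w x)%:E) <= s1%:E.
Hypothesis mH2 : measurable_fun [set: borel G] H2.
Hypothesis H20 : forall x, 0 <= H2 x.
Hypothesis HH2 : \forall x \ae mu, (cmod (toC H x))%:E <= H2 x.
Hypothesis H2b : forall Q : set G, compact Q -> exists (hs : G -> \bar R) (s : R),
  [/\ measurable_fun [set: borel G] hs /\ (forall x, 0 <= hs x),
      forall q t, Q q -> H2 (q * t)%g <= hs t
    & \int[mu]_x (hs x * (w x)%:E) <= s%:E].
Hypothesis mg1 : measurable_fun [set: borel G] g1.
Hypothesis g10 : forall x, 0 <= g1 x.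
Hypothesis gg1 : \forall x \ae mu, (cmod (smear mu V (toC g) x))%:E <= g1 x.
Hypothesis mgb : measurable_fun [set: borel G] gb.
Hypothesis gb0 : forall x, 0 <= gb x.
Hypothesis g1b : forall q t, closure V q -> g1 (q * t)%g <= gb t.
Hypothesis intgb : \int[mu]_x (gb (x^-1)%g * (w x)%:E) <= sg%:E.

Local Notation absE f := (fun x => (cmod (f x))%:E).
Let hwa : admissible_weight Delta w. Proof. by case: hw. Qed.
Let hB' : solid_TI_BF mu Delta B. Proof. by case: hB. Qed.
Let mHC : measurable_cfun (toC H). Proof. exact: (BF_measurable hB' BH). Qed.
Let SE f : S f -> E f. Proof. by case: hS => /(_ f). Qed.
Let lwE f : E f -> locally_weighted mu V w f.
Proof. exact: (BF_locally_weighted hG hE hw). Qed.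
Let m0 : (0 < volV mu V)%R. Proof. exact: (volV_gt0 hG). Qed.
Let V0 (z : G) : 0 <= eindic V z :> \bar R. Proof. exact: eindic_ge0. Qed.
Let mV' : measurable_fun [set: borel G] (eindic V : G -> \bar R).
Proof. exact: (measurable_eindic (mV hG)). Qed.

(** For [f] in [S], [rough f] lies above [|f|] by the reproducing property, and [smooth f] bounds
    [rough f] along translates of [V]: they are the [f1] and [F] of [averaging]. *)
Definition rough f : G -> \bar R := econv mu (absE f) H1.
Definition smooth f : G -> \bar R := econv mu (absE f) Hs.
(** Inversion puts [gb] in convolution form: [gb (x^-1 t)] is [gcheck (t^-1 x)]. *)
Definition gcheck (z : G) : \bar R := gb (z^-1)%g.

Lemma measurable_rough f : measurable_cfun f -> measurable_fun [set: borel G] (rough f).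
Proof.
move=> mf; apply: (measurable_econv hG) => //; first exact: measurable_ecmod.
by move=> y; rewrite lee_fin cmod_ge0.
Qed.

Lemma rough_ge0 f x : 0 <= rough f x.
Proof. by apply: econv_ge0 => // y; rewrite lee_fin cmod_ge0. Qed.

Lemma measurable_smooth f : measurable_cfun f -> measurable_fun [set: borel G] (smooth f).
Proof.
move=> mf; apply: (measurable_econv hG) => //; first exact: measurable_ecmod.
by move=> y; rewrite lee_fin cmod_ge0.
Qed.

Lemma smooth_ge0 f x : 0 <= smooth f x.
Proof. by apply: econv_ge0 => // y; rewrite lee_fin cmod_ge0. Qed.

Lemma rough_smooth f t v : measurable_cfun f -> V v -> rough f (t * v)%g <= smooth f t.
Proof.
move=> mf Vv; have mef := measurable_ecmod mf; apply: ge0_le_integral.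
- exact: measurableT.
- by move=> y _; apply: mule_ge0; [rewrite lee_fin cmod_ge0|exact: H10].
- exact: (measurable_econv_integrand (t * v)%g mef mH1).
- exact: (measurable_econv_integrand t mef mHs).
move=> y _; apply: lee_wpmul2l; first by rewrite lee_fin cmod_ge0.
by rewrite mulgA; exact: H1s.
Qed.

Lemma reproduced f : S f -> \forall x \ae mu, (cmod (f x))%:E <= rough f x.
Proof.
move=> Sf; apply: (aeS2 _ (hPid Sf) (operator_le hG hwa mHC hPH (lwE (SE Sf)) mH1 H10 HH1)).
by move=> x ->.
Qed.

Lemma smooth_dominated : exists2 c : R, (0 <= c)%R & forall f, E f ->
  dominated mu E (smooth f) (c * nrm E f).
Proof.
have [c c0 hc] := young hG hE hw; exists (c * `|s1|)%R; first by rewrite mulr_ge0// ltW.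
move=> f Ef; have mf := BF_measurable hE Ef.
have intHs' : \int[mu]_x (Hs x * (w x)%:E) <= `|s1|%:E.
  by apply: (le_trans intHs); rewrite lee_fin ler_norm.
rewrite mulrAC; apply: hc => //; first exact: measurable_ecmod.
- by move=> y; rewrite lee_fin cmod_ge0.
- exact: dominated_self.
Qed.

(** This holds at every point: local integrability of [g] makes its average over each translate of
    [V] finite, so no default value of the integral intervenes. *)
Lemma smearE z : (cmod (smear mu V (toC g) z))%:E =
  \int[mu]_y (eindic V (z^-1 * y)%g * (cmod (toC g y))%:E).
Proof.
have [mg lg] := hg; have meg := measurable_ecmod mg.
have [_ _ _ _ [_ _ cV _]] := hG.
pose k y := (cmod (toC g y) * \1_V (y^-1 * z)%g)%R.
have k0 y : (0 <= k y)%R by rewrite mulr_ge0// cmod_ge0.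
have kE y : ((toC (fun x => cmod (toC g x)) y) * toC (fun x => \1_V x : R) (y^-1 * z)%g = (k y)%:C%C)%R.
  by rewrite /toC -rmorphM.
have IE : \int[mu]_y (k y)%:E = \int[mu]_y (eindic V (z^-1 * y)%g * (cmod (toC g y))%:E).
  apply: eq_integral => y _; rewrite /k EFinM muleC; congr (_ * _).
  have := windowV hG (z^-1 * y)%g; rewrite invgM invgK => Vyz.
  have [Vy|nVy] := pselect (V (z^-1 * y)%g).
    by rewrite eindic1// indicE mem_set// Vyz.
  by rewrite eindic0// indicE memNset// Vyz.
have Ik0 : 0 <= \int[mu]_y (k y)%:E by apply: integral_ge0 => y _; rewrite lee_fin.
have Ikf : \int[mu]_y (k y)%:E < +oo.
  have cVz : compact (ltranslate (closure V) z) by exact: compact_ltranslate.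
  apply: le_lt_trans (lg _ cVz); rewrite IE [leRHS]integral_mkcond.
  apply: ge0_le_integral.
  - exact: measurableT.
  - by move=> y _; apply: mule_ge0; [exact: V0|rewrite lee_fin cmod_ge0].
  - by apply: emeasurable_funM => //; exact: (measurable_mull (z^-1)%g mV').
  - apply: measurable_patch => //; exact: (compact_borel hG).
  move=> y _; rewrite patchE; have [Vy|nVy] := pselect (V (z^-1 * y)%g).
    rewrite eindic1// mul1e mem_set//; exists (z^-1 * y)%g; last by rewrite mulVKg.
    exact: subset_closure.
  by rewrite eindic0// mul0e; case: ifP => _ //; rewrite lee_fin cmod_ge0.
rewrite -IE; have -> : smear mu V (toC g) z = (fine (\int[mu]_y (k y)%:E))%:C%C.
  rewrite /smear /convol /cintegral.
  congr (_ +i* _)%C.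
    by rewrite /Rintegral; congr fine; apply: eq_integral => y _; rewrite kE.
  under eq_Rintegral do rewrite kE /=.
  by rewrite /Rintegral integral0.
by rewrite cmod_real ger0_norm ?fine_ge0// fineK// ge0_fin_numE.
Qed.

(** [averaging] replaces the bound [g] of [eta gam] by its smear, hence by [g1]. The cutoffs follow
    along: if [gam^-1 t] is in [U'] and [t^-1 y] in [V], then [gam^-1 y] is in [U], so such [t]
    contribute nothing. Empty cutoffs give boundedness of the coefficients, large ones the tail of
    [g]. *)
Lemma atom_pairing (U U' : set G) (a a1 A : G -> \bar R) gam :
  measurable (U : set (borel G)) -> measurable (U' : set (borel G)) ->
  (forall z v, U' z -> V v -> U (z * v)%g) ->
  measurable_fun [set: borel G] a -> measurable_fun [set: borel G] a1 ->
  measurable_fun [set: borel G] A -> (forall x, 0 <= a x) -> (forall x, 0 <= a1 x) ->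
  (forall x, 0 <= A x) -> (\forall x \ae mu, a x <= a1 x) ->
  (forall t v, V v -> a1 (t * v)%g <= A t) ->
  \int[mu]_y (a y * ((cmod (eta gam y))%:E * eindic (~` U) ((\val gam)^-1 * y)%g)) <=
  ((volV mu V)^-1)%:E *
  \int[mu]_t (A t * (g1 ((\val gam)^-1 * t)%g * eindic (~` U') ((\val gam)^-1 * t)%g)).
Proof.
move=> mU mU' UU' ma ma1 mA a0 a10 A0 aa1 a1A; have [mg _] := hg.
have meg := measurable_ecmod mg.
set x := \val gam.
have mNU : measurable_fun [set: borel G] (eindic (~` U) : G -> \bar R).
  by apply: measurable_eindic; exact: measurableC.
have mNU' : measurable_fun [set: borel G] (eindic (~` U') : G -> \bar R).
  by apply: measurable_eindic; exact: measurableC.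
pose b y := (cmod (toC g (x^-1 * y)%g))%:E * eindic (~` U) (x^-1 * y)%g.
have mb : measurable_fun [set: borel G] b.
  apply: emeasurable_funM; first exact: (measurable_mull (x^-1)%g meg).
  exact: (measurable_mull (x^-1)%g mNU).
have b0 y : 0 <= b y by apply: mule_ge0; [rewrite lee_fin cmod_ge0|exact: eindic_ge0].
apply: (@le_trans _ _ (\int[mu]_y (a y * b y))).
  apply: ge0_le_integral.
  - exact: measurableT.
  - move=> y _; apply: mule_ge0; first exact: a0.
    by apply: mule_ge0; [rewrite lee_fin cmod_ge0|exact: eindic_ge0].
  - apply: emeasurable_funM => //; apply: emeasurable_funM; first exact: measurable_ecmod.
    exact: (measurable_mull (x^-1)%g mNU).
  - exact: emeasurable_funM.
  move=> y _; apply: lee_wpmul2l; first exact: a0.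
  apply: lee_wpmul2r; first exact: eindic_ge0.
  by rewrite lee_fin (le_trans (heta_g _ _))// cmod_real ler_norm.
apply: (le_trans (averaging hG ma ma1 mA mb a0 a10 A0 b0 aa1 a1A)).
apply: lee_wpmul2l; first by rewrite lee_fin invr_ge0 ltW.
have mVt t : measurable_fun [set: borel G] (fun y => eindic V (t^-1 * y)%g * b y).
  by apply: emeasurable_funM; [exact: (measurable_mull (t^-1)%g mV')|exact: mb].
have inner0 t : 0 <= \int[mu]_y (eindic V (t^-1 * y)%g * b y).
  by apply: integral_ge0 => y _; apply: mule_ge0; [exact: V0|exact: b0].
apply: ae_ge0_le_integral.
- exact: measurableT.
- by move=> t _; apply: mule_ge0; [exact: A0|exact: inner0].
- apply: emeasurable_funM => //.
  pose K (z : G * G) := eindic V (z.1^-1 * z.2)%g * b z.2.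
  have [] // := @tonelli _ _ _ _ _ hG K.
    by apply: emeasurable_funM; [exact: (measurable_ldiv mV')|exact: (measurable_proj2 mb)].
  by move=> z; apply: mule_ge0; [exact: V0|exact: b0].
- move=> t _; apply: mule_ge0; first exact: A0.
  by apply: mule_ge0; [exact: g10|exact: eindic_ge0].
- apply: emeasurable_funM => //; apply: emeasurable_funM.
    exact: (measurable_mull (x^-1)%g mg1).
  exact: (measurable_mull (x^-1)%g mNU').
apply: aeS (ae_mull hG (x^-1)%g gg1) => t gt _.
apply: lee_wpmul2l; first exact: A0.
have [U't|nU't] := pselect (U' (x^-1 * t)%g).
  rewrite [X in _ <= _ * X]eindic0 ?mule0; last by move=> /(_ U't).
  rewrite le_eqVlt; apply/orP; left; apply/eqP; rewrite -[RHS](integral0 mu setT).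
  apply: eq_integral => y _; have [Vy|nVy] := pselect (V (t^-1 * y)%g); last first.
    by rewrite (eindic0 nVy) mul0e.
  rewrite /b [X in _ * (_ * X)]eindic0 ?mule0//; apply.
  by have := UU' _ _ U't Vy; rewrite -mulgA mulVKg.
rewrite [X in _ <= _ * X]eindic1// mule1; apply: le_trans gt; rewrite smearE.
pose phi y := eindic V ((x^-1 * t)^-1 * y)%g * (cmod (toC g y))%:E.
have mphi : measurable_fun [set: borel G] phi.
  by apply: emeasurable_funM; [exact: (measurable_mull ((x^-1 * t)^-1)%g mV')|exact: meg].
have phi0 y : 0 <= phi y by apply: mule_ge0; [exact: V0|rewrite lee_fin cmod_ge0].
rewrite -[leRHS](integral_mull hG (x^-1)%g mphi phi0).
apply: ge0_le_integral.
- exact: measurableT.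
- by move=> y _; apply: mule_ge0; [exact: V0|exact: b0].
- exact: mVt.
- exact: (measurable_mull (x^-1)%g mphi).
move=> y _; rewrite /phi /b invgM invgK -mulgA mulVKg; apply: lee_wpmul2l; first exact: V0.
rewrite -[leRHS]mule1; apply: lee_wpmul2l; first by rewrite lee_fin cmod_ge0.
by rewrite -(@eindic1 R G setT (x^-1 * y)%g)//; exact: eindic_le.
Qed.

Lemma gcheck_ge0 z : 0 <= gcheck z. Proof. exact: gb0. Qed.

Lemma measurable_gcheck : measurable_fun [set: borel G] gcheck.
Proof. exact: (measurable_invg mgb). Qed.

Definition spread f : G -> \bar R := econv mu (smooth f) gcheck.

Lemma spread_ge0 f x : 0 <= spread f x.
Proof. by apply: econv_ge0; [exact: smooth_ge0|exact: gcheck_ge0]. Qed.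

Lemma spread_dominated : exists2 c : R, (0 <= c)%R & forall f, E f ->
  dominated mu E (spread f) (c * nrm E f).
Proof.
have [c1 c10 hc1] := smooth_dominated; have [c c0 hc] := young hG hE hw.
exists (c * c1 * `|sg|)%R; first by rewrite !mulr_ge0// ltW.
move=> f Ef; rewrite mulrAC -[(c * c1 * _)%R]mulrA; apply: hc.
- exact: measurable_smooth (BF_measurable hE Ef).
- exact: measurable_gcheck.
- exact: smooth_ge0.
- exact: gcheck_ge0.
- exact: hc1.
- by apply: (le_trans intgb); rewrite lee_fin ler_norm.
Qed.

(** Writing [gam^-1 t = (gam^-1 x) (x^-1 t)] with first factor in [V] bounds [g1 (gam^-1 t)] by
    [gb (x^-1 t)]. The estimate thus holds at every point of [gam V], as the norm of [Ed]
    requires. *)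
Lemma coef_le f gam x : S f -> V ((\val gam)^-1 * x)%g ->
  \int[mu]_y (cmod (f y * eta gam y))%:E <= ((volV mu V)^-1)%:E * spread f x.
Proof.
move=> Sf Vx; have mf := BF_measurable hE (SE Sf).
have m00 : measurable (set0 : set (borel G)) by exact: measurable0.
have e1 z : eindic (~` set0) z = 1 :> \bar R by apply: eindic1 => -[].
have := @atom_pairing set0 set0 (absE f) (rough f) (smooth f) gam m00 m00
  (fun z v => False_ind _) (measurable_ecmod mf) (measurable_rough mf)
  (measurable_smooth mf) (fun y => cmod_ge0 _) (rough_ge0 f) (smooth_ge0 f)
  (reproduced Sf) (fun t v Vv => rough_smooth t mf Vv).
under eq_integral do rewrite e1 mule1 -EFinM -cmodM.
move/le_trans; apply; apply: lee_wpmul2l; first by rewrite lee_fin invr_ge0 ltW.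
apply: ge0_le_integral.
- exact: measurableT.
- move=> t _; apply: mule_ge0; first exact: smooth_ge0.
  by rewrite e1 mule1.
- under eq_fun do rewrite e1 mule1.
  apply: emeasurable_funM; first exact: measurable_smooth.
  exact: (measurable_mull ((\val gam)^-1)%g mg1).
- exact: (measurable_econv_integrand x (measurable_smooth mf) measurable_gcheck).
move=> t _; apply: lee_wpmul2l; first exact: smooth_ge0.
rewrite e1 mule1 /gcheck invgM invgK.
have := g1b (x^-1 * t)%g (subset_closure Vx).
by rewrite -mulgA mulVKg.
Qed.

Lemma eta_bounded gam : \forall x \ae mu, (cmod (eta gam x) <= M)%R.
Proof.
apply: aeS heta_bnd => x hx; rewrite -lee_fin; apply: le_trans hx.
have := @sum_le_esum Gam R (fun gam => (cmod (eta gam x))%:E) [:: gam] erefl.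
by rewrite big_seq1.
Qed.

Lemma eta_sum_bounded L : exhausting L ->
  \forall x \ae mu, forall n, (\sum_(gam <- L n) cmod (eta gam x) <= M)%R.
Proof.
move=> [uL _ _]; apply: aeS heta_bnd => x hx n; rewrite -lee_fin; apply: le_trans hx.
by rewrite -sumEFin; exact: sum_le_esum.
Qed.

Lemma product_locally_weighted f gam : E f ->
  locally_weighted mu V w (fun y => f y * eta gam y)%R.
Proof.
move=> Ef; have mf := BF_measurable hE Ef.
apply: (locally_weighted_le hG (normr_ge0 M) (lwE Ef)); first exact: measurable_cfunM.
apply: aeS (eta_bounded gam) => x hx; rewrite cmodM mulrC.
by apply: ler_wpM2r; [exact: cmod_ge0|exact: le_trans hx (ler_norm _)].
Qed.

(** * Boundedness of the sampling map *)

Definition coefs (f : G -> R[i]) : Gam -> G -> R[i] :=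
  fun gam => P (fun x => f x * eta gam x)%R.

(** [P] of the product lies below its convolution with [|H|], and the isometric Young inequality
    sees only the [L^1] norm of the product, not where on [G] it is located. *)
Lemma coefs_B_le f gam (C : R) : E f ->
  \int[mu]_y (cmod (f y * eta gam y))%:E <= C%:E ->
  B (coefs f gam) /\ (nrm B (coefs f gam) <= C * nrm B (toC H))%R.
Proof.
move=> Ef hC; have mf := BF_measurable hE Ef.
have mfe : measurable_cfun (fun y => f y * eta gam y)%R by exact: measurable_cfunM.
have hl := product_locally_weighted gam Ef.
apply: (dominated_mem hB' (isometric_young hG hB mfe BH hC)).
- exact: (operator_measurable hG hwa hP hl).
- apply: (operator_le hG hwa mHC hPH hl).
  + exact: measurable_ecmod.
  + by move=> x; rewrite lee_fin cmod_ge0.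
  + by apply: ae_all.
Qed.

Lemma coefs_B f gam : S f -> B (coefs f gam).
Proof.
move=> Sf; have Ef := SE Sf; have mf := BF_measurable hE Ef.
have [c _ /(_ _ Ef)/(dominated_fin (spread_ge0 f)) hfin] := spread_dominated.
(* [spread f] is finite almost everywhere and [gam V] has positive measure. *)
have [x Vx xfin] : exists2 x, V ((\val gam)^-1 * x)%g & spread f x < +oo.
  apply: contrapT => nx; have : \forall x \ae mu, ~ ltranslate V (\val gam) x.
    by apply: aeS hfin => x xfin; rewrite ltranslateE => Vx; apply: nx; exists x.
  have mVg := measurable_ltranslate (\val gam) (mV hG).
  move=> h; have : mu (ltranslate V (\val gam)) = 0.
    apply: (measure_negligible mVg); move: h; apply: negligibleS => x Vx /=.
    by move=> /(_ Vx).
  by rewrite (mu_ltranslate hG _ (mV hG)) => h0; have := mu_window_gt0 hG; rewrite h0 ltxx.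
have sfin : spread f x \is a fin_num by rewrite ge0_fin_numE ?spread_ge0.
by have := coef_le Sf Vx; rewrite -(fineK sfin) -EFinM => /(coefs_B_le Ef)[].
Qed.

Lemma coefs_bounded : exists2 c : R, (0 <= c)%R & forall f, S f ->
  Ed V E Gam (norms B (coefs f)) /\ (nrm (Ed V E Gam) (norms B (coefs f)) <= c * nrm E f)%R.
Proof.
have [c c0 hc] := spread_dominated; have [K K0 hK] := steps_le hG hGam.
have nH0 : (0 <= nrm B (toC H))%R by exact: (nrm_ge0 (BF_seminormed hB')).
(* [K] counts overlaps of the sets [gam V], the inverse volume comes from [coef_le], and the norm of
   [H] from Young's inequality in [B]. *)
pose k := (K * ((volV mu V)^-1 * nrm B (toC H)))%R.
have k0 : (0 <= k)%R by rewrite /k !mulr_ge0// invr_ge0 ltW.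
exists (k * c)%R; first exact: mulr_ge0.
move=> f Sf; have Ef := SE Sf; have mf := BF_measurable hE Ef.
have hd := hc _ Ef; rewrite -mulrA.
apply: (dominated_mem hE (dominatedZ hE k0 hd)).
  by apply: measurable_toC; exact: (measurable_steps hG hGam _).
apply: aeS (dominated_fin (spread_ge0 f) hd) => x xfin.
have sfin : spread f x \is a fin_num by rewrite ge0_fin_numE ?spread_ge0.
have s0 : (0 <= fine (spread f x))%R by rewrite fine_ge0 ?spread_ge0.
rewrite cmod_real ger0_norm; last exact: (steps_ge0 hG hGam).
rewrite -(fineK sfin) -EFinM lee_fin /k -!mulrA; apply: hK.
  by rewrite !mulr_ge0// invr_ge0 ltW.
move=> gam Vx; rewrite cmod_real ger0_norm; last first.
  by apply: (nrm_ge0 (BF_seminormed hB')); exact: coefs_B.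
have := coef_le Sf Vx; rewrite -(fineK sfin) -EFinM => /(coefs_B_le Ef)[_ /le_trans]; apply.
by rewrite -mulrA (mulrC (fine _)).
Qed.

Lemma steps_norms0 (c : Gam -> G -> R[i]) : (forall gam, nrm B (c gam) = 0%R) ->
  nrm (Ed V E Gam) (norms B c) = 0%R.
Proof.
move=> c0; rewrite /= (_ : toC _ = 0%R); first exact: (nrm0 (BF_seminormed hE)).
apply/funext => x; rewrite /toC /steps fsbig1// => gam _.
by rewrite /norms /toC c0 cmod0 mul0r.
Qed.

Lemma coefs_linear a f h : S f -> S h ->
  nrm (EdB V E B Gam) (coefs (a *: f + h)%R - (a *: coefs f + coefs h))%R = 0%R.
Proof.
move=> Sf Sh; apply: steps_norms0 => gam.
have [_ _ linS _] := hS; have Slin := linS a f h Sf Sh.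
have Bz : B (coefs (a *: f + h)%R gam - (a *: coefs f gam + coefs h gam))%R.
  apply: (memB (BF_seminormed hB')); first exact: coefs_B.
  by apply: (mem_lin (BF_seminormed hB')); exact: coefs_B.
apply/(BF_nrm_eq0 hB' Bz).
have := operator_linear hG hwa hP a (product_locally_weighted gam (SE Sf))
  (product_locally_weighted gam (SE Sh)).
apply: aeS => x hx.
rewrite -[LHS]/(coefs (a *: f + h)%R gam x - (a * coefs f gam x + coefs h gam x))%R.
rewrite -hx; apply/eqP; rewrite subr_eq0; apply/eqP; congr (P _ x); apply/funext => y.
by rewrite !fctE /= mulrDl scalerAl.
Qed.

(** * The synthesis operator *)

Lemma sequence_norm c : EdB V E B Gam c ->
  [/\ forall gam, B (c gam), E (toC (steps V (norms B c)))
    & forall x, (cmod (toC (steps V (norms B c)) x))%:E = (steps V (norms B c) x)%:E].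
Proof.
move=> [Bc Ec]; split=> // x; rewrite cmod_real ger0_norm//.
exact: (steps_ge0 hG hGam).
Qed.

Lemma synthesis_locally_weighted U c : compact U -> EdB V E B Gam c ->
  locally_weighted mu V w (synthesis U c).
Proof.
move=> cU dc; have [Bc Ec sE] := sequence_norm dc.
have mphi : measurable_cfun (synthesis U c).
  by apply: (measurable_synthesis hG hGam) => // gam; exact: (BF_measurable hB' (Bc gam)).
split=> //; have [_ _ _ _ [_ _ cV _]] := hG.
(* If [x^-1 s u] is in [V], with [u] in [U] and [v] in [V], then [x^-1 s v = (x^-1 s u) u^-1 v] lies
   in this set. *)
pose K := prodset (closure V) (prodset [set y^-1 | y in U]%g (closure V)).
have cK : compact K.
  by apply: compact_prodset => //; apply: compact_prodset => //; exact: compact_invset.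
have [k k0 hk] := synthesis_pairing hG hGam hB cU.
have [l l0 hl] := BF_local_bound hG hE hw cK.
have nc0 : (0 <= nrm E (toC (steps V (norms B c))))%R by exact: (nrm_ge0 (BF_seminormed hE)).
exists (k * (l * nrm E (toC (steps V (norms B c)))))%R; first by rewrite !mulr_ge0.
move=> x; rewrite integral_mul_indic.
have mxV : measurable (ltranslate V x : set (borel G)).
  exact: (measurable_ltranslate x (mV hG)).
have mxK : measurable (ltranslate K x : set (borel G)).
  by apply: measurable_ltranslate; exact: (compact_borel hG).
have := hk c (eindic (ltranslate V x)) (eindic (ltranslate K x)) Bc
  (measurable_eindic mxV) (measurable_eindic mxK) (eindic_ge0 _) (eindic_ge0 _).
have psile s u v : U u -> V v ->
    eindic (ltranslate V x) (s * u)%g <= eindic (ltranslate K x) (s * v)%g :> \bar R.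
  move=> Uu Vv; apply: eindic_le; rewrite !ltranslateE /= => Vsu.
  exists (x^-1 * (s * u))%g; first exact: subset_closure.
  exists (u^-1 * v)%g; last by rewrite -!mulgA mulVKg.
  by exists u^-1%g; [exists u|exists v => //; exact: subset_closure].
have ind (A : set G) y : (\1_A y)%:E = eindic A y :> \bar R.
  have [Ay|nAy] := pselect (A y); first by rewrite eindic1// indicE mem_set.
  by rewrite eindic0// indicE memNset.
under eq_integral do rewrite ind.
move=> /(_ psile)/le_trans; apply.
have := hl _ x Ec; rewrite integral_mul_indic => h2.
rewrite -mulrA EFinM; apply: lee_wpmul2l; first by rewrite lee_fin.
rewrite -mulrA (mulrC (nrm _ _)) mulrA; apply: le_trans h2.
rewrite le_eqVlt; apply/orP; left; apply/eqP.
by apply: eq_integral => y _; rewrite sE ind.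
Qed.

(** [synthesis_pairing] is applied with [psi z = H2 (z^-1 x)]. The shift it asks for is
    [(z u)^-1 x = (u^-1 v) ((z v)^-1 x)], a left shift by the compact set of products of [U^-1] with
    the closure of [V], which the right amalgam norm of [H] allows. *)
Lemma synthesis_dominated U : compact U -> exists2 C : R, (0 <= C)%R &
  forall c, EdB V E B Gam c ->
  dominated mu E (econv mu (absE (synthesis U c)) H2) (C * nrm (EdB V E B Gam) c).
Proof.
move=> cU; have [_ _ _ _ [_ _ cV _]] := hG.
have cQ : compact (prodset [set y^-1 | y in U]%g (closure V)).
  by apply: compact_prodset => //; exact: compact_invset.
have [hs [s [[mhs hs0] H2hs inths]]] := H2b cQ.
have [k k0 hk] := synthesis_pairing hG hGam hB cU.
have [y y0 hy] := young hG hE hw.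
exists (k * (y * `|s|))%R; first by rewrite !mulr_ge0// ltW.
move=> c dc; have [Bc Ec sE] := sequence_norm dc.
have mst := BF_measurable hE Ec.
have := hy _ hs _ `|s|%R (measurable_ecmod mst) mhs (fun x => cmod_ge0 _) hs0 (dominated_self mu Ec).
move=> h; have {}h := h (le_trans inths _); rewrite lee_fin ler_norm in h.
have {}h := dominatedZ hE k0 (h isT).
apply: dominated_le h; last by rewrite -!mulrA (mulrC `|s|%R).
apply: ae_all => x.
have mH2x := measurable_ldivr x mH2; have mhsx := measurable_ldivr x mhs.
have := hk c (fun z => H2 (z^-1 * x)%g) (fun z => hs (z^-1 * x)%g) Bc mH2x mhsx
  (fun z => H20 _) (fun z => hs0 _).
move=> h; apply: (le_trans (h _)) => [z u v Uu Vv|].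
  rewrite (_ : ((z * u)^-1 * x)%g = ((u^-1 * v) * ((z * v)^-1 * x))%g).
    by apply: H2hs; exists u^-1%g; [exists u|exists v => //; exact: subset_closure].
  by rewrite !invgM -!mulgA mulVKg.
rewrite le_eqVlt; apply/orP; left; apply/eqP; congr (_ * _).
by apply: eq_integral => z _; rewrite sE.
Qed.

Lemma synthesis_operator U : compact U -> exists2 C : R, (0 <= C)%R &
  forall c, EdB V E B Gam c ->
  E (P (synthesis U c)) /\ (nrm E (P (synthesis U c)) <= C * nrm (EdB V E B Gam) c)%R.
Proof.
move=> cU; have [C C0 hC] := synthesis_dominated cU; exists C => // c dc.
have hl := synthesis_locally_weighted cU dc.
apply: (dominated_mem hE (hC c dc)); first exact: (operator_measurable hG hwa hP hl).
exact: (operator_le hG hwa mHC hPH hl mH2 H20 HH2).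
Qed.

Lemma synthesis_linear U (a : R[i]) (c d : Gam -> G -> R[i]) : compact U ->
  synthesis U (a *: c + d)%R = (a *: synthesis U c + synthesis U d)%R.
Proof.
move=> cU; apply/funext => x; have [L hL] := separated_exhausting hG hGam.
have := filterI (synthesis_near hG hGam c x hL cU)
  (filterI (synthesis_near hG hGam d x hL cU) (synthesis_near hG hGam (a *: c + d)%R x hL cU)).
move=> [n _ /(_ n (leqnn n))[hc [hd hcd]]].
rewrite hcd -[RHS]/(a * synthesis U c x + synthesis U d x)%R hc hd mulr_sumr -big_split.
apply: eq_bigr => gam _.
rewrite /cutoff -[(a *: c + d)%R gam x]/(a * c gam x + d gam x)%R mulrDr.
by congr (_ + _)%R; rewrite mulrCA.
Qed.

(** A partial sum of coefficients is [P] of [f] times a partial sum of the [eta gam]. Its distance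
    to [f = P f] at [x] is at most the integral of [|f y| |1 - sum eta gam y| H1 (y^-1 x)], which
    vanishes in the limit by dominated convergence wherever [smooth f x] is finite. *)
Lemma coefs_series L f : exhausting L -> S f -> \forall x \ae mu, forall e : R, (0 < e)%R ->
  \forall n \near \oo, (cmod (f x - \sum_(gam <- L n) coefs f gam x) < e)%R.
Proof.
move=> hL Sf; have Ef := SE Sf; have mf := BF_measurable hE Ef.
pose part n y : R[i] := (\sum_(gam <- L n) f y * eta gam y)%R.
have lwp n : locally_weighted mu V w (part n).
  by apply: (locally_weighted_sum hG) => gam; exact: product_locally_weighted.
have lwd n : locally_weighted mu V w (f - part n)%R.
  have := locally_weighted_lin hG (-1) (lwp n) (lwE Ef).
  by rewrite scaleN1r addrC.
have aeA : \forall x \ae mu, forall n, P (part n) x = (\sum_(gam <- L n) coefs f gam x)%R.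
  apply: ae_nat => n; apply: (operator_sum hG hwa hP) => gam.
  exact: product_locally_weighted.
have aeB : \forall x \ae mu, forall n, P (f - part n)%R x = (P f x - P (part n) x)%R.
  by apply: ae_nat => n; exact: (operatorB hG hwa hP (lwE Ef) (lwp n)).
have aeC : \forall x \ae mu, forall n, (cmod (P (f - part n)%R x))%:E <=
    econv mu (absE (f - part n)%R) H1 x.
  by apply: ae_nat => n; exact: (operator_le hG hwa mHC hPH (lwd n) mH1 H10 HH1).
have [c _ /(_ _ Ef)/(dominated_fin (smooth_ge0 f)) aeE] := smooth_dominated.
apply: (aeS2 _ (aeI aeA aeB) (aeI aeC (aeI (hPid Sf) aeE))).
move=> x [hA hB2] [hC [hD hfin]] e e0.
pose r n y := cmod (1 - \sum_(gam <- L n) eta gam y)%R.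
pose k y := (cmod (f y))%:E * H1 (y^-1 * x)%g.
have mr n : measurable_fun [set: borel G] (r n).
  apply: measurable_cmod; apply: (@measurable_cfunB R G (fun=> 1%R)).
    exact: measurable_cfun_cst.
  by apply: measurable_cfun_sum => gam; exact: heta_meas.
have mk : measurable_fun [set: borel G] k.
  exact: (measurable_econv_integrand x (measurable_ecmod mf) mH1).
have k0 y : 0 <= k y by apply: mule_ge0; [rewrite lee_fin cmod_ge0|exact: H10].
have rM : \forall y \ae mu, forall n, (r n y <= 1 + M)%R.
  apply: aeS (eta_sum_bounded hL) => y hy n; apply: (le_trans (cmodB _ _)).
  by rewrite cmod1 lerD2l (le_trans (cmod_sum _ _)).
have rcvg : \forall y \ae mu, forall e : R, (0 < e)%R -> \forall n \near \oo, (r n y < e)%R.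
  apply: aeS heta_sum => y hy d d0.
  have := exhausting_unconditional_sum hL hy d0; apply: filterS => n.
  by rewrite /r -cmodN opprB.
have kfin : \int[mu]_y k y < +oo.
  apply: le_lt_trans hfin; have := rough_smooth x mf (window1 hG).
  by rewrite mulg1.
have := integral_vanishing mr mk (fun n y => cmod_ge0 _) k0 rM rcvg kfin e0.
apply: filterS => n hn; rewrite -lte_fin; apply: le_lt_trans hn.
rewrite -hA -{1}hD -hB2; apply: (le_trans (hC n)).
rewrite le_eqVlt; apply/orP; left; apply/eqP; apply: eq_integral => y _.
rewrite /k muleA -EFinM -cmodM; congr ((cmod _)%:E * _).
by rewrite mulrBl mul1r mulr_suml; congr (_ - _)%R; apply: eq_bigr => gam _; rewrite mulrC.
Qed.

Lemma ae_exhausting (L : nat -> seq Gam) (Q : Gam -> G -> Prop) : exhausting L ->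
  (forall gam, \forall x \ae mu, Q gam x) -> \forall x \ae mu, forall gam, Q gam x.
Proof.
move=> [_ _ UL] hQ.
have h : \forall x \ae mu, forall n gam, gam \in L n -> Q gam x.
  apply: ae_nat => n; elim: (L n) => [|gam s IH]; first exact: ae_all.
  apply: (aeS2 _ (hQ gam) IH) => x Qx Qs gam'.
  by rewrite inE => /predU1P[->|/Qs].
by apply: aeS h => x hx gam; have [n /hx] := UL gam.
Qed.

(** * The error of the synthesis *)

Definition core (Q : set G) : set G := prodset (closure V) Q.
(** [U2] cuts off [H] and [Q] cuts off the majorant of [g]. The closure of [V] on the right of
    [core Q] absorbs the shift made in [atom_pairing], the one inside [core Q] the shift made in
    [separated_sum]. *)
Definition support (Q U2 : set G) : set G :=
  prodset (prodset (core Q) (closure V)) U2.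

Lemma compact_core Q : compact Q -> compact (core Q).
Proof. by have [_ _ _ _ [_ _ cV _]] := hG => cQ; exact: compact_prodset. Qed.

Lemma compact_support Q U2 : compact Q -> compact U2 -> compact (support Q U2).
Proof.
have [_ _ _ _ [_ _ cV _]] := hG => /compact_core cQ cU2.
by apply: compact_prodset => //; exact: compact_prodset.
Qed.

(* If [x] is outside [gam U], then either [y^-1 x] is outside [U2] or [y] is
   far from [gam]. *)
Lemma coef_split Q U2 f gam x : compact Q -> compact U2 -> E f ->
  (cmod (coefs f gam x))%:E <=
    econv mu (absE (fun y => f y * eta gam y)%R) (absE (toC H)) x ->
  (cmod (coefs f gam x))%:E * eindic (~` support Q U2) ((\val gam)^-1 * x)%g <=
  \int[mu]_y ((cmod (eta gam y))%:E * ((cmod (f y))%:E *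
     ((cmod (toC H (y^-1 * x)%g))%:E * eindic (~` U2) (y^-1 * x)%g))) +
  \int[mu]_y (((cmod (f y))%:E * (cmod (toC H (y^-1 * x)%g))%:E) *
     ((cmod (eta gam y))%:E *
      eindic (~` prodset (core Q) (closure V)) ((\val gam)^-1 * y)%g)).
Proof.
have [_ _ _ _ [_ _ cV _]] := hG.
move=> cQ cU2 Ef hx; have mf := measurable_ecmod (BF_measurable hE Ef).
have me := measurable_ecmod (heta_meas gam).
have mHx := measurable_ldivr x (measurable_ecmod mHC).
have mU2 : measurable (U2 : set (borel G)) by exact: (compact_borel hG).
have mU1 : measurable (prodset (core Q) (closure V) : set (borel G)).
  by apply: (compact_borel hG); apply: compact_prodset => //; exact: compact_core.
have mN2 : measurable_fun [set: borel G] (fun y => eindic (~` U2) (y^-1 * x)%g : \bar R).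
  by apply: (measurable_ldivr x); apply: measurable_eindic; exact: measurableC.
have mN1 : measurable_fun [set: borel G]
    (fun y : G => eindic (~` prodset (core Q) (closure V)) ((\val gam)^-1 * y)%g : \bar R).
  by apply: measurable_mull; apply: measurable_eindic; exact: measurableC.
have A0 y : 0 <= (cmod (eta gam y))%:E * ((cmod (f y))%:E *
     ((cmod (toC H (y^-1 * x)%g))%:E * eindic (~` U2) (y^-1 * x)%g)).
  apply: mule_ge0; first by rewrite lee_fin cmod_ge0.
  apply: mule_ge0; first by rewrite lee_fin cmod_ge0.
  by apply: mule_ge0; [rewrite lee_fin cmod_ge0|exact: eindic_ge0].
have B0 y : 0 <= ((cmod (f y))%:E * (cmod (toC H (y^-1 * x)%g))%:E) *
     ((cmod (eta gam y))%:E *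
      eindic (~` prodset (core Q) (closure V)) ((\val gam)^-1 * y)%g).
  apply: mule_ge0; first by rewrite -EFinM lee_fin mulr_ge0 ?cmod_ge0.
  by apply: mule_ge0; [rewrite lee_fin cmod_ge0|exact: eindic_ge0].
have mA := emeasurable_funM me (emeasurable_funM mf (emeasurable_funM mHx mN2)).
have mB := emeasurable_funM (emeasurable_funM mf mHx) (emeasurable_funM me mN1).
have [Ux|nUx] := pselect (support Q U2 ((\val gam)^-1 * x)%g).
  rewrite [X in _ * X]eindic0 ?mule0; last by move=> /(_ Ux).
  by apply: adde_ge0; apply: integral_ge0 => y _; [exact: A0|exact: B0].
rewrite [X in _ * X]eindic1// mule1; apply: (le_trans hx).
rewrite -(ge0_integralD mu measurableT (fun y _ => A0 y) mA (fun y _ => B0 y) mB).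
apply: ge0_le_integral.
- exact: measurableT.
- by move=> y _; rewrite -EFinM lee_fin mulr_ge0 ?cmod_ge0.
- apply: emeasurable_funM => //; apply: measurable_ecmod; apply: measurable_cfunM => //.
  exact: (BF_measurable hE Ef).
- exact: emeasurable_funD mA mB.
move=> y _; have [U2y|nU2y] := pselect (U2 (y^-1 * x)%g); last first.
  apply: le_trans (leeDl _ (B0 y)); rewrite eindic1// mule1 -!EFinM lee_fin cmodM.
  by rewrite mulrA (mulrC (cmod (f y))).
apply: le_trans (leeDr _ (A0 y)); rewrite eindic1; last first.
  move=> U1y; apply: nUx; exists ((\val gam)^-1 * y)%g => //; exists (y^-1 * x)%g => //.
  by rewrite -mulgA mulVKg.
by rewrite mule1 -!EFinM lee_fin cmodM mulrAC.
Qed.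

(** The two parts of [coef_split] are summed over [gam] separately. In the first, the bound [M] on
    the sum of the [|eta gam|] leaves a tail of [H1]. In the second, [atom_pairing] leaves the sum
    of the [g1 (gam^-1 t)] cut off outside [core Q], which is of order [delta] uniformly in [t]. *)
Lemma residual_tail : exists2 K : R, (0 <= K)%R &
  forall (Q U2 : set G) (hb : G -> \bar R) (delta : R) (L : nat -> seq Gam) f,
  compact Q -> compact U2 -> measurable_fun [set: borel G] hb -> (forall x, 0 <= hb x) ->
  (forall q t, closure V q -> H2 (q * t)%g <= hb t) -> (0 <= delta)%R ->
  \int[mu]_s (gcheck s * eindic (~` Q) (s^-1)%g) <= delta%:E ->
  exhausting L -> S f ->
  \forall x \ae mu, forall n,
    \sum_(gam <- L n) ((cmod (coefs f gam x))%:E *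
       eindic (~` support Q U2) ((\val gam)^-1 * x)%g) <=
    `|M|%:E * econv mu (absE f) (fun z => H1 z * eindic (~` U2) z) x +
    (K * delta)%:E * econv mu (smooth f) hb x.
Proof.
have [_ _ _ _ [_ _ cV _]] := hG.
have [K K0 hK] := separated_sum hG hGam.
exists ((volV mu V)^-1 * K)%R; first by rewrite mulr_ge0// invr_ge0 ltW.
move=> Q U2 hb delta L f cQ cU2 mhb hb0 H2hb d0 hdelta hL Sf.
have Ef := SE Sf; have mf := BF_measurable hE Ef; have mef := measurable_ecmod mf.
have [uL _ _] := hL.
have meH := measurable_ecmod mHC.
have mU2 : measurable (U2 : set (borel G)) by exact: (compact_borel hG).
have mQ : measurable (Q : set (borel G)) by exact: (compact_borel hG).
have mcore : measurable (core Q : set (borel G)).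
  by apply: (compact_borel hG); exact: compact_core.
have mU1 : measurable (prodset (core Q) (closure V) : set (borel G)).
  by apply: (compact_borel hG); apply: compact_prodset => //; exact: compact_core.
have mN2 : measurable_fun [set: borel G] (eindic (~` U2) : G -> \bar R).
  by apply: measurable_eindic; exact: measurableC.
have mNQ : measurable_fun [set: borel G] (eindic (~` Q) : G -> \bar R).
  by apply: measurable_eindic; exact: measurableC.
have mNc : measurable_fun [set: borel G] (eindic (~` core Q) : G -> \bar R).
  by apply: measurable_eindic; exact: measurableC.
have mN1 : measurable_fun [set: borel G]
    (eindic (~` prodset (core Q) (closure V)) : G -> \bar R).
  by apply: measurable_eindic; exact: measurableC.
have aeO : \forall x \ae mu, forall gam, (cmod (coefs f gam x))%:E <=
    econv mu (absE (fun y => f y * eta gam y)%R) (absE (toC H)) x.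
  apply: (ae_exhausting hL) => gam.
  apply: (operator_le hG hwa mHC hPH (product_locally_weighted gam Ef) meH).
    by move=> x; rewrite lee_fin cmod_ge0.
  exact: ae_all.
apply: aeS aeO => x hx n.
pose A (gam : Gam) (y : G) := (cmod (eta gam y))%:E * ((cmod (f y))%:E *
     ((cmod (toC H (y^-1 * x)%g))%:E * eindic (~` U2) (y^-1 * x)%g)).
pose a y := (cmod (f y))%:E * (cmod (toC H (y^-1 * x)%g))%:E.
have mH1x := measurable_ldivr x mH1; have mHx := measurable_ldivr x meH.
have mH2x := measurable_ldivr x mH2; have mhbx := measurable_ldivr x mhb.
have mN2x := measurable_ldivr x mN2.
have mF : measurable_fun [set: borel G] (fun y => (cmod (f y))%:E *
     ((cmod (toC H (y^-1 * x)%g))%:E * eindic (~` U2) (y^-1 * x)%g)).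
  by apply: emeasurable_funM => //; exact: emeasurable_funM.
have F0 y : 0 <= (cmod (f y))%:E *
     ((cmod (toC H (y^-1 * x)%g))%:E * eindic (~` U2) (y^-1 * x)%g).
  apply: mule_ge0; first by rewrite lee_fin cmod_ge0.
  by apply: mule_ge0; [rewrite lee_fin cmod_ge0|exact: eindic_ge0].
have mA gam : measurable_fun [set: borel G] (A gam).
  by apply: emeasurable_funM; [exact: measurable_ecmod|exact: mF].
have A0 gam y : 0 <= A gam y by apply: mule_ge0; [rewrite lee_fin cmod_ge0|exact: F0].
have M0 : 0 <= (`|M|%:E : \bar R) by rewrite lee_fin.
pose W y := (cmod (f y))%:E * (H1 (y^-1 * x)%g * eindic (~` U2) (y^-1 * x)%g).
have mW : measurable_fun [set: borel G] W.
  by apply: emeasurable_funM => //; exact: emeasurable_funM.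
have W0 y : 0 <= W y.
  apply: mule_ge0; first by rewrite lee_fin cmod_ge0.
  by apply: mule_ge0; [exact: H10|exact: eindic_ge0].
have sumA : \sum_(gam <- L n) \int[mu]_y A gam y <=
    `|M|%:E * econv mu (absE f) (fun z => H1 z * eindic (~` U2) z) x.
  rewrite -(ge0_integral_sum mu measurableT mA (fun gam y _ => A0 gam y)).
  rewrite -(ge0_integralZl mu measurableT mW (fun y _ => W0 y) M0).
  apply: ae_ge0_le_integral.
  - exact: measurableT.
  - by move=> y _; apply: sume_ge0 => gam _; exact: A0.
  - exact: emeasurable_sum.
  - by move=> y _; apply: mule_ge0; [exact: M0|exact: W0].
  - exact: measurable_funeM mW.
  apply: (aeS2 _ (eta_sum_bounded hL) (ae_ldiv hG x HH1)) => y hy hHy _.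
  rewrite /A -ge0_sume_distrl; last by move=> gam _; rewrite lee_fin cmod_ge0.
  apply: lee_pmul.
  - by apply: sume_ge0 => gam _; rewrite lee_fin cmod_ge0.
  - exact: F0.
  - by rewrite sumEFin lee_fin (le_trans (hy n))// ler_norm.
  apply: lee_wpmul2l; first by rewrite lee_fin cmod_ge0.
  by apply: lee_wpmul2r; [exact: eindic_ge0|exact: hHy].
have ma : measurable_fun [set: borel G] a by exact: emeasurable_funM.
have a0 y : 0 <= a y by rewrite /a -EFinM lee_fin mulr_ge0 ?cmod_ge0.
(* Both factors tolerate a shift of [y] by an element of [V]: [rough f] through the left amalgam
   norm of [H], [H2] through the right one. *)
pose a1 y := rough f y * H2 (y^-1 * x)%g.
have ma1 : measurable_fun [set: borel G] a1.
  by apply: emeasurable_funM => //; exact: measurable_rough.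
have a10 y : 0 <= a1 y by apply: mule_ge0; [exact: rough_ge0|exact: H20].
pose D t := smooth f t * hb (t^-1 * x)%g.
have mD : measurable_fun [set: borel G] D.
  by apply: emeasurable_funM => //; exact: measurable_smooth.
have D0 t : 0 <= D t by apply: mule_ge0; [exact: smooth_ge0|exact: hb0].
have aa1 : \forall y \ae mu, a y <= a1 y.
  apply: (aeS2 _ (reproduced Sf) (ae_ldiv hG x HH2)) => y h1 h2.
  by apply: lee_pmul; rewrite ?lee_fin ?cmod_ge0.
have a1D t v : V v -> a1 (t * v)%g <= D t.
  move=> Vv; apply: lee_pmul; [exact: rough_ge0|exact: H20|exact: rough_smooth|].
  rewrite invgM -mulgA; apply: H2hb; apply: subset_closure.
  by rewrite (windowV hG).
pose q (gam : Gam) (t : G) := g1 ((\val gam)^-1 * t)%g * eindic (~` core Q) ((\val gam)^-1 * t)%g.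
have mq (gam : Gam) : measurable_fun [set: borel G] (q gam).
  apply: emeasurable_funM; first exact: (measurable_mull ((\val gam)^-1)%g mg1).
  exact: (measurable_mull ((\val gam)^-1)%g mNc).
have q0 (gam : Gam) t : 0 <= q gam t by apply: mule_ge0; [exact: g10|exact: eindic_ge0].
have coreV z v : core Q z -> V v -> prodset (core Q) (closure V) (z * v)%g.
  by move=> Qz Vv; exists z => //; exists v => //; exact: subset_closure.
have pairB (gam : Gam) := atom_pairing gam mU1 mcore coreV ma ma1 mD a0 a10 D0 aa1 a1D.
(* For [s] in [gam V], the term at [gam] is at most [be (t^-1 s)]. Hence [separated_sum] bounds the
   sum by the integral of [be], which is a tail of [gcheck]. *)
have sumq t : \sum_(gam <- L n) q gam t <= (K * delta)%:E.
  pose be (z : G) := gcheck z * eindic (~` Q) (z^-1)%g.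
  have mbe : measurable_fun [set: borel G] be.
    by apply: emeasurable_funM; [exact: measurable_gcheck|exact: (measurable_invg mNQ)].
  have be0 z : 0 <= be z by apply: mule_ge0; [exact: gcheck_ge0|exact: eindic_ge0].
  rewrite EFinM; apply: le_trans (_ : K%:E * \int[mu]_s be (t^-1 * s)%g <= _); last first.
    apply: lee_wpmul2l; first by rewrite lee_fin.
    by rewrite (integral_mull hG (t^-1)%g mbe be0).
  apply: hK.
  - exact: uL.
  - exact: (measurable_mull (t^-1)%g mbe).
  - by move=> s; exact: be0.
  - by move=> gam; exact: q0.
  move=> gam s Vs; rewrite /q /be /gcheck invgM invgK.
  have E1 : ((\val gam)^-1 * t = ((\val gam)^-1 * s) * (s^-1 * t))%g by rewrite -mulgA mulVKg.
  apply: lee_pmul; [exact: g10|exact: eindic_ge0|by rewrite E1; apply: g1b; exact: subset_closure|].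
  apply: eindic_le => nc Qs; apply: nc; exists ((\val gam)^-1 * s)%g; first exact: subset_closure.
  by exists (s^-1 * t)%g; rewrite // E1.
pose Bg (gam : Gam) (y : G) := a y * ((cmod (eta gam y))%:E *
      eindic (~` prodset (core Q) (closure V)) ((\val gam)^-1 * y)%g).
have mi0 : 0 <= ((volV mu V)^-1)%:E :> \bar R by rewrite lee_fin invr_ge0 ltW.
have sumB : \sum_(gam <- L n) \int[mu]_y Bg gam y <=
    ((volV mu V)^-1 * K * delta)%:E * econv mu (smooth f) hb x.
  apply: (@le_trans _ _ (\sum_(gam <- L n) (((volV mu V)^-1)%:E * \int[mu]_t (D t * q gam t)))).
    by apply: lee_sum => gam _; exact: pairB.
  have mDq (gam : Gam) : measurable_fun [set: borel G] (fun t => D t * q gam t).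
    exact: emeasurable_funM mD (mq gam).
  have Dq0 (gam : Gam) t : 0 <= D t * q gam t by apply: mule_ge0; [exact: D0|exact: q0].
  rewrite -ge0_sume_distrr; last by move=> gam _; apply: integral_ge0 => t _; exact: Dq0.
  rewrite -mulrA EFinM -muleA; apply: lee_wpmul2l; first exact: mi0.
  rewrite -(ge0_integral_sum mu measurableT mDq (fun gam t _ => Dq0 gam t)).
  have Kd0 : 0 <= (K * delta)%:E :> \bar R by rewrite lee_fin mulr_ge0.
  rewrite -(ge0_integralZl mu measurableT mD (fun t _ => D0 t) Kd0).
  apply: ge0_le_integral.
  - exact: measurableT.
  - by move=> t _; apply: sume_ge0 => gam _; exact: Dq0.
  - exact: emeasurable_sum.
  - exact: measurable_funeM mD.
  move=> t _; rewrite -ge0_sume_distrr; last by move=> gam _; exact: q0.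
  by rewrite muleC; apply: lee_wpmul2r; [exact: D0|exact: sumq].
apply: le_trans (leeD sumA sumB); rewrite -big_split /=; apply: lee_sum => gam _.
exact: coef_split.
Qed.

(** At a given point [f] is within [e] of a partial sum of its coefficients and [synthesis] equals
    its own partial sum over the same list; what remains are the terms outside [gam U]. *)
Lemma residual_le (U : set G) f (Z : G -> \bar R) L : compact U -> S f -> exhausting L ->
  (\forall x \ae mu, forall n,
    \sum_(gam <- L n) ((cmod (coefs f gam x))%:E * eindic (~` U) ((\val gam)^-1 * x)%g) <= Z x) ->
  \forall x \ae mu, (cmod ((f - synthesis U (coefs f))%R x))%:E <= Z x.
Proof.
move=> cU Sf hL; apply: (aeS2 _ (coefs_series hL Sf)) => x hser hZ.
apply/lee_addgt0Pr => e e0.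
have := filterI (hser e e0) (synthesis_near hG hGam (coefs f) x hL cU).
move=> [n _ /(_ n (leqnn n))[h1 h2]].
rewrite -[(f - synthesis U (coefs f))%R x]/(f x - synthesis U (coefs f) x)%R h2.
pose r := (\sum_(gam <- L n) (cmod (coefs f gam x) * \1_(~` U) ((\val gam)^-1 * x)%g))%R.
have rZ : r%:E <= Z x.
  apply: le_trans (hZ n); rewrite /r -sumEFin; apply: lee_sum => gam _.
  rewrite EFinM; apply: lee_wpmul2l; first by rewrite lee_fin cmod_ge0.
  have [Ux|nUx] := pselect ((~` U) ((\val gam)^-1 * x)%g).
    by rewrite eindic1// indicE mem_set.
  by rewrite eindic0// indicE memNset.
apply: (@le_trans _ _ (r%:E + e%:E)); last by apply: leeD.
rewrite -EFinD lee_fin (addrC r).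
rewrite -(subrKA (\sum_(gam <- L n) coefs f gam x)%R); apply: (le_trans (cmodD _ _)).
apply: lerD; first exact: ltW.
rewrite -sumrB; apply: (le_trans (cmod_sum _ _)); apply: ler_sum => gam _.
rewrite /cutoff ltranslate_indic !indicE in_setC.
case: (_ \in U) => /=; first by rewrite mul1r subrr cmod0 mulr0.
by rewrite mul0r subr0 mulr1.
Qed.

Lemma int_H1 : \int[mu]_x (H1 x * (w x)%:E) <= s1%:E.
Proof.
apply: le_trans intHs; apply: ge0_le_integral.
- exact: measurableT.
- by move=> x _; apply: mule_ge0; [exact: H10|exact: (ew0 hwa)].
- by apply: emeasurable_funM => //; exact: (mew hwa).
- by apply: emeasurable_funM => //; exact: (mew hwa).
move=> x _; apply: lee_wpmul2r; first exact: (ew0 hwa).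
by have := H1s x (window1 hG); rewrite mulg1.
Qed.

(** The element [f0] makes [w] bounded below, so [gcheck], integrable against [w], is integrable,
    and its unweighted tails in [residual_tail] become small. [U] is chosen before [f], which makes
    the error small in operator norm. *)
Lemma approximation f0 : E f0 -> nrm E f0 != 0%R -> forall e : R, (0 < e)%R ->
  exists2 U : set G, compact U & forall f, S f ->
    dominated mu E (absE (f - synthesis U (coefs f))%R) (e * nrm E f).
Proof.
move=> Ef0 nf0 e e0; have [_ _ _ _ [_ _ cV _]] := hG.
have [cw cw0 hcw] := weight_bounded_below hG hE hw Ef0 nf0.
have [Qn [cQn ndQn UQn]] := exhaustion hG.
have [K K0 hK] := residual_tail.
have [hb [s [[mhb hb0] H2hb inthb]]] := H2b cV.
have [cF cF0 hF] := smooth_dominated.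
have [y y0 hy] := young hG hE hw.
have [L hL] := separated_exhausting hG hGam.
(* [k1] and [k2] collect the constants in front of the two tails. Tails of size [e1] and [d] make
   each term at most [e / 2]; the [1] in the denominators avoids division by [0]. *)
pose k1 := (`|M| * y)%R; pose k2 := (K * (y * cF * `|s|))%R.
have k10 : (0 <= k1)%R by rewrite mulr_ge0// ltW.
have k20 : (0 <= k2)%R by rewrite !mulr_ge0// ltW.
pose e1 := (e / 2 / (k1 + 1))%R; pose d := (e / 2 / (k2 + 1))%R.
have e10 : (0 < e1)%R by rewrite !divr_gt0// ltr_wpDl.
have d0 : (0 < d)%R by rewrite !divr_gt0// ltr_wpDl.
have mQn n : measurable (Qn n : set (borel G)) by exact: (compact_borel hG).
have mHw : measurable_fun [set: borel G] (fun x => H1 x * (w x)%:E).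
  by apply: emeasurable_funM => //; exact: (mew hwa).
have Hw0 x : 0 <= H1 x * (w x)%:E by apply: mule_ge0; [exact: H10|exact: (ew0 hwa)].
have [n1 hn1] := integral_tail mHw Hw0 (le_lt_trans int_H1 (ltry _)) mQn ndQn UQn e10.
(* [residual_tail] cuts [gcheck] off at the inverse of its variable, so its tails are taken along
   the inverted exhaustion. *)
pose Rn n := [set z^-1 | z in Qn n]%g.
have RnE n z : Rn n z <-> Qn n (z^-1)%g.
  split=> [[t Qt <-]|Qz]; first by rewrite invgK.
  by exists (z^-1)%g => //; rewrite invgK.
have mRn n : measurable (Rn n : set (borel G)).
  by apply: (compact_borel hG); exact: compact_invset.
have ndRn n m : (n <= m)%N -> Rn n `<=` Rn m.
  by move=> nm z /RnE/(ndQn _ _ nm) /RnE.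
have URn : \bigcup_n Rn n = setT.
  apply/seteqP; split => // z _; have [n _ Qz] : (\bigcup_n Qn n) (z^-1)%g by rewrite UQn.
  by exists n => //; apply/RnE.
have gfin : \int[mu]_z gcheck z < +oo.
  have mgw : measurable_fun [set: borel G] (fun z => gcheck z * (w z)%:E).
    by apply: emeasurable_funM; [exact: measurable_gcheck|exact: (mew hwa)].
  have gw0 z : 0 <= gcheck z * (w z)%:E.
    by apply: mule_ge0; [exact: gcheck_ge0|exact: (ew0 hwa)].
  have cwi : 0 <= (cw^-1)%:E :> \bar R by rewrite lee_fin invr_ge0 ltW.
  apply: (@le_lt_trans _ _ ((cw^-1)%:E * \int[mu]_z (gcheck z * (w z)%:E))).
    rewrite -(ge0_integralZl mu measurableT mgw (fun z _ => gw0 z) cwi).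
    apply: ge0_le_integral.
    - exact: measurableT.
    - by move=> z _; exact: gcheck_ge0.
    - exact: measurable_gcheck.
    - exact: measurable_funeM mgw.
    move=> z _; rewrite muleCA -[leLHS]mule1; apply: lee_wpmul2l; first exact: gcheck_ge0.
    by rewrite -EFinM lee_fin mulrC ler_pdivlMr// mul1r.
  apply: (@le_lt_trans _ _ ((cw^-1)%:E * sg%:E)); last by rewrite -EFinM ltry.
  exact: lee_wpmul2l cwi _ _ intgb.
have [n2 hn2] := integral_tail measurable_gcheck gcheck_ge0 gfin mRn ndRn URn d0.
have hn2' : \int[mu]_z (gcheck z * eindic (~` Qn n2) (z^-1)%g) <= d%:E.
  apply: le_trans hn2; rewrite le_eqVlt; apply/orP; left; apply/eqP.
  apply: eq_integral => z _; congr (_ * _).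
  by apply/eqP; rewrite eq_le; apply/andP; split; apply: eindic_le => /= h h'; apply: h; apply/RnE.
exists (support (Qn n2) (Qn n1)); first exact: compact_support.
move=> f Sf; have Ef := SE Sf; have mf := BF_measurable hE Ef.
have nf : (0 <= nrm E f)%R by exact: (nrm_ge0 (BF_seminormed hE)).
have := hK _ _ hb d L f (cQn n2) (cQn n1) mhb hb0 H2hb (ltW d0) hn2' hL Sf.
move=> /(residual_le (compact_support (cQn n2) (cQn n1)) Sf hL) hres.
have mN : measurable_fun [set: borel G] (eindic (~` Qn n1) : G -> \bar R).
  by apply: measurable_eindic; exact: measurableC.
have d1 : dominated mu E (econv mu (absE f) (fun z => H1 z * eindic (~` Qn n1) z))
    (y * nrm E f * e1).
  apply: hy.
  - exact: measurable_ecmod.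
  - exact: emeasurable_funM.
  - by move=> x; rewrite lee_fin cmod_ge0.
  - by move=> x; apply: mule_ge0; [exact: H10|exact: eindic_ge0].
  - exact: dominated_self.
  by under eq_integral do rewrite muleAC.
have d2 : dominated mu E (econv mu (smooth f) hb) (y * (cF * nrm E f) * `|s|).
  apply: hy.
  - exact: measurable_smooth.
  - exact: mhb.
  - exact: smooth_ge0.
  - exact: hb0.
  - exact: hF.
  by apply: (le_trans inthb); rewrite lee_fin ler_norm.
have Kd0 : (0 <= K * d)%R by rewrite mulr_ge0// ltW.
apply: dominated_le hres _ (dominatedD hE (dominatedZ hE (normr_ge0 M) d1) (dominatedZ hE Kd0 d2)).
rewrite (_ : (_ + _)%R = ((k1 * e1 + k2 * d) * nrm E f)%R); last by rewrite /k1 /k2; ring.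
apply: ler_wpM2r => //.
have bound k : (0 <= k -> k * (e / 2 / (k + 1)) <= e / 2)%R.
  move=> k0; rewrite mulrCA mulrC -[leRHS]mul1r; apply: ler_wpM2r; first by rewrite divr_ge0// ltW.
  by rewrite ler_pdivrMr ?mul1r ?lerDl// ltr_wpDl.
by rewrite [leRHS](splitr e); apply: lerD; exact: bound.
Qed.

(** * Construction of the left inverse *)

Lemma EdB_lin a c d : EdB V E B Gam c -> EdB V E B Gam d -> EdB V E B Gam (a *: c + d)%R.
Proof.
move=> dc dd; have [Bc Ec _] := sequence_norm dc; have [Bd Ed _] := sequence_norm dd.
have sB := BF_seminormed hB'; have sE := BF_seminormed hE.
split=> [gam|]; first exact: (mem_lin sB).
have h := mem_lin sE (cmod a)%:C%C Ec Ed.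
apply: (proj1 (BF_solid hE h _ _)).
  by apply: measurable_toC; exact: (measurable_steps hG hGam).
apply: ae_all => x.
have -> : (((cmod a)%:C%C *: toC (steps V (norms B c)) + toC (steps V (norms B d)))%R x =
    (cmod a * steps V (norms B c) x + steps V (norms B d) x)%:C%C)%R.
  by rewrite rmorphD rmorphM.
rewrite !cmod_real ger0_norm; last exact: (steps_ge0 hG hGam).
apply: le_trans (ler_norm _).
have [L hL] := separated_exhausting hG hGam.
have := filterI (steps_near hG hGam (norms B c) x hL) (filterI (steps_near hG hGam (norms B d) x hL)
  (steps_near hG hGam (norms B (a *: c + d)%R) x hL)).
move=> [n _ /(_ n (leqnn n))[-> [-> ->]]].
rewrite mulr_sumr -big_split; apply: ler_sum => gam _.
have nE (b : Gam -> G -> R[i]) : B (b gam) -> cmod (norms B b gam) = nrm B (b gam).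
  by move=> Bb; rewrite cmod_real ger0_norm// (nrm_ge0 sB).
have tm (i : R) : (0 <= i)%R -> (cmod (norms B (a *: c + d) gam) * i <=
    cmod a * (cmod (norms B c gam) * i) + cmod (norms B d gam) * i)%R.
  move=> i0; rewrite mulrA -mulrDl; apply: ler_wpM2r => //.
  rewrite !nE//; last exact: (mem_lin sB).
  rewrite -(nrmZ sB)//; apply: (nrmD sB) => //; exact: (memZ sB).
by apply: tm.
Qed.

Lemma operator_E : exists2 c : R, (0 < c)%R & forall f r, locally_weighted mu V w f ->
  dominated mu E (absE f) r -> E (P f) /\ (nrm E (P f) <= c * r)%R.
Proof. exact: (operator_bounded hG hwa hP mHC hPH hE hw mH1 H10 HH1 int_H1). Qed.

(** [P] acts on functions, so compatibility with almost everywhere equality has to be derived: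
    linearity reduces it to [f - h], of norm [0], and boundedness on [E] concludes. *)
Lemma operator_congr f h : E f -> E h -> (\forall x \ae mu, f x = h x) ->
  \forall x \ae mu, P f x = P h x.
Proof.
move=> Ef Eh fh; have sE := BF_seminormed hE; have [c c0 hc] := operator_E.
have Efh := memB sE Ef Eh.
have n0 : nrm E (f - h)%R = 0%R.
  apply/(BF_nrm_eq0 hE Efh); apply: aeS fh => x fx.
  by rewrite -[(f - h)%R x]/(f x - h x)%R fx subrr.
have [EP] := hc _ _ (lwE Efh) (dominated_self mu Efh); rewrite n0 mulr0 => nP.
have nP0 : nrm E (P (f - h)%R) = 0%R.
  by apply/eqP; rewrite eq_le nP (nrm_ge0 sE EP).
move/(BF_nrm_eq0 hE EP) : nP0; apply: (aeS2 _ (operatorB hG hwa hP (lwE Ef) (lwE Eh))).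
by move=> x ->; exact: subr0_eq.
Qed.

(** The inner [P] takes the synthesis into [E]; only then does [hPE] place the outer [P] in [S]. *)
Lemma reconstruction_bounded_linear U : compact U ->
  bounded_linear (EdB V E B Gam) (subnspace S E) (fun c => P (P (synthesis U c))).
Proof.
move=> cU; have sE := BF_seminormed hE; have [k k0 hk] := operator_E.
have [C C0 hC] := synthesis_operator cU.
have lwS c : EdB V E B Gam c -> locally_weighted mu V w (synthesis U c).
  exact: synthesis_locally_weighted.
split=> [c dc|a c d dc dd|].
- by apply: hPE; case: (hC _ dc).
- have [Ec _] := hC _ dc; have [Ed' _] := hC _ dd.
  have dcd := EdB_lin a dc dd; have [Ecd _] := hC _ dcd.
  have El := mem_lin sE a Ec Ed'.
  have EPc := SE (hPE Ec); have EPd := SE (hPE Ed'); have EPcd := SE (hPE Ecd).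
  have Ez := memB sE EPcd (mem_lin sE a EPc EPd).
  apply/(BF_nrm_eq0 hE Ez).
  have h1 : \forall x \ae mu, P (synthesis U (a *: c + d)%R) x =
      ((a *: P (synthesis U c) + P (synthesis U d))%R) x.
    rewrite (synthesis_linear a c d cU).
    exact: (operator_linear hG hwa hP a (lwS _ dc) (lwS _ dd)).
  have h2 := operator_congr Ecd El h1.
  have h3 := operator_linear hG hwa hP a (lwE Ec) (lwE Ed').
  apply: (aeS2 _ h2 h3) => x e2 e3; apply/eqP; rewrite subr_eq0; apply/eqP.
  by rewrite e2 e3.
exists (k * C)%R => c dc; have [Ec nc] := hC _ dc.
have [_ nP] := hk _ _ (lwE Ec) (dominated_self mu Ec).
by apply: (le_trans nP); rewrite -mulrA; apply: ler_wpM2l => //; exact: ltW.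
Qed.

Lemma coefs_EdB f : S f -> EdB V E B Gam (coefs f).
Proof.
move=> Sf; have [c _ /(_ f Sf)[Ec _]] := coefs_bounded.
by split => // gam; exact: coefs_B.
Qed.

Lemma coefs_left_invertible : left_invertible (subnspace S E) (EdB V E B Gam) coefs.
Proof.
have sE := BF_seminormed hE; have [_ S0 linS _] := hS.
(* When all norms in [E] vanish, the zero map is a left inverse; otherwise [approximation]
   applies. *)
have [tri|ntri] := pselect (forall f, E f -> nrm E f = 0%R).
  exists (fun=> 0%R) => [|f Sf]; last first.
    by apply: tri; apply: memB => //; [exact: mem0|exact: SE].
  split=> [c _|a c d _ _|]; first exact: S0.
    by rewrite /= addr0 scaler0 subr0 tri//; exact: mem0.
  by exists 0%R => c _; rewrite /= mul0r tri//; exact: mem0.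
have [f0 Ef0 nf0] : exists2 f0, E f0 & nrm E f0 != 0%R.
  apply: contrapT => h; apply: ntri => f Ef; apply: contrapT => /eqP nf.
  by apply: h; exists f.
have [k k0 hk] := operator_E.
(* [k] bounds [P] and is used twice, so an error of [1 / (2 k k)] before applying [P] twice leaves
   at most half of the norm of [f]. *)
have e0 : (0 < 1 / (2 * k * k))%R by rewrite divr_gt0// !mulr_gt0.
have [U cU hU] := approximation Ef0 nf0 e0.
have hQ := reconstruction_bounded_linear cU.
have [C C0 hC] := synthesis_operator cU.
have [QS Qlin [CQ hCQ]] := hQ.
apply: (left_invertible_of_approximate (Q := fun c => P (P (synthesis U c)))).
- exact: sE.
- exact: (BF_complete hE).
- exact: hS.
- by move=> a c d; exact: EdB_lin.
- exact: coefs_EdB.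
- exact: hQ.
- move=> a f h Sf Sh; pose Q (c : Gam -> G -> R[i]) := P (P (synthesis U c)).
  have Sl := linS a f h Sf Sh.
  have df := coefs_EdB Sf; have dh := coefs_EdB Sh; have dl := coefs_EdB Sl.
  have dz := EdB_lin a df dh.
  (* [z] is the defect of linearity of [coefs], of norm [0]; splitting it off leaves the linearity
     of [Q]. *)
  pose z := (coefs (a *: f + h)%R - (a *: coefs f + coefs h))%R.
  have ddz : EdB V E B Gam z by rewrite /z addrC -scaleN1r; exact: EdB_lin.
  have nz : nrm (EdB V E B Gam) z = 0%R by exact: coefs_linear.
  have nQz : nrm E (Q z) = 0%R.
    apply/eqP; rewrite eq_le (nrm_ge0 sE (SE (QS _ ddz))) andbT.
    by have := hCQ _ ddz; rewrite nz mulr0.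
  have EQ c : EdB V E B Gam c -> E (Q c) by move=> /QS/SE.
  have E1 := memB sE (EQ _ dl) (mem_lin sE a (EQ _ df) (EQ _ dh)).
  apply/(BF_nrm_eq0 hE E1).
  have Q1 := Qlin 1%R z _ ddz dz; have Q2 := Qlin a _ _ df dh.
  have F1 : E (Q (1 *: z + (a *: coefs f + coefs h)) - (1 *: Q z + Q (a *: coefs f + coefs h)))%R.
    by apply: memB => //; [apply: EQ; exact: EdB_lin|apply: mem_lin => //; exact: EQ].
  have F2 : E (Q (a *: coefs f + coefs h) - (a *: Q (coefs f) + Q (coefs h)))%R.
    by apply: memB => //; [exact: EQ|apply: mem_lin => //; exact: EQ].
  move/(BF_nrm_eq0 hE F1): Q1; move/(BF_nrm_eq0 hE F2): Q2.
  move/(BF_nrm_eq0 hE (EQ _ ddz)): nQz => az a2 a1.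
  apply: (aeS2 _ a2 (aeI az a1)) => x h2 [hz h1].
  rewrite (_ : coefs (a *: f + h) = 1 *: z + (a *: coefs f + coefs h))%R; last first.
    by rewrite scale1r /z subrK.
  apply/eqP; rewrite subr_eq0; apply/eqP.
  move/eqP: h2; rewrite subr_eq0 => /eqP <-.
  move/eqP: h1; rewrite subr_eq0 => /eqP ->.
  by rewrite -[LHS]/((1 : R[i]) * Q z x + Q (a *: coefs f + coefs h) x)%R hz mulr0 add0r.
move=> f Sf; have Ef := SE Sf; have df := coefs_EdB Sf.
have [EF _] := hC _ df; have hd := hU f Sf.
have lwF := synthesis_locally_weighted cU df.
set Phi := synthesis U (coefs f) in EF hd lwF *.
have lwd : locally_weighted mu V w (f - Phi)%R.
  by have := locally_weighted_lin hG (-1) lwF (lwE Ef); rewrite scaleN1r addrC.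
have [EP1 nP1] := hk _ _ lwd hd.
have Ed1 : E (f - P Phi)%R by exact: memB.
have n1 : nrm E (f - P Phi)%R = nrm E (P (f - Phi)%R).
  apply: (proj2 (BF_ae hE EP1 (BF_measurable hE Ed1) _)).
  apply: (aeS2 _ (operatorB hG hwa hP (lwE Ef) lwF) (hPid Sf)) => x ->.
  by move=> ->.
have [EP2 nP2] := hk _ _ (lwE Ed1) (dominated_self mu Ed1).
have Ed2 : E (f - P (P Phi))%R by apply: memB => //; exact: SE (hPE EF).
have -> : nrm E (f - P (P Phi))%R = nrm E (P (f - P Phi)%R).
  apply: (proj2 (BF_ae hE EP2 (BF_measurable hE Ed2) _)).
  apply: (aeS2 _ (operatorB hG hwa hP (lwE Ef) (lwE EF)) (hPid Sf)) => x ->.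
  by move=> ->.
apply: (le_trans nP2); rewrite n1.
apply: (@le_trans _ _ (k * (k * (1 / (2 * k * k) * nrm E f)))%R).
  by apply: ler_wpM2l => //; exact: ltW.
rewrite le_eqVlt; apply/orP; left; apply/eqP.
by field; rewrite gt_eqF.
Qed.

Lemma coefs_frame :
  [/\ forall f gam, S f ->
        amalgam V (L1 mu) (Linf_inv mu w) (fun x => f x * eta gam x)%R,
      bounded_linear (subnspace S E) (EdB V E B Gam) coefs,
      left_invertible (subnspace S E) (EdB V E B Gam) coefs
    & exists c C : R, [/\ (0 < c)%R, (c <= C)%R & forall f, S f ->
        (c * nrm E f <= nrm (Ed V E Gam) (norms B (coefs f)) <= C * nrm E f)%R]].
Proof.
have sE := BF_seminormed hE; have [c1 c10 hc1] := coefs_bounded.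
have inv := coefs_left_invertible; split=> //.
- move=> f gam Sf; apply: (locally_weighted_domain hG hwa).
  exact: product_locally_weighted (SE Sf).
- split; [exact: coefs_EdB|exact: coefs_linear|].
  by exists c1 => f Sf; case: (hc1 f Sf).
have [D [DS _ [C0 hC0]] DK] := inv.
have c00 : (0 < `|C0| + 1)%R by rewrite ltr_wpDl.
(* The lower constant comes from a bound for the left inverse, the [1] keeping it positive; adding
   it to [c1] ensures that it does not exceed the upper constant. *)
exists (`|C0| + 1)^-1%R, (c1 + (`|C0| + 1)^-1)%R; split.
- by rewrite invr_gt0.
- by rewrite lerDr.
move=> f Sf; have [Ec nc] := hc1 f Sf; have Ef := SE Sf.
have nf := nrm_ge0 sE Ef.
have n0 : (0 <= nrm (Ed V E Gam) (norms B (coefs f)))%R by exact: (nrm_ge0 sE Ec).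
have dc := coefs_EdB Sf; have ED := SE (DS _ dc).
apply/andP; split; last first.
  by apply: (le_trans nc); apply: ler_wpM2r => //; rewrite lerDl invr_ge0 ltW.
rewrite mulrC ler_pdivrMr// mulrC.
have h1 := nrm_leB sE Ef ED.
have h2 : nrm E (f - D (coefs f))%R = 0%R.
  by rewrite (nrm_distC sE Ef ED); exact: DK.
apply: (le_trans h1); rewrite h2 add0r; apply: (le_trans (hC0 _ dc)).
apply: ler_wpM2r; first exact: n0.
by rewrite (le_trans (ler_norm _))// lerDl.
Qed.

End frame.

Theorem theorem3 (R : realType) (G : topologicalGroupType)
  (mu : {measure set (borel G) -> \bar R}) (Delta : G -> R) (V : set G)
  (hT2 : hausdorff_space G) (hlc : locally_compact [set: G])
  (hsc : sigma_compact G) (hmu : left_haar mu)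
  (hDelta : modular_function mu Delta) (hV : window V)
  (E : nspace (G -> R[i])) (w : G -> R) (S : (G -> R[i]) -> Prop)
  (hE : solid_TI_BF mu Delta E) (hw : admissible_for Delta E w)
  (hS : closed_complemented S E)
  (P : (G -> R[i]) -> (G -> R[i]))
  (hP : bounded_linear (amalgam V (L1 mu) (Linf_inv mu w)) (Linf_inv mu w) P)
  (hPE : forall f, E f -> S (P f))
  (hPsurj : forall s, S s -> exists2 f, E f & \forall x \ae mu, P f x = s x)
  (hPid : forall f, S f -> \forall x \ae mu, P f x = f x)
  (H : G -> R)
  (hHl : amalgam V (Linf mu) (L1w mu w) (toC H))
  (hHr : amalgamR V (Linf mu) (L1w mu w) (toC H))
  (hPH : forall f, amalgam V (L1 mu) (Linf_inv mu w) f ->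
     \forall x \ae mu,
       ((cmod (P f x))%:E
          <= \int[mu]_y (cmod (f y) * H (y^-1 * x)%g)%:E)%E)
  (Gam : set G) (hGam : relatively_separated V Gam)
  (eta : Gam -> G -> R[i]) (heta_meas : forall gam, measurable_cfun (eta gam))
  (g : G -> R) (hg : weak_amalgamR mu V w (toC g))
  (heta_g : forall gam x, cmod (eta gam x) <= g ((\val gam)^-1 * x)%g)
  (heta_sum : \forall x \ae mu, unconditional_sum (fun gam => eta gam x) 1)
  (heta_bnd : exists M : R, \forall x \ae mu,
     (\esum_(gam in [set: Gam]) (cmod (eta gam x))%:E <= M%:E)%E)
  (B : nspace (G -> R[i])) (hB : solid_isometric_TI_BF mu Delta B)
  (hWB : embedded (amalgam V (Linf mu) (L1w mu w)) B) :
  let CB : (G -> R[i]) -> (Gam -> G -> R[i]) :=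
    fun f gam => P (fun x => f x * eta gam x) in
  [/\ forall f gam, S f ->
        amalgam V (L1 mu) (Linf_inv mu w) (fun x => f x * eta gam x),
      bounded_linear (subnspace S E) (EdB V E B Gam) CB,
      left_invertible (subnspace S E) (EdB V E B Gam) CB
    & exists c C : R, [/\ 0 < c, c <= C & forall f, S f ->
        c * nrm E f <= nrm (Ed V E Gam) (norms B (CB f)) <= C * nrm E f]].
Proof.
move=> CB; have hG : haar_group mu Delta V by [].
have [hwa _] := hw; have [hSc _] := hS.
have BH : B (toC H) by exact: (proj1 hWB).
have [H1 [Hs [s1 [[mH1 H10] [mHs Hs0] HH1 H1s intHs]]]] := left_majorant hG hwa hHl.
have [H2 [mH2 H20 HH2 H2b]] := right_majorant hG hwa hHr.
have [hg1 hg2] := hg.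
have [g1 [mg1 g10 gg1 g1b]] := right_majorant hG hwa hg2.
have [_ _ cV _] := hV; have [gb [sg [[mgb gb0] g1gb _ intgb]]] := g1b _ cV.
have [M hM] := heta_bnd.
have H2b' Q : compact Q -> exists (hs : G -> \bar R) (s : R),
    [/\ measurable_fun [set: borel G] hs /\ (forall x, (0 <= hs x)%E),
        forall q t, Q q -> (H2 (q * t)%g <= hs t)%E
      & (\int[mu]_x (hs x * (w x)%:E) <= s%:E)%E].
  by move=> /H2b[hs [s [h1 h2 h3 _]]]; exists hs, s.
exact: (coefs_frame hG hE hw hSc hP hPE hPid hPH hGam heta_meas hg1 heta_g
  heta_sum hM hB BH mH1 H10 mHs Hs0 HH1 H1s intHs mH2 H20 HH2 H2b' mg1 g10 gg1
  mgb gb0 g1gb intgb).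
Qed.
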